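(* Let $\theta=(\nu,Q,(f_x)_{x\in\mathbb{X}})$ be a parameter such that $\delta:=\min_{x,x'}Q_{x,x'}>0$ and $\min_x\nu_x\ge\delta$. Let $\Lambda=\int_{\mathbb{Y}}\min_{x_0\in\mathbb{X}}\left[\sum_{x\ne x_0}f_x(y)\right]d\mathcal{L}(y)$, $\beta=\min_{1\le i\le n,\ j\ne k\in\mathbb{X}}\mathbb{P}_\theta(X_i\in\{j,k\})$ and $\rho_0=\frac{1-J\delta}{1-(J-1)\delta}$. (1) Let $J=2$. If $\theta\in\Theta^{\mathrm{ind}}$ and $n\ge2$, then $$(1-\alpha_n)\delta\Lambda\le\inf_{g\in\mathcal{G}_n}\mathcal{R}_n^{\mathrm{clust}}(\theta,g)\le(1-\delta)\Lambda,$$ where, with $\varepsilon_{n,\theta}=\frac12-\inf_{h\in\mathcal{H}_n}\mathcal{R}_n^{\mathrm{class}}(\theta,h)$, $$\alpha_n=2\min\left(2(1+2\varepsilon_{n,\theta})\frac{(1-4\varepsilon_{n,\theta}^2)^{\frac{n-2}2}}{n\log\left(\frac{1+2\varepsilon_{n,\theta}}{1-2\varepsilon_{n,\theta}}\right)},\ \frac1{1-2\varepsilon_{n,\theta}}\sqrt{\frac{\pi}{2n}}\right)$$ (the first term in the minimum being $+\infty$ if $\varepsilon_{n,\theta}=0$, and $\alpha_n=0$ if $\varepsilon_{n,\theta}=\frac12$). If $\theta\in\Theta^{\mathrm{dep}}$ and $n\ge1$, then $$\frac{\delta^2(1-\tilde\alpha_n)}{1-\delta}\Lambda\le\inf_{g\in\mathcal{G}_n}\mathcal{R}_n^{\mathrm{clust}}(\theta,g)\le(1-\delta)\Lambda,\qquad\tilde\alpha_n=2e\left(\tfrac{1-\delta}{\delta}\right)^4\left[\tfrac{1-\delta}{\delta}\sqrt{\tfrac{\log2}{2n}}\right]^{1-2/n}.$$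 (2) Let $J>2$ and $\theta\in\Theta^{\mathrm{ind}}$. If $\delta\Lambda\ge4J^2e^{-n\beta/8}$ and $n$ is large enough that $\xi_n:=\frac{4e}{\beta}\left[\sqrt{\log(J!)/(2n)}\right]^{1-4/(n\beta)}\le\frac12$, then $$\frac\delta4\Lambda\le\inf_{g\in\mathcal{G}_n}\mathcal{R}_n^{\mathrm{clust}}(\theta,g)\le(1-(J-1)\delta)\Lambda.$$ (3) Let $J>2$ and $\theta\in\Theta^{\mathrm{dep}}$. If $\delta^2\Lambda\ge4(1-(J-1)\delta)(J^2+1)e^{-2n(1-\rho_0)^2\beta^2/25}$ and $n$ is large enough that $\tilde\xi_n:=\frac5{\beta(1-\rho_0)}\sqrt{\frac{\log(J!)}{2n}}\le\frac12$, then $$\frac{\delta^2}{4(1-\delta)}\Lambda\le\inf_{g\in\mathcal{G}_n}\mathcal{R}_n^{\mathrm{clust}}(\theta,g)\le(1-(J-1)\delta)\Lambda.$$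
   Context: Model. $J\ge2$ is an integer, $\mathbb{X}=\{1,\dots,J\}$, $(\mathbb{Y},\mathcal{Y})$ is a Polish space with its Borel $\sigma$-field and $\mathcal{L}$ is a dominating ($\sigma$-finite) measure on it. A parameter is $\theta=(\nu,Q,(f_x)_{x\in\mathbb{X}})$ with $\nu$ a probability vector on $\mathbb{X}$, $Q$ a $J\times J$ transition matrix and $f_x$ probability densities with respect to $\mathcal{L}$. Under $\mathbb{P}_\theta$ (expectation $\mathbb{E}_\theta$), $(X_i)_{i\ge1}$ is a Markov chain on $\mathbb{X}$ with initial law $\nu$ and transition matrix $Q$ and, conditionally on $(X_i)_{i\ge 1}$, the $Y_i$ are independent, $Y_i$ having density $f_{X_i}$. $Y_{1:n}=(Y_1,\dots,Y_n)$. $\Theta^{\mathrm{ind}}$ is the set of parameters for which all rows of $Q$ equal $\nu$ (i.i.d. labels); $\Theta^{\mathrm{dep}}$ is the set of parameters for which the rows of $Q$ are not all equal. Risks. $\mathcal{P}[n]$ is the set of partitions of $[n]=\{1,\dots,n\}$. $\mathcal{G}_n$ is the set of measurable maps $g:\mathbb{Y}^n\to\mathcal{P}[n]$ (clusterers) and $\mathcal{H}_n$ the set of measurable maps $h=(h_1,\dots,h_n):\mathbb{Y}^n\to\mathbb{X}^n$ (classifiers). $\Pi_n$ is the partition of $[n]$ into the nonempty sets among $\{i:X_i=x\}$, $x\in\mathbb{X}$. For partitions $A,B$ of $[n]$, $\ell(A,B)=1-\frac1n\sup_M\sum_{\{C,C'\}\in M}\mathrm{Card}(C\cap C')$, the supremum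 being over matchings $M$ between the blocks of $A$ and the blocks of $B$ in the complete bipartite graph (each block is in at most one edge). $\mathcal{R}_n^{\mathrm{clust}}(\theta,g)=\mathbb{E}_\theta[\ell(g(Y_{1:n}),\Pi_n)]$ and $\mathcal{R}_n^{\mathrm{class}}(\theta,h)=\mathbb{E}_\theta[\frac1n\sum_{i=1}^n\mathbf{1}_{h_i(Y_{1:n})\ne X_i}]$. *)

(* Defs.v *)
(* MathComp-Analysis; every development below is over an abstract realType. *)
From HB Require Import structures.
From mathcomp Require Import all_boot all_order all_algebra.
From mathcomp Require Import all_classical all_reals all_analysis.
Set Implicit Arguments.
Unset Strict Implicit.
Unset Printing Implicit Defensive.
Import Order.TTheory GRing.Theory Num.Theory.
Import numFieldNormedType.Exports.
Local Open Scope classical_set_scope.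
Local Open Scope ring_scope.

(* Conventions.
   - Times and observations are indexed from 0: [X i], [Y i] stand for X_{i+1},
     Y_{i+1}; [n] = {1, ..., n} is ['I_n] and the label set is ['I_J].
   - A minimum over a nonempty finite index set is written as the [inf] of the
     set of values, which is then attained. *)

(* Separable and completely metrizable. *)
Definition polish (R : realType) (T : topologicalType) : Prop :=
  (exists2 D : set T, countable D & dense D) /\
  exists dist : T -> T -> R,
    [/\ forall x y, 0 <= dist x y,
        forall x y, dist x y = 0 <-> x = y,
        forall x y, dist x y = dist y x,
        forall x y z, dist x z <= dist x y + dist y z &
        (forall A : set T, open A <->
           forall x, A x -> exists2 e : R, 0 < e & [set y | dist x y < e] `<=` A)
        /\
        (forall u : nat -> T,
           (forall e : R, 0 < e -> exists N : nat,
              forall m n, (N <= m)%N -> (N <= n)%N -> dist (u m) (u n) < e) ->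
           exists l : T, u @ \oo --> l)].

Notation borel T := (g_sigma_algebraType (@open T)).

Section HMM.
Context {R : realType} {J : nat} {dY : measure_display} {TY : measurableType dY}.
Variable L : {measure set TY -> \bar R}.

Record hmm_param : Type := HmmParam {
  hmm_nu : 'I_J -> R;
  hmm_Q : 'M[R]_J;
  hmm_f : 'I_J -> TY -> R;
  hmm_nu_ge0 : forall x, 0 <= hmm_nu x;
  hmm_nu_sum1 : \sum_x hmm_nu x = 1;
  hmm_Q_ge0 : forall x x', 0 <= hmm_Q x x';
  hmm_Q_sum1 : forall x, \sum_x' hmm_Q x x' = 1;
  hmm_f_measurable : forall x, measurable_fun [set: TY] (hmm_f x);
  hmm_f_ge0 : forall x y, 0 <= hmm_f x y;
  hmm_f_int1 : forall x, (\int[L]_y (hmm_f x y)%:E = 1)%E }.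

Definition Theta_ind (theta : hmm_param) : Prop :=
  forall x x', hmm_Q theta x x' = hmm_nu theta x'.

Definition Theta_dep (theta : hmm_param) : Prop :=
  exists x1 x2, row x1 (hmm_Q theta) <> row x2 (hmm_Q theta).

Definition minQ (theta : hmm_param) : R :=
  inf [set hmm_Q theta xx.1 xx.2 | xx in [set: 'I_J * 'I_J]].

Definition minnu (theta : hmm_param) : R := inf (range (hmm_nu theta)).

Definition Lambda (theta : hmm_param) : R :=
  \int[L]_y inf [set \sum_(x | x != x0) hmm_f theta x y | x0 in [set: 'I_J]].

Definition rho0 (delta : R) : R :=
  (1 - J%:R * delta) / (1 - (J%:R - 1) * delta).

Section Process.
Context {d : measure_display} {Omega : measurableType d}.
Variables (P : probability Omega R) (X : nat -> Omega -> 'I_J)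
  (Y : nat -> Omega -> TY).

Definition label_path (x : nat -> 'I_J) (n : nat) : set Omega :=
  [set w | forall i, (i < n)%N -> X i w = x i].

(* The Markov property is written multiplicatively to allow conditioning events
   of probability 0. *)
Definition markov_chain (p : 'I_J -> R) (q : 'M[R]_J) : Prop :=
  [/\ forall i x, measurable (X i @^-1` [set x]),
      forall x, P (X 0%N @^-1` [set x]) = (p x)%:E &
      forall (n : nat) (x : nat -> 'I_J),
        P (label_path x n.+2) =
          (P (label_path x n.+1) * (q (x n) (x n.+1))%:E)%E].

(* Since n is arbitrary and the A i may be setT, the second clause determines
   the conditional law of (Y i)_i given the whole sequence (X i)_i. *)
Definition conditionally_independent_emissions
    (g : 'I_J -> TY -> R) : Prop :=
  (forall i, measurable_fun [set: Omega] (Y i)) /\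
  forall (n : nat) (x : nat -> 'I_J) (A : nat -> set TY),
    (forall i, measurable (A i)) ->
    P (label_path x n `&` [set w | forall i, (i < n)%N -> A i (Y i w)]) =
      (P (label_path x n) *
       (\prod_(i < n) (\int[L]_(t in A i) g (x i) t)%R)%:E)%E.

(* (X, Y) is distributed under P as under P_theta. *)
Definition is_hmm (theta : hmm_param) : Prop :=
  markov_chain (hmm_nu theta) (hmm_Q theta) /\
  conditionally_independent_emissions (hmm_f theta).

Definition pair_beta (n : nat) : R :=
  inf [set b | exists (i : 'I_n) (j k : 'I_J),
    j != k /\ b = fine (P (X i @^-1` [set j; k]))].

End Process.

End HMM.

Arguments hmm_param {R} J {dY TY} L.
Arguments rho0 {R} J delta.

(* The bipartite graph has the disjoint union of A and B as vertices, so a set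
   of edges is a set of ordered pairs in A x B, even if A and B share blocks. *)
Definition is_matching (n : nat) (A B : {set {set 'I_n}})
    (M : {set {set 'I_n} * {set 'I_n}}) : bool :=
  [&& M \subset finset.setX A B,
      [forall e in M, forall e' in M, (e.1 == e'.1) ==> (e == e')] &
      [forall e in M, forall e' in M, (e.2 == e'.2) ==> (e == e')]].

Definition clust_loss (R : realType) (n : nat) (A B : {set {set 'I_n}}) : R :=
  1 - n%:R^-1 *
    (\max_(M : {set {set 'I_n} * {set 'I_n}} | is_matching A B M)
       \sum_(e in M) #|e.1 :&: e.2|)%:R.

(* Measurability is for the product sigma-algebra on tuples and the discrete
   sigma-algebra on the finite codomain. *)
Definition clusterers (n : nat) (d : measure_display) (T : measurableType d) :
    set (n.-tuple T -> {set {set 'I_n}}) :=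
  [set g | (forall y, finset.partition (g y) [set: 'I_n]%SET) /\
           (forall p, measurable (g @^-1` [set p]))].

Definition classifiers (J n : nat) (d : measure_display)
    (T : measurableType d) : set (n.-tuple T -> n.-tuple 'I_J) :=
  [set h | forall z, measurable (h @^-1` [set z])].

Section Risks.
Context {R : realType} {J : nat} {dY : measure_display} {TY : measurableType dY}.
Context {d : measure_display} {Omega : measurableType d}.
Variables (P : probability Omega R) (X : nat -> Omega -> 'I_J)
  (Y : nat -> Omega -> TY) (n : nat).

Definition obs (w : Omega) : n.-tuple TY := [tuple Y i w | i < n].

Definition label_partition (w : Omega) : {set {set 'I_n}} :=
  finset.preim_partition (fun i : 'I_n => X i w) [set: 'I_n]%SET.

Definition clust_risk (g : n.-tuple TY -> {set {set 'I_n}}) : R :=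
  fine 'E_P[fun w => clust_loss R (g (obs w)) (label_partition w)].

Definition class_risk (h : n.-tuple TY -> n.-tuple 'I_J) : R :=
  fine 'E_P[fun w => n%:R^-1 *
    \sum_(i < n) (tnth (h (obs w)) i != X i w)%:R].

Definition inf_clust_risk : R :=
  inf [set clust_risk g | g in @clusterers n _ TY].

Definition inf_class_risk : R :=
  inf [set class_risk h | h in @classifiers J n _ TY].

Definition epsilon : R := 2^-1 - inf_class_risk.

End Risks.

Section Rates.
Context {R : realType}.

Definition alpha (n : nat) (eps : R) : R :=
  let t1 := 2 * (1 + 2 * eps) * (1 - 4 * eps ^+ 2) `^ ((n%:R - 2) / 2) /
    (n%:R * ln ((1 + 2 * eps) / (1 - 2 * eps))) in
  let t2 := (1 - 2 * eps)^-1 * Num.sqrt (pi / (2 * n%:R)) in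
  if eps == 2^-1 then 0
  else if eps == 0 then 2 * t2 (* t1 = +oo *)
  else 2 * Num.min t1 t2.

Definition alpha_tilde (n : nat) (delta : R) : R :=
  2 * expR 1 * ((1 - delta) / delta) ^+ 4 *
  ((1 - delta) / delta * Num.sqrt (ln 2 / (2 * n%:R))) `^ (1 - 2 / n%:R).

Definition xi (J n : nat) (beta : R) : R :=
  4 * expR 1 / beta *
  Num.sqrt (ln (J`!)%:R / (2 * n%:R)) `^ (1 - 4 / (n%:R * beta)).

Definition xi_tilde (J n : nat) (beta rho : R) : R :=
  5 / (beta * (1 - rho)) * Num.sqrt (ln (J`!)%:R / (2 * n%:R)).

End Rates.

(* Main.v *)
Require Import Defs.
From HB Require Import structures.
From mathcomp Require Import all_boot all_order all_algebra.
From mathcomp Require Import all_classical all_reals all_analysis.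
From mathcomp Require Import measurable_realfun.
From mathcomp Require Import ring lra zify.
Set Implicit Arguments.
Unset Strict Implicit.
Unset Printing Implicit Defensive.
Import Order.TTheory GRing.Theory Num.Theory.
Import numFieldNormedType.Exports.
Local Open Scope ring_scope.

(** The upper bound comes from a classifier: grouping the points by guessed label loses at most the
    classification error ([clust_loss_le]). Guessing at each point the label whose density is
    largest at the observation errs at time i with probability sum_a P(X_i = a) times the f_a-mass
    of the observations not assigned to a. Summed over a, these masses are [Lambda], so a bound on
    the label probabilities gives [risk_upper].

    For the lower bounds, each label path is reweighted so that the labels become uniform and
    independent. The observations are then i.i.d. with the average density, and a risk becomes the
    integral over observations of sum_x [post] w x * loss, where [post] is an unnormalised posterior
    ([expectation_change]). A clusterer sees only the observations, so it suffices to bound, for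
    each observation w and each partition A, the sum over x of [post] w x * (n - [gain] A x) from
    below ([risk_ge]). Here [gain] is the largest number of points hit when disjoint blocks are
    assigned to labels. Integrating back turns conditional error probabilities of single labels into
    multiples of [Lambda].

    Two mechanisms bound the number of misses.

    Many errors ([dense_bound]): the hits are the conditional probabilities of the guessed labels
    plus centred residuals. Residuals of two distinct labels at times of equal parity are
    orthogonal, because such labels are not neighbours in the chain. The residuals therefore
    contribute only a square root, uniformly over the blocks.

    Few errors ([sparse_bound]): fix all labels but one. If two of its values a and b are both hit,
    the same block served a in one case and b in the other, so every other point labelled a or b is
    missed in one of them ([misses_conflict]). When misses are rare and every pair of labels is
    frequent, at most one value of each label is hit, and the conditional miss probability is at
    least the local error.

    For two labels only the two largest blocks matter ([gain_two_blocks]), and the misses are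
    controlled by the mean of |sum_i e_i sign(x_i)| with e_i in {-1, 0, 1}. For independent labels
    this mean is estimated by viewing each label as known or as a fair coin
    ([binary_independent_le]). The optimal exponential parameter gives the first term of [alpha],
    the residual method the second ([alpha_bound]). For dependent labels [alpha_tilde] is at least 3
    / sqrt n, and the dense and sparse bounds together lose at most that much ([dep_lower]).

    For more than two labels the smallness of [xi] or [xi_tilde] makes n * beta large compared with
    J and with J^2 times the variance factor of the chain ([xi_conditions], [xi_tilde_conditions]).
    A variance bound for the chain ([plaw_variance]) then makes all pair counts large with
    probability at least 11/16, and one of the two mechanisms leaves a quarter of the local error
    ([multi_risk]). *)

(* Splitting the indices by parity makes the summands of each half
   uncorrelated, at the cost of a factor 2. *)
Lemma sq_sum_parity (R : realFieldType) n (e : 'I_n -> R) :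
  (\sum_i e i) ^+ 2 <= 2 * \sum_(i < n) \sum_(j < n | odd j == odd i) e i * e j.
Proof.
have split (F : 'I_n -> R) : \sum_i F i =
    \sum_(i < n | odd i) F i + \sum_(i < n | ~~ odd i) F i.
  exact: (bigID (fun i : 'I_n => odd i)).
pose u := \sum_(i < n | odd i) e i; pose v := \sum_(i < n | ~~ odd i) e i.
have -> : \sum_(i < n) \sum_(j < n | odd j == odd i) e i * e j = u * u + v * v.
  rewrite split; congr (_ + _); rewrite mulr_suml; apply: eq_bigr => i oi;
  rewrite mulr_sumr; apply: eq_bigl => j; first by rewrite oi eqb_id.
  by rewrite (negPf oi) eqbF_neg.
rewrite split -/u -/v; have := sqr_ge0 (u - v); nra.
Qed.

(** * Resampling one label: conditional laws, residuals and their orthogonality *)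

Section Paths.
Variables (R : realFieldType) (n : nat) (K : finType).
Local Notation path := {ffun 'I_n -> K}.
Implicit Types (x : path) (i j : 'I_n) (a b c : K) (F G pi : path -> R).

Definition upd x i a : path := [ffun j => if j == i then a else x j].

Lemma updE x i a j : upd x i a j = if j == i then a else x j.
Proof. by rewrite ffunE. Qed.

Lemma upd_same x i a : upd x i a i = a.
Proof. by rewrite updE eqxx. Qed.

Lemma upd_upd x i a b : upd (upd x i a) i b = upd x i b.
Proof. by apply/ffunP => j; rewrite !updE; case: eqP. Qed.

Lemma upd_id x i : upd x i (x i) = x.
Proof. by apply/ffunP => j; rewrite updE; case: eqP => // ->. Qed.

(** Exchanging the label at [i] with the free label is an involution of the pairs (path, label). *)
Lemma sum_upd F i : \sum_x \sum_a F (upd x i a) = #|K|%:R * \sum_x F x.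
Proof.
rewrite pair_big /=.
pose h (q : path * K) := (upd q.1 i q.2, q.1 i).
have hK : involutive h.
  by case=> x a; rewrite /h /= upd_same upd_upd upd_id.
rewrite (reindex_inj (inv_inj hK)) /=.
under eq_bigr => q _ do rewrite upd_upd upd_id.
rewrite -(pair_big xpredT xpredT (fun x (_ : K) => F x)) /= mulr_sumr.
by apply: eq_bigr => x _; rewrite sumr_const mulr_natl.
Qed.

(** By [sum_upd], summing over all fibres in direction [i] counts each path equally often, so sums
    may be compared fibre by fibre. All later conditioning on the other labels goes through this
    lemma or [fiber_eq]. *)
Lemma fiber_le i F G : (forall x, \sum_a F (upd x i a) <= \sum_a G (upd x i a)) ->
  \sum_x F x <= \sum_x G x.
Proof.
move=> FG; have [K0|K0] := posnP #|K|.
  rewrite !big1// => x _; by have := card0_eq K0 (x i); rewrite !inE.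
rewrite -(ler_pM2l (x := #|K|%:R)) ?ltr0n// -!(sum_upd _ i).
by apply: ler_sum => x _.
Qed.

Lemma fiber_eq i F G : (forall x, \sum_a F (upd x i a) = \sum_a G (upd x i a)) ->
  \sum_x F x = \sum_x G x.
Proof.
by move=> FG; apply/le_anti/andP; split; apply: (fiber_le (i := i)) => x; rewrite FG.
Qed.

Section Local.
Variable pi : path -> R.
Hypothesis pi_ge0 : forall x, 0 <= pi x.

Definition fib i x := \sum_a pi (upd x i a).
(** Conditional probability that label [i] is [a] given all other labels, for the unnormalised
    weight [pi]. On a fibre of weight zero it is 0, which is why [sum_cp_le1] is only an
    inequality. *)
Definition cp i a x := pi (upd x i a) / fib i x.

Lemma fib_ge0 i x : 0 <= fib i x.
Proof. exact: sumr_ge0. Qed.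

Lemma pi_le_fib i x a : pi (upd x i a) <= fib i x.
Proof. by rewrite /fib (bigD1 a)//= lerDl sumr_ge0. Qed.

Lemma fib_upd i x a : fib i (upd x i a) = fib i x.
Proof. by apply: eq_bigr => b _; rewrite upd_upd. Qed.

Lemma cp_upd i a x b : cp i a (upd x i b) = cp i a x.
Proof. by rewrite /cp fib_upd upd_upd. Qed.

Lemma cp_ge0 i a x : 0 <= cp i a x.
Proof. by rewrite divr_ge0// fib_ge0. Qed.

Lemma fib0_pi i x a : fib i x = 0 -> pi (upd x i a) = 0.
Proof. by move=> f0; apply/le_anti; rewrite pi_ge0 -f0 pi_le_fib. Qed.

Lemma cp_fib i a x : cp i a x * fib i x = pi (upd x i a).
Proof.
rewrite /cp; have [f0|f0] := eqVneq (fib i x) 0.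
  by rewrite f0 mulr0 fib0_pi.
by rewrite divfK.
Qed.

Lemma sum_cp_le1 i x : \sum_a cp i a x <= 1.
Proof.
rewrite -mulr_suml -/(fib i x); have [->|f0] := eqVneq (fib i x) 0.
  by rewrite mul0r ler01.
by rewrite divff.
Qed.

Lemma cp_le1 i a x : cp i a x <= 1.
Proof.
apply: le_trans (sum_cp_le1 i x); rewrite (bigD1 a)//= lerDl.
by apply: sumr_ge0 => b _; exact: cp_ge0.
Qed.

(** Error probability of the best guess of label [i] knowing all the others; its value is 1 on a
    fibre of weight zero. *)
Definition mu i x := 1 - \big[Num.max/0]_a cp i a x.

Lemma cp_le_mu i a x : cp i a x <= 1 - mu i x.
Proof. by rewrite /mu subKr; apply: (@le_bigmax _ _ _ _ (cp i ^~ x) a). Qed.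

Lemma mu_le1 i x : mu i x <= 1.
Proof. by rewrite /mu lerBlDr lerDl; apply: bigmax_ge_id. Qed.

Lemma mu_attained i x : exists a, mu i x = 1 - cp i a x.
Proof.
have [a _ e] := @eq_bigmax _ _ _ 0 (x i) xpredT (cp i ^~ x) isT
  (fun a _ => cp_ge0 i a x).
by exists a; rewrite /mu e.
Qed.

(** The most likely label contributes at most its complementary probability [mu], and the other
    labels together have probability at most [mu]. *)
Lemma sum_cp_var i x : \sum_a cp i a x * (1 - cp i a x) <= 2 * mu i x.
Proof.
have [a ea] := mu_attained i x; rewrite (bigD1 a)//= ea.
have h : \sum_(b | b != a) cp i b x * (1 - cp i b x) <= 1 - cp i a x.
  rewrite lerBrDl; apply: le_trans (sum_cp_le1 i x).
  rewrite [leRHS](bigD1 a)//= lerD2l; apply: ler_sum => b _.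
  by rewrite ler_piMr ?cp_ge0// lerBlDr lerDl cp_ge0.
rewrite mulr_natl mulr2n; apply: lerD => //.
by rewrite ler_piMl ?cp_le1// subr_ge0 cp_le1.
Qed.

Definition resid i a x : R := (x i == a)%:R - cp i a x.

Lemma resid_upd i a x b : resid i a (upd x i b) = (b == a)%:R - cp i a x.
Proof. by rewrite /resid upd_same cp_upd. Qed.

Lemma fiber_resid i a x : \sum_c pi (upd x i c) * resid i a (upd x i c) = 0.
Proof.
under eq_bigr => c _ do rewrite resid_upd mulrBr.
rewrite sumrB -mulr_suml -/(fib i x) mulrC cp_fib (bigD1 a)//= eqxx mulr1.
rewrite big1 ?addr0 ?subrr// => c ca.
by rewrite (negPf ca) mulr0.
Qed.

(** Conditional independence of labels [i] and [j] given all the others: the two-by-two minors of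
    the weight vanish. No division occurs, so null fibres are allowed. *)
Definition cross i j := forall x a a' b b',
  pi (upd (upd x i a) j b) * pi (upd (upd x i a') j b') =
  pi (upd (upd x i a) j b') * pi (upd (upd x i a') j b).

(** Under conditional independence the conditional law of label [j] does not change along the fibre
    of [i]. The constant is the ratio of the sums over that fibre, and the factor [pi] absorbs the
    points of weight zero. *)
Lemma cross_cp i j x b : cross i j -> exists k, forall c,
  pi (upd x i c) * cp j b (upd x i c) = pi (upd x i c) * k.
Proof.
move=> cr.
exists ((\sum_c pi (upd (upd x i c) j b)) / \sum_c fib j (upd x i c)) => c.
have [f0|f0] := eqVneq (fib j (upd x i c)) 0.
  by rewrite -(upd_id (upd x i c) j) fib0_pi// !mul0r.
have S0 : \sum_c fib j (upd x i c) != 0.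
  apply: contraNneq f0 => /eqP; rewrite psumr_eq0 => [/allP/(_ c)|? _].
    by rewrite mem_index_enum => /(_ isT) /eqP ->.
  exact: fib_ge0.
congr (_ * _); apply/eqP; rewrite /cp eqr_div//; apply/eqP.
rewrite mulr_sumr mulr_suml; apply: eq_bigr => c' _.
rewrite /fib mulr_sumr mulr_sumr; apply: eq_bigr => b' _.
by rewrite mulrC [in RHS]mulrC cr mulrC.
Qed.

(** Along the fibre of [i] the residual at [j] is constant on the support of [pi], while the
    residual at [i] sums to zero there. *)
Lemma resid_orth i j a b : i != j -> cross i j ->
  \sum_x pi x * (resid i a x * resid j b x) = 0.
Proof.
move=> ij cr; transitivity (\sum_(x : path) (0 : R)); last by rewrite big1.
apply: (fiber_eq (i := i)) => x; rewrite [RHS]big1//.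
have [k hk] := cross_cp x b cr.
transitivity (\sum_c ((x j == b)%:R - k) * (pi (upd x i c) * resid i a (upd x i c))).
  apply: eq_bigr => c _; rewrite [resid j b _]/resid updE [j == i]eq_sym (negPf ij).
  have -> : forall P X B C : R, P * (X * (B - C)) = X * (P * B - P * C).
    by move=> *; ring.
  by rewrite hk; ring.
by rewrite -mulr_sumr fiber_resid mulr0.
Qed.

Lemma resid_var i a :
  \sum_x pi x * resid i a x ^+ 2 = \sum_x pi x * (cp i a x * (1 - cp i a x)).
Proof.
apply: (fiber_eq (i := i)) => x.
under eq_bigr => c _ do rewrite resid_upd.
under [RHS]eq_bigr => c _ do rewrite !cp_upd.
rewrite -[RHS]mulr_suml -/(fib i x).
transitivity (\sum_c (pi (upd x i c) * (c == a)%:R * (1 - 2 * cp i a x)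
    + pi (upd x i c) * cp i a x ^+ 2)).
  by apply: eq_bigr => c _; case: (c == a) => /=; ring.
rewrite big_split/= -!mulr_suml -/(fib i x).
have -> : \sum_c pi (upd x i c) * (c == a)%:R = cp i a x * fib i x.
  rewrite cp_fib (bigD1 a)//= eqxx mulr1 big1 ?addr0// => c ca.
  by rewrite (negPf ca) mulr0.
ring.
Qed.

Lemma sum_sq_le (eta : 'I_n -> path -> R) :
  (forall i j, i != j -> odd i = odd j ->
     \sum_x pi x * (eta i x * eta j x) = 0) ->
  \sum_x pi x * (\sum_i eta i x) ^+ 2 <=
  2 * \sum_i \sum_x pi x * eta i x ^+ 2.
Proof.
move=> orth; apply: le_trans (_ : \sum_x pi x * (2 * \sum_(i < n)
   \sum_(j < n | odd j == odd i) eta i x * eta j x) <= _).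
  by apply: ler_sum => x _; rewrite ler_wpM2l// sq_sum_parity.
under eq_bigr => x _ do rewrite mulrCA mulr_sumr.
rewrite -mulr_sumr ler_pM2l// exchange_big/=; apply: ler_sum => i _.
under eq_bigr => x _ do rewrite mulr_sumr.
rewrite exchange_big/= (bigD1 i)//= [X in _ + X]big1 ?addr0.
  by apply: ler_sum => x _; rewrite expr2.
by move=> j /andP[/eqP oj ji]; apply: orth; rewrite // eq_sym.
Qed.

End Local.
End Paths.

(** * The clustering loss as a maximal number of hits *)

Section Gain.
Variables (n : nat) (K : finType).
Local Notation path := {ffun 'I_n -> K}.
Local Notation assignment := {ffun K -> {set 'I_n}}.
Implicit Types (A : {set {set 'I_n}}) (x : path) (al : assignment).

(* [al a] is the block matched with label [a], or empty if there is none. *)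
Definition admissible A al : bool :=
  [forall a, (al a == finset.set0) || (al a \in A)] &&
  [forall i, forall a, forall b, (i \in al a) && (i \in al b) ==> (a == b)].

Definition hits al x : nat := (\sum_i (i \in al (x i)))%N.

Definition best A x : assignment :=
  [arg max_(al > [ffun=> finset.set0] | admissible A al) hits al x]%N.

Definition gain A x : nat := hits (best A x) x.

Lemma admissible0 A : admissible A [ffun=> finset.set0].
Proof.
apply/andP; split; first by apply/forallP => a; rewrite ffunE eqxx.
apply/forallP => i; apply/forallP => a; apply/forallP => b.
by rewrite !ffunE !inE.
Qed.

Lemma best_admissible A x : admissible A (best A x).
Proof. by rewrite /best; case: arg_maxnP => //; exact: admissible0. Qed.

Lemma hits_le_gain A x al : admissible A al -> (hits al x <= gain A x)%N.
Proof.
rewrite /gain /best; case: arg_maxnP; first exact: admissible0.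
by move=> be _ h /h.
Qed.

Lemma admissible_uniq A al i a b :
  admissible A al -> i \in al a -> i \in al b -> a = b.
Proof.
by move=> /andP[_ /forallP/(_ i)/forallP/(_ a)/forallP/(_ b)/implyP h] ia ib;
  apply/eqP/h; rewrite ia ib.
Qed.

Lemma admissible_block A al i a :
  admissible A al -> i \in al a -> al a \in A.
Proof.
move=> /andP[/forallP/(_ a)/orP[/eqP->|//]]; by rewrite inE.
Qed.

Lemma block_uniq A i (B C : {set 'I_n}) : finset.partition A [set: 'I_n]%SET ->
  B \in A -> C \in A -> i \in B -> i \in C -> B = C.
Proof.
case/and3P => _ tA _ BA CA iB iC.
by rewrite -(def_pblock tA BA iB) (def_pblock tA CA iC).
Qed.

Lemma in_preim_partition x (C : {set 'I_n}) i :
  C \in finset.preim_partition x [set: 'I_n]%SET -> i \in C ->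
  C = [set j | x j == x i]%SET.
Proof.
move=> /imsetP[k _ ->]; rewrite !inE /= => /eqP xki.
by apply/setP => j; rewrite !inE /= xki eq_sym.
Qed.

(** A matching assigns to each label the block joined to its class. Two labels sharing a point would
    share the block, hence the edge, hence the nonempty class, so the assignment is admissible. Each
    point then lies in the intersection of at most one edge and is hit by its own label. *)
Lemma matching_le_gain A x M : finset.partition A [set: 'I_n]%SET ->
  is_matching A (finset.preim_partition x [set: 'I_n]%SET) M ->
  (\sum_(e in M) #|e.1 :&: e.2|%SET <= gain A x)%N.
Proof.
move=> pA /and3P[/fintype.subsetP sM /forallP m1 /forallP m2].
have inj1 e e' : e \in M -> e' \in M -> e.1 = e'.1 -> e = e'.
  move=> eM e'M ee; move: (m1 e); rewrite eM => /forallP/(_ e').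
  by rewrite e'M ee eqxx /= => /eqP.
have inj2 e e' : e \in M -> e' \in M -> e.2 = e'.2 -> e = e'.
  move=> eM e'M ee; move: (m2 e); rewrite eM => /forallP/(_ e').
  by rewrite e'M ee eqxx /= => /eqP.
pose al : assignment := [ffun a =>
  if [pick e in M | e.2 == [set i | x i == a]%SET] is Some e then e.1
  else finset.set0].
have alP i a : i \in al a ->
    exists2 e, e \in M & e.2 = [set j | x j == a]%SET /\ al a = e.1.
  rewrite /al ffunE; case: pickP => [e /andP[eM /eqP e2] _|_]; last by rewrite inE.
  by exists e.
have adm : admissible A al.
  apply/andP; split.
    apply/forallP => a.
    rewrite /al ffunE; case: pickP => [e /andP[eM _]|_]; last by rewrite eqxx.
    by have := sM _ eM; rewrite inE => /andP[-> _]; rewrite orbT.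
  apply/forallP => i; apply/forallP => a; apply/forallP => b; apply/implyP => /andP[ia ib].
  have [e eM [e2 ale]] := alP _ _ ia; have [e' e'M [e2' ale']] := alP _ _ ib.
  have := sM _ eM; rewrite inE => /andP[eA ex].
  have e'A : e'.1 \in A by have := sM _ e'M; rewrite inE => /andP[].
  have ee : e = e'.
    by apply: inj1 => //; apply: (block_uniq (i := i)) pA _ _ _ _ => //;
      rewrite -?ale -?ale'.
  have [k _ ek] := imsetP ex.
  have ke : k \in e.2 by rewrite ek !inE /=.
  have ka : x k = a by move: ke; rewrite e2 inE => /eqP.
  by move: ke; rewrite ee e2' inE ka.
apply: leq_trans (hits_le_gain x adm).
under eq_bigr => e _ do rewrite -sum1_card big_mkcond/=.
rewrite exchange_big/=; apply: leq_sum => i _.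
case: (boolP [exists e in M, i \in (e.1 :&: e.2)%SET]) => [|ne]; last first.
  rewrite big1// => e eM; case: ifP => // ie.
  by move/existsP: ne; case; exists e; rewrite eM.
case/existsP => e /andP[eM ie].
have cl e' : e' \in M -> i \in (e'.1 :&: e'.2)%SET -> e'.2 = [set j | x j == x i]%SET.
  move=> e'M; rewrite inE => /andP[_ i2]; apply: in_preim_partition i2.
  by have := sM _ e'M; rewrite inE => /andP[].
have -> : i \in al (x i).
  rewrite /al ffunE; case: pickP => [e' /andP[e'M /eqP e2']|/(_ e)].
    rewrite (inj2 e' e)//; first by move: ie; rewrite inE => /andP[].
    by rewrite e2' cl.
  by rewrite eM (cl _ eM ie) eqxx.
rewrite (bigD1 e)//= ie big1 ?addn0// => e' /andP[e'M e'e].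
case: ifP => // ie'; case/eqP: e'e; apply: inj2 => //.
by rewrite (cl _ eM ie) (cl _ e'M ie').
Qed.

Lemma clust_loss_ge (R : realType) A x : (0 < n)%N -> finset.partition A [set: 'I_n]%SET ->
  (n%:R - (gain A x)%:R : R) <= n%:R * clust_loss R A
     (finset.preim_partition x [set: 'I_n]%SET).
Proof.
move=> n0 pA.
rewrite /clust_loss mulrBr mulr1 mulrA divff ?pnatr_eq0 ?gtn_eqF// mul1r.
rewrite lerB// ler_nat; apply/bigmax_leqP => M mM.
exact: matching_le_gain.
Qed.

(** Matching the two classes of each label, one from [h] and one from [x], covers every correctly
    classified point. *)
Lemma clust_loss_le (R : realType) (x h : path) : (0 < n)%N ->
  n%:R * clust_loss R (finset.preim_partition h [set: 'I_n]%SET)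
    (finset.preim_partition x [set: 'I_n]%SET) <= (\sum_i (h i != x i)%:R : R).
Proof.
move=> n0; rewrite /clust_loss mulrBr mulr1 mulrA divff ?pnatr_eq0 ?gtn_eqF//.
rewrite mul1r.
pose cl (z : path) a : {set 'I_n} := [set i | z i == a]%SET.
(* Edges must join actual blocks, so only labels present in both paths are kept; the others
   contribute no common point. *)
pose D := [set a | (cl h a != finset.set0) && (cl x a != finset.set0)]%SET.
pose M := [set (cl h a, cl x a) | a in D]%SET.
have clI (z : path) a b : cl z a != finset.set0 -> cl z a = cl z b -> a = b.
  move=> /set0Pn[i ia] e; move: (ia); rewrite e !inE => /eqP <-.
  by move: ia; rewrite inE => /eqP.
have clP (z : path) a : cl z a != finset.set0 ->
    cl z a \in finset.preim_partition z [set: 'I_n]%SET.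
  move=> /set0Pn[i ia]; apply/imsetP; exists i => //.
  apply/setP => j; rewrite !inE /=; move: ia; rewrite inE => /eqP <-.
  by rewrite eq_sym.
have mM : is_matching (finset.preim_partition h [set: 'I_n]%SET)
    (finset.preim_partition x [set: 'I_n]%SET) M.
  apply/and3P; split.
  - apply/fintype.subsetP => e /imsetP[a]; rewrite inE => /andP[ha xa] ->.
    by rewrite inE /= !clP.
  - apply/forallP => e; apply/implyP => /imsetP[a]; rewrite inE => /andP[ha xa] ->.
    apply/forallP => e'; apply/implyP => /imsetP[b _ ->] /=.
    by apply/implyP => /eqP /clI -> //.
  - apply/forallP => e; apply/implyP => /imsetP[a]; rewrite inE => /andP[ha xa] ->.
    apply/forallP => e'; apply/implyP => /imsetP[b _ ->] /=.
    by apply/implyP => /eqP /clI -> //.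
have -> : \sum_i (h i != x i)%:R = n%:R - (\sum_i (h i == x i))%N%:R :> R.
  rewrite natr_sum -[n in n%:R]card_ord -sumr_const -sumrB.
  by apply: eq_bigr => i _; case: eqP => _ /=; rewrite ?subrr ?subr0.
rewrite lerB// ler_nat; apply: leq_trans (@leq_bigmax_cond _ _ _ _ mM).
rewrite (big_imset _) /=; last first.
  by move=> a b; rewrite inE => /andP[ha _] _ [/clI -> //].
under [leqRHS]eq_bigr => a _ do rewrite -sum1_card big_mkcond/=.
rewrite exchange_big/=; apply: leq_sum => i _.
case: eqP => // hx; rewrite (bigD1 (h i)) /=; last first.
  rewrite inE; apply/andP; split; apply/set0Pn; exists i; rewrite inE//.
  by rewrite hx.
by rewrite !inE hx !eqxx.
Qed.
End Gain.

Lemma boolr_le1 (R : numDomainType) (b : bool) : b%:R <= 1 :> R.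
Proof. by rewrite lern1 leq_b1. Qed.

(** * Many errors: a second-moment bound uniform over the blocks *)

Section Dense.
Variables (R : realFieldType) (n : nat) (K : finType).
Local Notation path := {ffun 'I_n -> K}.
Variable pi : path -> R.
Hypothesis pi_ge0 : forall x, 0 <= pi x.
Hypothesis pi_cross : forall i j : 'I_n, i != j -> odd i = odd j -> cross pi i j.
Variable A : {set {set 'I_n}}.
Hypothesis pA : finset.partition A [set: 'I_n]%SET.

Let U a (C : {set 'I_n}) x : R := \sum_i (i \in C)%:R * resid pi i a x.

Lemma sum_block_le1 i : \sum_(C in A) (i \in C)%:R <= 1 :> R.
Proof.
case: (boolP [exists C in A, i \in C]) => [/existsP[C /andP[CA iC]]|ne].
  rewrite (bigD1 C)//= iC big1 ?addr0// => D /andP[DA DC].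
  case: (boolP (i \in D)) => // iD; case/eqP: DC.
  exact: block_uniq pA _ _ iD iC.
rewrite big1 ?ler01// => C CA; case: (boolP (i \in C)) => // iC.
by move/existsP: ne; case; exists C; rewrite CA.
Qed.

(** The indicator of a label is its conditional probability plus a residual. Each point lies in the
    block of at most one label, so its conditional part is at most 1 - [mu]. *)
Lemma gain_decomp al x : admissible A al ->
  (hits al x)%:R <= \sum_i (1 - mu pi i x) + \sum_a U a (al a) x.
Proof.
move=> adm; rewrite /hits natr_sum.
have -> : \sum_i ((i \in al (x i)) : nat)%:R =
    \sum_i \sum_a (i \in al a)%:R * cp pi i a x + \sum_a U a (al a) x.
  rewrite [X in _ + X]exchange_big /= -big_split/=; apply: eq_bigr => i _.
  rewrite -big_split/= (bigD1 (x i))//= big1 ?addr0.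
    by rewrite /resid eqxx /=; ring.
  by move=> a ax; rewrite /resid eq_sym (negPf ax) /=; ring.
rewrite lerD2r; apply: ler_sum => i _.
case: (boolP [exists a, i \in al a]) => [/existsP[a ia]|ne].
  rewrite (bigD1 a)//= ia mul1r big1 ?addr0 ?cp_le_mu// => b ba.
  case: (boolP (i \in al b)) => [ib|_]; last by rewrite mul0r.
  by case/eqP: ba; apply: admissible_uniq adm ib ia.
rewrite big1 ?subr_ge0 ?mu_le1// => a _.
case: (boolP (i \in al a)) => [ia|_]; last by rewrite mul0r.
by move/existsP: ne; case; exists a.
Qed.

Lemma ler_amgm (s v : R) : 0 < s -> v <= s / 2 + v ^+ 2 / (2 * s).
Proof.
move=> s0; have s1 : s != 0 by rewrite gt_eqF.
rewrite -subr_ge0.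
have -> : s / 2 + v ^+ 2 / (2 * s) - v = (s - v) ^+ 2 / (2 * s) by field.
by rewrite divr_ge0 ?sqr_ge0// mulr_ge0// ltW.
Qed.

(** The optimal assignment depends on [x], so orthogonality cannot be applied to it directly. Each
    linear term is replaced by a square, and the square is summed over all blocks of [A]. *)
Lemma gain_le s x : 0 < s -> (gain A x)%:R <= \sum_i (1 - mu pi i x) +
  (#|K|%:R * s / 2 + (2 * s)^-1 * \sum_a \sum_(C in A) U a C x ^+ 2).
Proof.
move=> s0; apply: le_trans (gain_decomp x (best_admissible A x)) _.
rewrite lerD2l.
have -> : #|K|%:R * s / 2 = \sum_(a : K) (s / 2).
  by rewrite sumr_const -[RHS]mulr_natl mulrA.
rewrite mulr_sumr -big_split/=; apply: ler_sum => a _.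
apply: le_trans (ler_amgm _ s0) _; rewrite lerD2l mulrC.
rewrite ler_pM2l ?invr_gt0 ?mulr_gt0//.
have /andP[/forallP/(_ a)/orP[/eqP->|aA] _] := best_admissible A x.
  have -> : U a finset.set0 x = 0 by apply: big1 => i _; rewrite inE mul0r.
  by rewrite expr0n/=; apply: sumr_ge0 => C _; exact: sqr_ge0.
rewrite [leRHS](bigD1 (best A x a))//= lerDl.
by apply: sumr_ge0 => C _; exact: sqr_ge0.
Qed.

(** The constant is 2 from the parity splitting times 2 from [sum_cp_var]. Summing over all blocks
    costs nothing since each point lies in at most one. *)
Lemma sum_U2 : \sum_x pi x * (\sum_a \sum_(C in A) U a C x ^+ 2) <=
  4 * \sum_x pi x * \sum_i mu pi i x.
Proof.
have h a C : \sum_x pi x * U a C x ^+ 2 <=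
    2 * \sum_i (i \in C)%:R * \sum_x pi x * (cp pi i a x * (1 - cp pi i a x)).
  apply: le_trans (sum_sq_le pi_ge0 _) _.
    move=> i j ij oij.
    under eq_bigr => x _.
      have -> : pi x * ((i \in C)%:R * resid pi i a x * ((j \in C)%:R * resid pi j a x)) =
        (i \in C)%:R * (j \in C)%:R * (pi x * (resid pi i a x * resid pi j a x)) by ring.
      over.
    by rewrite -mulr_sumr resid_orth ?mulr0//; exact: pi_cross.
  rewrite ler_pM2l//; apply: ler_sum => i _; rewrite -resid_var// mulr_sumr.
  apply: ler_sum => x _; case: (i \in C); first by rewrite !mul1r.
  by rewrite !mul0r expr0n/= mulr0.
under eq_bigr => x _.
  rewrite mulr_sumr; under eq_bigr => a _ do rewrite mulr_sumr; over.
rewrite exchange_big/=.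
under eq_bigr => a _ do rewrite exchange_big/=.
have -> : \sum_x pi x * \sum_i mu pi i x = \sum_i \sum_x pi x * mu pi i x.
  by rewrite exchange_big/=; apply: eq_bigr => x _; rewrite mulr_sumr.
pose v i a := \sum_x pi x * (cp pi i a x * (1 - cp pi i a x)).
have v0 i a : 0 <= v i a.
  apply: sumr_ge0 => x _; rewrite mulr_ge0// mulr_ge0 ?cp_ge0//.
  by rewrite subr_ge0 cp_le1.
apply: le_trans (_ : \sum_a 2 * \sum_i v i a <= _).
  apply: ler_sum => a _.
  apply: le_trans (ler_sum _ (fun C _ => h a C)) _.
  rewrite -mulr_sumr ler_pM2l// exchange_big/=; apply: ler_sum => i _.
  by rewrite -mulr_suml -[leRHS]mul1r ler_wpM2r ?sum_block_le1// v0.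
rewrite -mulr_sumr exchange_big/=.
have -> : 4 = 2 * 2 :> R by ring.
rewrite -mulrA ler_pM2l// mulr_sumr; apply: ler_sum => i _.
rewrite /v exchange_big/= mulr_sumr; apply: ler_sum => x _.
by rewrite -mulr_sumr mulrCA ler_wpM2l// sum_cp_var.
Qed.

Lemma dense_bound s : 0 < s ->
  (1 - 2 / s) * \sum_x pi x * \sum_i mu pi i x
    - #|K|%:R * s / 2 * \sum_x pi x <=
  \sum_x pi x * (n%:R - (gain A x)%:R).
Proof.
move=> s0; have s1 : s != 0 by rewrite gt_eqF.
set V := fun x => \sum_a \sum_(C in A) U a C x ^+ 2.
apply: le_trans (_ : \sum_x pi x * (\sum_i mu pi i x -
   (#|K|%:R * s / 2 + (2 * s)^-1 * V x)) <= _); last first.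
  apply: ler_sum => x _; rewrite ler_wpM2l//.
  have := gain_le x s0; rewrite sumrB sumr_const card_ord -/(V x); lra.
have -> : \sum_x pi x * (\sum_i mu pi i x - (#|K|%:R * s / 2 + (2 * s)^-1 * V x))
  = \sum_x pi x * (\sum_i mu pi i x) - #|K|%:R * s / 2 * \sum_x pi x
    - (2 * s)^-1 * \sum_x pi x * V x.
  rewrite !mulr_sumr -!sumrB; apply: eq_bigr => x _; ring.
have : (2 * s)^-1 * \sum_x pi x * V x <=
    2 / s * \sum_x pi x * \sum_i mu pi i x.
  have -> : 2 / s = (2 * s)^-1 * 4 by field.
  by rewrite -mulrA ler_pM2l ?invr_gt0 ?mulr_gt0// sum_U2.
set E := \sum_x pi x * \sum_i mu pi i x.
rewrite mulrBl mul1r; lra.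
Qed.
End Dense.

(** * Few errors: two values of one label cannot both be hit *)

Section Sparse.
Variables (R : realFieldType) (n : nat) (K : finType).
Local Notation path := {ffun 'I_n -> K}.
Implicit Types (x : path) (al : {ffun K -> {set 'I_n}}) (i : 'I_n) (a b : K).
Variable A : {set {set 'I_n}}.
Hypothesis pA : finset.partition A [set: 'I_n]%SET.

Definition miss i x : bool := i \notin best A x (x i).
Definition misses x : R := n%:R - (gain A x)%:R.

Lemma missesE x : misses x = \sum_i (miss i x)%:R.
Proof.
rewrite /misses /gain /hits natr_sum -[n in n%:R]card_ord -sumr_const -sumrB.
by apply: eq_bigr => i _; rewrite /miss; case: (i \in _); rewrite ?subrr ?subr0.
Qed.

Lemma misses_upd x i a : misses (upd x i a) <= misses x + 1.
Proof.
suff : (gain A x)%:R <= (gain A (upd x i a))%:R + 1 :> R by rewrite /misses; lra.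
rewrite -[1]/(1%:R) -natrD ler_nat.
apply: leq_trans (_ : hits (best A x) (upd x i a) + 1 <= _)%N; last first.
  by rewrite leq_add2r hits_le_gain// best_admissible.
rewrite /gain /hits (bigD1 i)//= [X in (_ <= X + 1)%N](bigD1 i)//= addnAC.
apply: leq_add; first by case: (i \in best A x (x i)); rewrite // addnC.
by apply: leq_sum => j ji; rewrite updE (negPf ji).
Qed.

(** Both optimal assignments use the block containing [i], the first for [a] and the second for [b].
    Since blocks of distinct labels are disjoint within one assignment, a point labelled [a] or [b]
    cannot be hit by both. *)
Lemma misses_conflict x i a b : a != b ->
  ~~ miss i (upd x i a) -> ~~ miss i (upd x i b) ->
  \sum_(j | j != i) ((x j == a) || (x j == b))%:R <=
    misses (upd x i a) + misses (upd x i b).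
Proof.
move=> ab; rewrite /miss !negbK !upd_same => ia ib.
set al := best A _ in ia; set be := best A _ in ib.
have aal := best_admissible A (upd x i a); have abe := best_admissible A (upd x i b).
have e : al a = be b.
  by apply: (block_uniq pA _ _ ia ib);
    [exact: (admissible_block aal ia)|exact: (admissible_block abe ib)].
rewrite !missesE -big_split/= [leRHS](bigD1 i)//= -[leLHS]add0r.
apply: lerD; first by rewrite addr_ge0.
apply: ler_sum => j ji; rewrite /miss !updE (negPf ji) -/al -/be.
have [xa|] := eqVneq (x j) a => /=.
  rewrite xa; case: (boolP (j \in al a)) => [ja|_]; last by rewrite lerDl.
  case: (boolP (j \in be a)) => [jb|_]; last by rewrite lerDr.
  by case/eqP: ab; apply: admissible_uniq abe jb _; rewrite -e.
have [xb|] := eqVneq (x j) b => /=; last by rewrite addr_ge0.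
rewrite xb; case: (boolP (j \in al b)) => [ja|_]; last by rewrite lerDl.
case: (boolP (j \in be b)) => [jb|_]; last by rewrite lerDr.
by case/eqP: ab; apply: admissible_uniq aal _ ja; rewrite e.
Qed.

(** [mt] bounds from below the conditional error of any guess of a label given the others. [ok] says
    that, apart from label [i], every pair of labels is frequent. [q] dominates the positive part of
    the total local error minus [t0]. Both [mt i] and [ok i] are constant along the fibre of [i]. *)
Variables (pi : path -> R) (mt : 'I_n -> path -> R) (ok : 'I_n -> path -> bool).
Variables (q : path -> R) (t0 t1 : R).
Hypothesis pi_ge0 : forall x, 0 <= pi x.
Hypothesis mt_ge0 : forall i x, 0 <= mt i x.
Hypothesis mt_upd : forall i x a, mt i (upd x i a) = mt i x.
Hypothesis mt_le : forall i x b,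
  mt i x * fib pi i x <= \sum_(a | a != b) pi (upd x i a).
Hypothesis ok_upd : forall i x a, ok i (upd x i a) = ok i x.
Hypothesis ok_pair : forall i x a b, ok i x -> a != b ->
  2 * t1 <= \sum_(j | j != i) ((x j == a) || (x j == b))%:R.
Hypothesis t01 : t0 < t1.
Hypothesis q_ge0 : forall x, 0 <= q x.
Hypothesis q_ge : forall x, \sum_i mt i x - t0 <= q x.

Let rg := t1 - t0.
Let rg_gt0 : 0 < rg. Proof. by rewrite subr_gt0. Qed.

(* A weight decreasing linearly from 1 at [t0] to 0 at [t1], so that resampling
   one label changes the weight of the number of misses by at most [rg^-1]. *)
Let phi (v : R) := Num.max 0 (Num.min 1 ((t1 - v) / rg)).

Let phi_ge0 v : 0 <= phi v. Proof. by rewrite /phi le_max lexx. Qed.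

Let phi_le1 v : phi v <= 1.
Proof. by rewrite /phi ge_max ler01 ge_min lexx. Qed.

Let phi0 v : t1 <= v -> phi v = 0.
Proof.
move=> tv; apply/max_idPl; rewrite ge_min; apply/orP; right.
by rewrite pmulr_lle0 ?invr_gt0// subr_le0.
Qed.

Let phi1 v : v <= t0 -> phi v = 1.
Proof.
move=> vt; have -> : phi v = Num.max 0 1; last by apply/max_idPr.
congr Num.max; apply/min_idPl; rewrite ler_pdivlMr// mul1r /rg.
by rewrite lerD2l lerN2.
Qed.

Let phi_lip u v : u <= v + 1 -> phi v - rg^-1 <= phi u.
Proof.
move=> uv; have h : (t1 - v) / rg - rg^-1 <= (t1 - u) / rg.
  by rewrite -{2}[rg^-1]mul1r -mulrBl ler_pM2r ?invr_gt0//; lra.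
have rv0 : 0 <= rg^-1 by rewrite invr_ge0 ltW.
rewrite /phi; case: (leP 1 ((t1 - v) / rg)) => h1;
  case: (leP 1 ((t1 - u) / rg)) => h2; rewrite !maxEle; do ?case: ifP; lra.
Qed.

(** Taking the minimum over the fibre makes the weight independent of label [i]; as one label moves
    the number of misses by at most 1, this costs at most [rg^-1] by [phi_lip]. *)
Let w i x := \big[Num.min/1]_a phi (misses (upd x i a)).

Let w_upd i x a : w i (upd x i a) = w i x.
Proof. by apply: eq_bigr => b _; rewrite upd_upd. Qed.

Let w_le i x a : w i x <= phi (misses (upd x i a)).
Proof. exact: (bigmin_le _ a (fun b => phi (misses (upd x i b)))). Qed.

Let w_ge0 i x : 0 <= w i x.
Proof. by apply: le_bigmin => // a _. Qed.

Let w_ge i x : phi (misses x) - rg^-1 <= w i x.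
Proof.
apply: le_bigmin => [|a _]; last by apply: phi_lip; exact: misses_upd.
by rewrite lerBlDr (le_trans (phi_le1 _))// lerDl invr_ge0 ltW.
Qed.

(** If the weight is positive, every path of the fibre has fewer than [t1] misses. Two hit values of
    label [i] would give at least 2 * [t1] misses together by [misses_conflict], so all values but
    one are missed and [mt_le] applies. *)
Let fiber_miss i x :
  \sum_a pi (upd x i a) * (mt i x * (w i x * (ok i x)%:R)) <=
  \sum_a pi (upd x i a) * ((miss i (upd x i a))%:R * (w i x * (ok i x)%:R)).
Proof.
rewrite -mulr_suml -/(fib pi i x).
have -> : \sum_a pi (upd x i a) * ((miss i (upd x i a))%:R * (w i x * (ok i x)%:R))
  = (\sum_a pi (upd x i a) * (miss i (upd x i a))%:R) * (w i x * (ok i x)%:R).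
  by rewrite mulr_suml; apply: eq_bigr => a _; rewrite -mulrA.
rewrite [fib _ _ _ * _]mulrA.
case: (boolP (ok i x)) => okx; last by rewrite !mulr0.
have [->|w0] := eqVneq (w i x) 0; first by rewrite mul0r !mulr0.
have wp : 0 < w i x by rewrite lt_neqAle eq_sym w0 w_ge0.
apply: ler_wpM2r; first by rewrite /= mulr1 ltW.
rewrite [leLHS]mulrC.
suff [b hb] : exists b, forall a, a != b -> miss i (upd x i a).
  apply: le_trans (mt_le i x b) _; rewrite [leRHS](bigD1 b)//=.
  rewrite -[leLHS]add0r lerD ?mulr_ge0//.
  by apply: ler_sum => a ab; rewrite (hb _ ab) mulr1.
case: (boolP [exists b, ~~ miss i (upd x i b)]) => [/existsP[b bb]|ne]; last first.
  exists (x i) => a _; move/existsP: ne; apply: contra_notT => h.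
  by exists a.
exists b => a ab; apply: contraT => aa.
have := le_trans (ok_pair okx ab) (misses_conflict ab aa bb).
have lt c : misses (upd x i c) < t1.
  rewrite ltNge; apply/negP => /phi0 p0.
  by have := w_le i x c; rewrite p0 leNgt wp.
by have := lt a; have := lt b; lra.
Qed.

(** The misses are split with weights [phi] and 1 - [phi]. The first part is bounded by the
    fibrewise argument. In the second part there are already more than [t0] misses, hence at least
    the total local error minus [q]. *)
Lemma sparse_bound :
  \sum_x pi x * (\sum_i mt i x * (ok i x)%:R - (t1 - t0)^-1 * \sum_i mt i x - q x)
  <= \sum_x pi x * (n%:R - (gain A x)%:R).
Proof.
have step : \sum_x pi x * (\sum_i mt i x * (w i x * (ok i x)%:R)) <=
    \sum_x pi x * (\sum_i (miss i x)%:R * (w i x * (ok i x)%:R)).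
  under eq_bigr => x _ do rewrite mulr_sumr.
  under [leRHS]eq_bigr => x _ do rewrite mulr_sumr.
  rewrite exchange_big/= [leRHS]exchange_big/=; apply: ler_sum => i _.
  apply: (fiber_le (i := i)) => x.
  under eq_bigr => a _ do rewrite mt_upd w_upd ok_upd.
  under [leRHS]eq_bigr => a _ do rewrite w_upd ok_upd.
  exact: fiber_miss.
have lb x : \sum_i (miss i x)%:R * (w i x * (ok i x)%:R) +
    (1 - phi (misses x)) * misses x <= misses x.
  suff : \sum_i (miss i x)%:R * (w i x * (ok i x)%:R) <=
      phi (misses x) * misses x by lra.
  have -> : phi (misses x) * misses x = \sum_i phi (misses x) * (miss i x)%:R.
    by rewrite -mulr_sumr -missesE.
  apply: ler_sum => i _; rewrite mulrC; apply: ler_wpM2r => //.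
  apply: (@le_trans _ _ (w i x)).
    by rewrite ler_piMr ?w_ge0 ?boolr_le1.
  by have := w_le i x (x i); rewrite upd_id.
apply: le_trans (_ : \sum_x pi x * (\sum_i (miss i x)%:R * (w i x * (ok i x)%:R) +
    (1 - phi (misses x)) * misses x) <= _); last first.
  by apply: ler_sum => x _; apply: ler_wpM2l; [exact: pi_ge0|exact: lb].
under [leRHS]eq_bigr => x _ do rewrite mulrDr.
rewrite big_split/=; apply: le_trans (lerD step (lexx _)).
rewrite -big_split/=; apply: ler_sum => x _.
rewrite -mulrDr ler_wpM2l//.
set u := \sum_i mt i x; set v := \sum_i mt i x * (ok i x)%:R.
have vu : v <= u.
  by apply: ler_sum => i _; rewrite ler_piMr ?boolr_le1.
have v0 : 0 <= v by apply: sumr_ge0 => i _; rewrite mulr_ge0.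
have h1 : phi (misses x) * v - rg^-1 * u <= \sum_i mt i x * (w i x * (ok i x)%:R).
  apply: le_trans (_ : (phi (misses x) - rg^-1) * v <= _).
    rewrite mulrBl lerD2l lerN2; apply: ler_wpM2l => //.
    by rewrite invr_ge0 ltW.
  rewrite mulr_sumr; apply: ler_sum => i _.
  by rewrite mulrCA ler_wpM2l// ler_wpM2r// w_ge.
have h2 : (1 - phi (misses x)) * v - q x <= (1 - phi (misses x)) * misses x.
  have [mt0|mt0] := leP (misses x) t0.
    by rewrite phi1// subrr !mul0r sub0r oppr_le0.
  have p1 : 0 <= 1 - phi (misses x) by rewrite subr_ge0.
  apply: le_trans (_ : (1 - phi (misses x)) * t0 <= _); last first.
    by rewrite ler_wpM2l// ltW.
  have := q_ge x; have := q_ge0 x; rewrite -/u => q0 qu.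
  have p2 := phi_ge0 (misses x); nra.
rewrite -/rg; lra.
Qed.
End Sparse.

(** * Two labels: reduction to two blocks and to signed sums *)

Lemma half_sum_abs (R : realFieldType) (u v k : R) : `|v| <= k ->
  [/\ `|u - v| <= (`|u - v| + `|u + v|) / 2 + k, `|u| <= (`|u - v| + `|u + v|) / 2,
      `|v| <= (`|u - v| + `|u + v|) / 2 & (`|u - v| + `|u + v|) / 2 - k <= `|u - v|].
Proof.
have nD := ler_normD (u - v) (u + v); have nB := ler_normB (u + v) (u - v).
have nC := ler_normD (u + v) (- v *+ 2); have nE := ler_normD (u - v) (v *+ 2).
move: nD nB nC nE; have -> : u - v + (u + v) = 2 * u by ring.
have -> : u + v - (u - v) = 2 * v by ring.
have -> : u + v + - v *+ 2 = u - v by ring.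
have -> : u - v + v *+ 2 = u + v by ring.
by rewrite !normrMn normrN !normrM normr_nat => *; split; lra.
Qed.

Section Binary.
Variables (R : realFieldType) (n : nat).
Local Notation K := 'I_2.
Local Notation path := {ffun 'I_n -> K}.
Implicit Types (x : path) (i : 'I_n) (a b : K).

Definition trit (e : R) := [\/ e = -1, e = 0 | e = 1].

Definition lsign a : R := if a == ord0 then 1 else -1.

Lemma ord2P (P : K -> Prop) : P ord0 -> P ord_max -> forall a, P a.
Proof.
move=> P0 P1 a; have := ltn_ord a; case: a => [[|[|k]] Hk] //= _.
  by rewrite (_ : Ordinal Hk = ord0)//; apply/val_inj.
by rewrite (_ : Ordinal Hk = ord_max)//; apply/val_inj.
Qed.

Lemma big_ord2 (F : K -> R) : \sum_a F a = F ord0 + F ord_max.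
Proof.
rewrite big_ord_recl big_ord1; congr (_ + F _); exact/val_inj.
Qed.

Let s (C : {set 'I_n}) x : R := \sum_i (i \in C)%:R * lsign (x i).
Let c (C : {set 'I_n}) : R := \sum_(i < n) (i \in C)%:R.

Let c_ge0 C : 0 <= c C. Proof. exact: sumr_ge0. Qed.

Let s_le C x : `|s C x| <= c C.
Proof.
apply: le_trans (ler_norm_sum _ _ _) _; apply: ler_sum => i _.
rewrite normrM normr_nat ler_piMr// /lsign; case: ifP => _; rewrite ?normrN normr1//.
Qed.

Let c_card C : c C = #|C|%:R.
Proof.
by rewrite /c -natr_sum -sum1_card [in RHS]big_mkcond/=; congr (_%:R).
Qed.

Let hits_s (al : {ffun K -> {set 'I_n}}) x :
  2 * (hits al x)%:R =
  c (al ord0) + c (al ord_max) + s (al ord0) x - s (al ord_max) x.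
Proof.
rewrite /hits natr_sum /c /s mulr_sumr -!big_split/= -sumrB; apply: eq_bigr => i _.
by elim/ord2P: (x i); rewrite /lsign /=; ring.
Qed.

(* Among all blocks only the two largest ones matter: a matching using another
   block leaves one of them unmatched. *)
Lemma gain_two_blocks (A : {set {set 'I_n}}) :
  finset.partition A [set: 'I_n]%SET ->
  exists e1 e2 : 'I_n -> R, exists2 th : R,
    [/\ 0 <= th <= 1, forall i, trit (e1 i)
       & forall i, trit (e2 i)] &
    forall x, 2 * (gain A x)%:R - n%:R <=
      (1 - th) * `|\sum_i e1 i * lsign (x i)| + th * `|\sum_i e2 i * lsign (x i)|.
Proof.
move=> pA.
pose C1 : {set 'I_n} :=
  [arg max_(C > finset.set0 | (C == finset.set0) || (C \in A)) #|C|%SET]%N.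
have [C1A C1max] : ((C1 == finset.set0) || (C1 \in A)) /\
    forall C, C \in A -> c C <= c C1.
  rewrite /C1; case: arg_maxnP => [|C CA h]; first by rewrite eqxx.
  by split=> // D DA; rewrite !c_card ler_nat; apply: h; rewrite DA orbT.
pose C2 : {set 'I_n} :=
  [arg max_(C > finset.set0 | (C == finset.set0) || ((C \in A) && (C != C1))) #|C|%SET]%N.
have [C2A C2max] : ((C2 == finset.set0) || ((C2 \in A) && (C2 != C1))) /\
    forall C, C \in A -> C != C1 -> c C <= c C2.
  rewrite /C2; case: arg_maxnP => [|C CA h]; first by rewrite eqxx.
  by split=> // D DA DC; rewrite !c_card ler_nat; apply: h; rewrite DA DC orbT.
have dj (C D : {set 'I_n}) i : ((C == finset.set0) || (C \in A)) ->
    ((D == finset.set0) || (D \in A)) -> C != D -> i \in C -> i \in D -> False.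
  move=> /orP[/eqP->|CA]; first by rewrite inE.
  move=> /orP[/eqP->|DA]; first by rewrite inE.
  by move=> /eqP CD iC iD; apply: CD; exact: block_uniq pA CA DA iC iD.
have C2A' : (C2 == finset.set0) || (C2 \in A).
  by case/orP: C2A => [->//|/andP[-> _]]; rewrite orbT.
have C21 : C2 != C1 \/ C2 = finset.set0.
  by case/orP: C2A => [/eqP->|/andP[_ ->]]; [right|left].
have d12 i : i \in C1 -> i \in C2 -> False.
  case: C21 => [ne|->]; last by rewrite inE.
  by apply: dj => //; rewrite eq_sym.
have e12 i : (i \in C1) && (i \in C2) = false.
  by apply/negP => /andP[]; exact: d12.
have eo (B : {set 'I_n}) (h : forall i, i \in B -> i \notin C1 /\ i \notin C2) i :
    (i \in B) ==> ~~ (i \in C1) && ~~ (i \in C2).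
  by apply/implyP => /h[-> ->].
pose rho := n%:R - c C1 - c C2.
have cn (C D E F : {set 'I_n}) :
    (forall i, (i \in C) + (i \in D) + (i \in E) + (i \in F) <= 1)%N ->
    c C + c D + c E + c F <= n%:R.
  move=> h; rewrite /c -!big_split/= -[n in leRHS]card_ord -sumr_const.
  apply: ler_sum => i _; rewrite -!natrD -[1]/(1%:R) ler_nat; exact: h.
have c0 : c finset.set0 = 0 by rewrite /c big1// => i _; rewrite inE.
have s0 x : s finset.set0 x = 0 by rewrite /s big1// => i _; rewrite inE mul0r.
have rho0 : 0 <= rho.
  have := cn C1 C2 finset.set0 finset.set0; rewrite !c0 /rho => h.
  rewrite -addrA -opprD subr_ge0 -[leLHS]addr0 -[leLHS]addr0; apply: h => i.
  rewrite !inE; have := @d12 i.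
  by case: (i \in C1); case: (i \in C2) => //= /(_ isT isT).
have c21 : c C2 <= c C1.
  by case/orP: C2A => [/eqP->|/andP[h _]]; [rewrite c0|exact: C1max].
(* Upper bound for the size of any block besides [C1] and [C2]: such a block lies in their
   complement, of size [rho], and is no larger than [C2]. *)
pose rho' := Num.min rho (c C2).
have [r1 r2] : rho' <= rho /\ rho' <= c C2.
  by split; rewrite ge_min lexx ?orbT.
pose other (B : {set 'I_n}) := [/\ forall i, i \in B -> i \notin C1 /\ i \notin C2,
  c B <= rho & c B <= c C2].
have oth (B : {set 'I_n}) : (B == finset.set0) || (B \in A) ->
    [\/ other B, B = C1 /\ B != finset.set0 | B = C2 /\ B != finset.set0].
  move=> BA; have [B0|B0] := eqVneq B finset.set0.
    by apply: Or31; split; rewrite B0 ?c0// => i; rewrite inE.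
  have [B1|B1] := eqVneq B C1; first exact: Or32.
  have [B2|B2] := eqVneq B C2; first exact: Or33.
  have BA' : B \in A by move: BA; rewrite (negPf B0).
  have h i : i \in B -> i \notin C1 /\ i \notin C2.
    by move=> iB; split; apply/negP; [move: B1|move: B2] => ne iC;
      apply: (dj _ _ i BA _ ne iB iC).
  apply: Or31; split=> //; last exact: C2max.
  have : c C1 + c C2 + c B + c finset.set0 <= n%:R.
    apply: cn => i; rewrite !inE addn0; move: (e12 i) (eo _ h i).
    by case: (i \in C1); case: (i \in C2); case: (i \in B).
  by rewrite c0 /rho; lra.
(* Interpolation weight with [th] * |C2| = [rho']; both sides vanish when [C2] is empty. *)
pose th := if c C2 == 0 then 0 else rho' / c C2.
have th01 : 0 <= th <= 1.
  rewrite /th; case: eqP => [_|/eqP h]; first by rewrite lexx ler01.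
  have cp : 0 < c C2 by rewrite lt_neqAle eq_sym h c_ge0.
  rewrite divr_ge0 ?ler_pdivrMr ?mul1r//.
  by rewrite /rho' le_min rho0 c_ge0.
have thc : th * c C2 = rho'.
  rewrite /th; case: eqP => [h|/eqP h]; last by rewrite divfK.
  by rewrite mul0r; apply/le_anti; rewrite -{2}h r2 /rho' le_min rho0 c_ge0.
have e_in (b1 b2 : bool) : ~ (b1 /\ b2) ->
    trit (b1%:R - b2%:R) /\ trit (b1%:R + b2%:R).
  case: b1; case: b2 => h; first by case: h.
  - by rewrite /= subr0 addr0; split; apply: Or33.
  - by rewrite /= sub0r add0r; split; [apply: Or31|apply: Or33].
  - by rewrite /= subr0 addr0; split; apply: Or32.
exists (fun i => (i \in C1)%:R - (i \in C2)%:R).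
exists (fun i => (i \in C1)%:R + (i \in C2)%:R).
exists (th / 2).
  split; first by apply/andP; lra.
    by move=> i; apply: (e_in _ _ _).1 => -[]; exact: d12.
  by move=> i; apply: (e_in _ _ _).2 => -[]; exact: d12.
move=> x; set al := best A x.
have adm : admissible A al := best_admissible A x.
have alA a : (al a == finset.set0) || (al a \in A).
  by case/andP: adm => /forallP.
have ald i : i \in al ord0 -> i \in al ord_max -> False.
  by move=> h1 h2; have := admissible_uniq adm h1 h2.
have eal i : (i \in al ord0) && (i \in al ord_max) = false.
  by apply/negP => /andP[]; exact: ald.
have -> : \sum_i ((i \in C1)%:R - (i \in C2)%:R) * lsign (x i) = s C1 x - s C2 x.
  by rewrite -sumrB; apply: eq_bigr => i _; rewrite mulrBl.
have -> : \sum_i ((i \in C1)%:R + (i \in C2)%:R) * lsign (x i) = s C1 x + s C2 x.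
  by rewrite -big_split; apply: eq_bigr => i _; rewrite mulrDl.
rewrite /gain -/al hits_s.
set p := `|s C1 x - s C2 x|; set q := `|s C1 x + s C2 x|.
have S1 := s_le C1 x; have S2 := s_le C2 x.
have T0 := s_le (al ord0) x; have T1 := s_le (al ord_max) x.
(* This half-sum is the larger of |s C1 x| and |s C2 x|. *)
pose m := (p + q) / 2.
have [pm m1 m2 [mp1 mp2]] : [/\ p <= m + c C2, `|s C1 x| <= m, `|s C2 x| <= m &
    m - c C2 <= p /\ 0 <= p].
  by split; try split; rewrite ?normr_ge0//; have [] := half_sum_abs (s C1 x) S2.
(* The three alternatives correspond to assignments using both, exactly one, or none of [C1] and
   [C2]. The mixture (1 - [th]) p + [th] m dominates all three because p and m differ by at most
   |C2| and [th] * |C2| = [rho']. *)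
have key v : v <= p - rho' \/ v <= m - c C2 + rho' \/ v <= 0 ->
    v <= (1 - th / 2) * p + th / 2 * q.
  have -> : (1 - th / 2) * p + th / 2 * q = (1 - th) * p + th * m by rewrite /m; field.
  move: th01 => /andP[th0 th1] [h|[h|h]]; apply: le_trans h _; rewrite -?thc.
  - have : 0 <= th * (m + c C2 - p) by rewrite mulr_ge0// subr_ge0.
    lra.
  - have : 0 <= (1 - th) * (p - (m - c C2)) by rewrite mulr_ge0 ?subr_ge0.
    lra.
  - have m0 : 0 <= m := le_trans (normr_ge0 _) m1.
    by apply: addr_ge0; apply: mulr_ge0 => //; rewrite subr_ge0.
apply: key; rewrite -/rho'.
have cc : n%:R = c C1 + c C2 + rho by rewrite /rho; ring.
have rr B : other B -> 2 * c B - rho <= rho' /\ c B <= rho'.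
  move=> [_ h1 h2]; have : c B <= rho' by rewrite le_min h1 h2.
  by split=> //; lra.
move: T0 T1; rewrite !ler_norml => /andP[a1 a2] /andP[b1 b2].
move: m1 m2; rewrite !ler_norml => /andP[m1 m1'] /andP[m2 m2'].
have pl := ler_norm (s C1 x - s C2 x);
have pl' := ler_norm (s C2 x - s C1 x); rewrite distrC in pl'.
rewrite -/p in pl pl'.
case: (oth _ (alA ord0)) => [hot0 | [hot0 n0] | [hot0 n0] ];
case: (oth _ (alA ord_max)) => [hot1 | [hot1 n1] | [hot1 n1] ].
- right; right.
  have : c C1 + c C2 + c (al ord0) + c (al ord_max) <= n%:R.
    case: hot0 => [h0 _ _]; case: hot1 => [h1 _ _]; apply: cn => i.
    move: (e12 i) (eal i) (eo _ h0 i) (eo _ h1 i).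
    by case: (i \in C1); case: (i \in C2); case: (i \in al ord0);
      case: (i \in al ord_max).
  case: hot0 => [_ ? ?]; case: hot1 => [_ ? ?]; lra.
- right; left; have [? ?] := rr _ hot0; rewrite hot1 in b1 b2 *; lra.
- right; left; have [? ?] := rr _ hot0; rewrite hot1 in b1 b2 *; lra.
- right; left; have [? ?] := rr _ hot1; rewrite hot0 in a1 a2 *; lra.
- by case/set0Pn: n0 => i i0; case: (ald i) => //; rewrite hot1 -hot0.
- left; rewrite hot0 hot1 in a1 a2 b1 b2 *; lra.
- right; left; have [? ?] := rr _ hot1; rewrite hot0 in a1 a2 *; lra.
- left; rewrite hot0 hot1 in a1 a2 b1 b2 *; lra.
- by case/set0Pn: n0 => i i0; case: (ald i) => //; rewrite hot1 -hot0.
Qed.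
End Binary.

Section BinaryBounds.
Variables (R : realFieldType) (n : nat).
Local Notation K := 'I_2.
Local Notation path := {ffun 'I_n -> K}.
Implicit Types (x : path) (i : 'I_n) (a b : K).
Variable pi : path -> R.
Hypothesis pi_ge0 : forall x, 0 <= pi x.
Variable A : {set {set 'I_n}}.
Hypothesis pA : finset.partition A [set: 'I_n]%SET.

Lemma binary_misses_ge (B : R) :
  (forall e : 'I_n -> R, (forall i, trit (e i)) ->
     \sum_x pi x * `|\sum_i e i * lsign R (x i)| <= B) ->
  (n%:R * \sum_x pi x - B) / 2 <= \sum_x pi x * (n%:R - (gain A x)%:R).
Proof.
move=> hB; have [e1 [e2 [th [/andP[th0 th1] he1 he2] hg]]] := gain_two_blocks R pA.
have B1 := hB _ he1; have B2 := hB _ he2.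
set S1 := (\sum_x pi x * _) in B1; set S2 := (\sum_x pi x * _) in B2.
have : \sum_x pi x * (2 * (gain A x)%:R - n%:R) <= (1 - th) * S1 + th * S2.
  rewrite /S1 /S2 !mulr_sumr -big_split/=; apply: ler_sum => x _.
  apply: le_trans (ler_wpM2l (pi_ge0 x) (hg x)) _.
  by rewrite mulrDr ![pi x * (_ * _)]mulrCA.
have -> : \sum_x pi x * (2 * (gain A x)%:R - n%:R) =
    n%:R * \sum_x pi x - 2 * \sum_x pi x * (n%:R - (gain A x)%:R).
  by rewrite !mulr_sumr -sumrB; apply: eq_bigr => x _; ring.
nra.
Qed.

(** A signed sum is its conditional mean plus residuals. The conditional mean of one sign is at most
    1 - 2 * [mu] in absolute value. Each residual has second moment at most 1, so parity splitting
    gives 2n for the sum, and the AM-GM inequality with parameter [s] turns this into a bound on the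
    mean absolute value. *)
Lemma binary_dense_bound s :
  (forall i j : 'I_n, i != j -> odd i = odd j -> cross pi i j) -> 0 < s ->
  \sum_x pi x * \sum_i mu pi i x - (s / 2 + n%:R / s) / 2 * \sum_x pi x <=
  \sum_x pi x * (n%:R - (gain A x)%:R).
Proof.
move=> pi_cross s0; have s1 : s != 0 by rewrite gt_eqF.
pose B := \sum_x pi x * (\sum_i (1 - 2 * mu pi i x)) +
  (s / 2 + n%:R / s) * \sum_x pi x.
apply: le_trans (binary_misses_ge (B := B) _).
  rewrite /B le_eqVlt; apply/orP; left; apply/eqP.
  have -> : \sum_x pi x * (\sum_i (1 - 2 * mu pi i x)) =
      n%:R * \sum_x pi x - 2 * \sum_x pi x * \sum_i mu pi i x.
    rewrite !mulr_sumr -sumrB; apply: eq_bigr => x _.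
    rewrite sumrB sumr_const card_ord -mulr_sumr; ring.
  by field.
move=> e he; pose eta i x := e i * (resid pi i ord0 x - resid pi i ord_max x).
pose m i x := cp pi i ord0 x - cp pi i ord_max x.
have etaE i x : e i * lsign R (x i) = e i * m i x + eta i x.
  by rewrite /eta /resid /m; elim/ord2P: (x i); rewrite /lsign /=; ring.
have e1 i : `|e i| <= 1.
  by case: (he i) => ->; rewrite ?normrN ?normr0 ?normr1.
have pm i x : pi x * `|e i * m i x| <= pi x * (1 - 2 * mu pi i x).
  have [->|px] := eqVneq (pi x) 0; first by rewrite !mul0r.
  rewrite ler_wpM2l// normrM (le_trans (_ : _ <= `|m i x|))//.
    by rewrite ler_piMl.
  have f0 : fib pi i x != 0.
    apply: contraNneq px => f0; have := fib0_pi pi_ge0 (x i) f0.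
    by rewrite upd_id => ->.
  have : \sum_a cp pi i a x = 1 by rewrite /cp -mulr_suml -/(fib pi i x) divff.
  rewrite big_ord2 => h.
  have := cp_le_mu pi i ord0 x; have := cp_le_mu pi i ord_max x.
  have [a ->] := mu_attained pi_ge0 i x.
  move=> h1 h0.
  rewrite ler_norml /m; apply/andP.
  by move: h0 h1; elim/ord2P: a => h0 h1; split; lra.
have orth i j : i != j -> odd i = odd j -> \sum_x pi x * (eta i x * eta j x) = 0.
  move=> ij oij; have o a b := resid_orth pi_ge0 a b ij (pi_cross _ _ ij oij).
  rewrite (eq_bigr (fun x => e i * e j * (pi x * (resid pi i ord0 x * resid pi j ord0 x))
    - e i * e j * (pi x * (resid pi i ord0 x * resid pi j ord_max x))
    - e i * e j * (pi x * (resid pi i ord_max x * resid pi j ord0 x))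
    + e i * e j * (pi x * (resid pi i ord_max x * resid pi j ord_max x)))); last first.
    by move=> x _; rewrite /eta; ring.
  by rewrite big_split/= !sumrB -!mulr_sumr !o !mulr0 !subr0 addr0.
have var i : \sum_x pi x * eta i x ^+ 2 <= \sum_x pi x.
  apply: le_trans (_ : 2 * (\sum_x pi x * resid pi i ord0 x ^+ 2) +
    2 * (\sum_x pi x * resid pi i ord_max x ^+ 2) <= _).
    rewrite !mulr_sumr -big_split/=; apply: ler_sum => x _.
    rewrite -![2 * (_ * _)]mulrCA -mulrDr ler_wpM2l// /eta exprMn.
    have : e i ^+ 2 <= 1 by case: (he i) => ->; rewrite ?sqrrN ?expr1n ?expr0n.
    have := sqr_ge0 (e i).
    have := sqr_ge0 (resid pi i ord0 x + resid pi i ord_max x).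
    have := sqr_ge0 (resid pi i ord0 x - resid pi i ord_max x).
    nra.
  rewrite !resid_var// !mulr_sumr -big_split/=; apply: ler_sum => x _.
  rewrite -![2 * (_ * _)]mulrCA -mulrDr -[leRHS]mulr1 ler_wpM2l//.
  have := sqr_ge0 (1 - 2 * cp pi i ord0 x).
  have := sqr_ge0 (1 - 2 * cp pi i ord_max x).
  rewrite !expr2; lra.
have total : \sum_x pi x * (\sum_i eta i x) ^+ 2 <= 2 * n%:R * \sum_x pi x.
  apply: le_trans (sum_sq_le pi_ge0 orth) _; rewrite -mulrA ler_pM2l//.
  apply: le_trans (ler_sum _ (fun i _ => var i)) _.
  by rewrite sumr_const card_ord mulr_natl.
apply: le_trans (_ : \sum_x (pi x * (\sum_i (1 - 2 * mu pi i x)) +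
  (s / 2 * pi x + (2 * s)^-1 * (pi x * (\sum_i eta i x) ^+ 2))) <= _).
  apply: ler_sum => x _.
  under [X in `|X|]eq_bigr => i _ do rewrite etaE.
  rewrite big_split/=; apply: le_trans (ler_wpM2l (pi_ge0 x) (ler_normD _ _)) _.
  rewrite mulrDr; apply: lerD.
    apply: le_trans (ler_wpM2l (pi_ge0 x) (ler_norm_sum _ _ _)) _.
    by rewrite !mulr_sumr; apply: ler_sum => i _; exact: pm.
  have -> : s / 2 * pi x + (2 * s)^-1 * (pi x * (\sum_i eta i x) ^+ 2) =
    pi x * (s / 2 + `|\sum_i eta i x| ^+ 2 / (2 * s)) by rewrite real_normK ?num_real//; ring.
  by rewrite ler_wpM2l// ler_amgm.
rewrite /B big_split/= lerD2l big_split/= -!mulr_sumr [leRHS]mulrDl lerD2l.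
have -> : n%:R / s * \sum_x pi x = (2 * s)^-1 * (2 * n%:R * \sum_x pi x) by field.
by rewrite ler_pM2l ?invr_gt0 ?mulr_gt0.
Qed.
End BinaryBounds.

(** * Two independent labels: known labels and fair coins *)

Section BinaryIndependent.
Variables (R : realType) (n : nat).
Local Notation K := 'I_2.
Local Notation path := {ffun 'I_n -> K}.
Local Notation bits := {ffun 'I_n -> bool}.
Variables (q : 'I_n -> K -> R) (e : 'I_n -> R) (lam : R).
Hypothesis q_ge0 : forall i a, 0 <= q i a.
Hypothesis e_trit : forall i, trit (e i).
Hypothesis lam_gt0 : 0 < lam.

Let Z i := q i ord0 + q i ord_max.
Let M i := Num.min (q i ord0) (q i ord_max).
Let k i : K := if q i ord_max <= q i ord0 then ord0 else ord_max.
Let D i := Z i - 2 * M i.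
Let r i (v : bool) a : R := if v then D i * (a == k i)%:R else M i.

Let D_ge0 i : 0 <= D i.
Proof. by rewrite /D /Z /M minElt; case: ltP => ?; lra. Qed.

Let M_ge0 i : 0 <= M i.
Proof. by rewrite le_min !q_ge0. Qed.

Let r_ge0 i v a : 0 <= r i v a.
Proof. by rewrite /r; case: v => //; rewrite mulr_ge0. Qed.

Let q_mix i a : q i a = \sum_v r i v a.
Proof.
have ME : M i = if q i ord_max <= q i ord0 then q i ord_max else q i ord0.
  by rewrite /M; case: (leP (q i ord_max) (q i ord0)).
rewrite big_bool /= /r /k /D /Z ME.
by elim/ord2P: a; case: (q i ord_max <= q i ord0) => /=; ring.
Qed.

Let sum_mix (f : 'I_n -> bool -> K -> R) :
  \sum_(v : bits) \sum_(x : path) \prod_i f i (v i) (x i) =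
  \prod_i \sum_v \sum_a f i v a.
Proof.
rewrite exchange_big/=.
under eq_bigr => x _ do rewrite -(bigA_distr_bigA (fun i v => f i v (x i))).
rewrite -(bigA_distr_bigA (fun i a => \sum_v f i v a)).
by apply: eq_bigr => i _; rewrite exchange_big.
Qed.

Let flip (v : bits) (x : path) : path :=
  [ffun i => if v i then x i else rev_ord (x i)].

Let flipK v : involutive (flip v).
Proof.
by move=> x; apply/ffunP => i; rewrite !ffunE; case: (v i); rewrite ?rev_ordK.
Qed.

Let lsign_rev a : lsign R (rev_ord a) = - lsign R a.
Proof. by elim/ord2P: a; rewrite /lsign /= ?opprK. Qed.

Let wt (v : bits) (x : path) := \prod_i r i (v i) (x i).

Let wt_flip v x : wt v (flip v x) = wt v x.
Proof. by apply: eq_bigr => i _; rewrite ffunE /r; case: (v i). Qed.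

Let wt_ge0 v x : 0 <= wt v x.
Proof. exact: prodr_ge0. Qed.

Let kn (v : bits) (x : path) :=
  \sum_i (if v i then e i * lsign R (x i) else 0).
Let coins (v : bits) (x : path) :=
  \sum_i (if v i then 0 else e i * lsign R (x i)).
Let card (v : bits) : R := \sum_i (v i)%:R.

Let e_le1 i : `|e i| <= 1.
Proof. by case: (e_trit i) => ->; rewrite ?normrN ?normr0 ?normr1. Qed.

Let kn_le v x : `|kn v x| <= card v.
Proof.
apply: le_trans (ler_norm_sum _ _ _) _; apply: ler_sum => i _.
case: (v i); last by rewrite normr0.
by rewrite normrM /lsign; case: ifP; rewrite ?normrN normr1 mulr1.
Qed.

Let kn_flip v x : kn v (flip v x) = kn v x.
Proof. by apply: eq_bigr => i _; rewrite ffunE; case: (v i). Qed.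

Let coins_flip v x : coins v (flip v x) = - coins v x.
Proof.
rewrite /coins -sumrN; apply: eq_bigr => i _; rewrite ffunE.
by case: (v i); rewrite ?oppr0// lsign_rev mulrN.
Qed.

Let expR_coins (v : bits) (x : path) s :
  \prod_i (if v i then expR (- lam) else expR (s * (e i * lsign R (x i)))) =
  expR (- (lam * card v) + s * coins v x).
Proof.
rewrite /card /coins -mulrN -sumrN !mulr_sumr -big_split/= expR_sum.
by apply: eq_bigr => i _; case: (v i); congr expR; rewrite /=; ring.
Qed.

(* A label with weights [q] is, with weight [D], equal to [k] and, with weight
   [2 M], a fair coin. The fair coins can be flipped together. *)
Lemma binary_independent_le :
  \sum_(x : path) (\prod_i q i (x i)) * `|\sum_i e i * lsign R (x i)| <=
  \sum_i D i * \prod_(j | j != i) Z j +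
  2 / lam * \prod_i (expR lam * M i + expR (- lam) * (Z i - M i)).
Proof.
have -> : \sum_(x : path) (\prod_i q i (x i)) * `|\sum_i e i * lsign R (x i)| =
    \sum_(x : path) \sum_v wt v x * `|\sum_i e i * lsign R (x i)|.
  apply: eq_bigr => x _; rewrite -mulr_suml; congr (_ * _).
  rewrite /wt -(bigA_distr_bigA (fun i v => r i v (x i))).
  by apply: eq_bigr => i _; exact: q_mix.
rewrite exchange_big/=.
have Zr i : \sum_v \sum_a r i v a = Z i.
  by rewrite exchange_big/= big_ord2 -!q_mix.
(* For fixed [v] the labels with [v i] true are known and the others are fair coins. Flipping all
   coins preserves the weight and changes the sign of the coin sum, so the absolute value may be
   averaged over the flip. *)
have pt v : \sum_(x : path) wt v x * `|\sum_i e i * lsign R (x i)| <= \sum_(x : path) wt v x *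
   (card v + lam^-1 * (expR (- (lam * card v) + lam * coins v x) +
      expR (- (lam * card v) + - lam * coins v x))).
  pose F x := wt v x * `|kn v x + coins v x|; pose G x := wt v x * `|kn v x - coins v x|.
  have -> : \sum_(x : path) wt v x * `|\sum_i e i * lsign R (x i)| = \sum_(x : path) F x.
    apply: eq_bigr => x _; congr (_ * `|_|); rewrite -big_split/=.
    by apply: eq_bigr => i _; case: (v i); rewrite ?addr0 ?add0r.
  have FG : \sum_(x : path) F x = \sum_(x : path) G x.
    rewrite (reindex_inj (inv_inj (flipK v)))/=; apply: eq_bigr => x _.
    by rewrite /F wt_flip kn_flip coins_flip.
  have -> : \sum_(x : path) F x = \sum_x (F x + G x) / 2.
    by rewrite -mulr_suml big_split/= -FG; field.
  apply: ler_sum => x _; rewrite /F /G -mulrDr -mulrA ler_wpM2l//.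
  set c := card v; set t := coins v x; set kk := kn v x.
  have kc : `|kk| <= c := kn_le v x.
  (* The average of |kk + t| and |kk - t| is the maximum of |kk| and |t|. The excess of |t| over c
     is then at most 1 / [lam] times the sum of exp([lam] (t - c)) and exp([lam] (- t - c)), which
     factorise over the labels. *)
  apply: le_trans (_ : c + Num.max 0 (`|t| - c) <= _).
    rewrite ler_pdivrMr//; move: kc; rewrite ler_norml => /andP[k1 k2].
    rewrite maxElt; case: ltP; case: (ger0P t) => ?; case: (ger0P (kk + t)) => ?;
      case: (ger0P (kk - t)) => ? ?; lra.
  rewrite lerD2l ge_max; apply/andP; split.
    by rewrite mulr_ge0 ?invr_ge0 ?addr_ge0 ?expR_ge0// ltW.
  rewrite mulrC ler_pdivlMr//.
  have E1 := expR_ge1Dx (- (lam * c) + lam * t).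
  have E2 := expR_ge1Dx (- (lam * c) + - lam * t).
  have P1 := expR_ge0 (- (lam * c) + lam * t).
  have P2 := expR_ge0 (- (lam * c) + - lam * t).
  case: (ger0P t) => t0; lra.
apply: le_trans (ler_sum _ (fun v _ => pt v)) _.
have -> : \sum_(v : bits) \sum_(x : path) wt v x *
   (card v + lam^-1 * (expR (- (lam * card v) + lam * coins v x) +
      expR (- (lam * card v) + - lam * coins v x))) =
  \sum_(v : bits) \sum_(x : path) wt v x * card v + lam^-1 *
  (\sum_(v : bits) \sum_(x : path) wt v x * expR (- (lam * card v) + lam * coins v x) +
   \sum_(v : bits) \sum_(x : path) wt v x * expR (- (lam * card v) + - lam * coins v x)).
  have lin (F a b : path -> R) c d :
      \sum_x F x * (c + d * (a x + b x)) =
      \sum_x F x * c + d * (\sum_x F x * a x + \sum_x F x * b x).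
    by rewrite mulrDr !mulr_sumr -!big_split; apply: eq_bigr => x _ /=; ring.
  under eq_bigr => v _ do rewrite lin.
  by rewrite big_split/= -mulr_sumr big_split.
apply: lerD.
  rewrite le_eqVlt; apply/orP; left; apply/eqP.
  have -> : \sum_(v : bits) \sum_(x : path) wt v x * card v =
      \sum_(v : bits) \sum_i \sum_(x : path) wt v x * (v i)%:R.
    apply: eq_bigr => v _; rewrite exchange_big/=; apply: eq_bigr => x _.
    by rewrite mulr_sumr.
  rewrite exchange_big/=; apply: eq_bigr => i _.
  transitivity (\sum_(v : bits) \sum_(x : path)
    \prod_j (r j (v j) (x j) * (if j == i then (v j)%:R else 1))).
    apply: eq_bigr => v _; apply: eq_bigr => x _; rewrite big_split/=; congr (_ * _).
    by rewrite (bigD1 i)//= eqxx big1 ?mulr1// => j /negPf->.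
  rewrite (sum_mix (fun j v a => r j v a * (if j == i then v%:R else 1))).
  rewrite (bigD1 i)//=; congr (_ * _).
    rewrite big_bool/= eqxx !big_ord2 /r /k; case: ifP => _ /=; ring.
  apply: eq_bigr => j /negPf ji; rewrite -Zr; apply: eq_bigr => v _.
  by apply: eq_bigr => a _; rewrite ji mulr1.
have sg s : (s = lam \/ s = - lam) ->
    \sum_(v : bits) \sum_(x : path) wt v x * expR (- (lam * card v) + s * coins v x) <=
    \prod_i (expR lam * M i + expR (- lam) * (Z i - M i)).
  move=> hs.
  have -> : \sum_(v : bits) \sum_(x : path)
      wt v x * expR (- (lam * card v) + s * coins v x) =
    \sum_(v : bits) \sum_(x : path) \prod_i (r i (v i) (x i) *
      (if v i then expR (- lam) else expR (s * (e i * lsign R (x i))))).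
    by apply: eq_bigr => v _; apply: eq_bigr => x _; rewrite -expR_coins -big_split.
  rewrite (sum_mix (fun i v a => r i v a *
    (if v then expR (- lam) else expR (s * (e i * lsign R a))))).
  apply: ler_prod => i _; apply/andP; split.
    apply: sumr_ge0 => v _; apply: sumr_ge0 => a _; rewrite mulr_ge0//.
    by case: v; rewrite expR_ge0.
  rewrite big_bool/= !big_ord2.
  have -> : r i true ord0 * expR (- lam) + r i true ord_max * expR (- lam) =
      D i * expR (- lam).
    by rewrite /r /k; case: ifP => _ /=; ring.
  have -> : expR lam * M i + expR (- lam) * (Z i - M i) =
      D i * expR (- lam) + M i * (expR lam + expR (- lam)).
    by rewrite /D; ring.
  (* A coin with e_i = 0 gives the factor 2, which is at most exp([lam]) + exp(- [lam]); for e_i of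
     modulus 1 there is equality. *)
  rewrite lerD2l /r -mulrDr ler_wpM2l//= /lsign /= !mulr1 !mulrN1 mulrN.
  have c1 : 2 <= expR lam + expR (- lam).
    by have := expR_ge1Dx lam; have := expR_ge1Dx (- lam); lra.
  by case: hs => ->; case: (e_trit i) => ->; rewrite ?mulr0 ?mulrN ?mulr1 ?opprK
    ?oppr0 ?expR0//; rewrite addrC.
rewrite [2 / lam]mulrC -mulrA ler_pM2l ?invr_gt0// mulr_natl mulr2n.
by apply: lerD; apply: sg; [left|right].
Qed.
End BinaryIndependent.

(** * The law of the label path: locality, variance and pair counts *)

Section MarkovLaw.
Variables (R : realFieldType) (K : finType) (nu : K -> R) (Q : K -> K -> R).
Local Notation path m := {ffun 'I_m -> K}.
Implicit Types (a b c : K) (f h : K -> R).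
Hypothesis nu_ge0 : forall a, 0 <= nu a.
Hypothesis nu_sum1 : \sum_a nu a = 1.
Hypothesis Q_ge0 : forall a b, 0 <= Q a b.
Hypothesis Q_sum1 : forall a, \sum_b Q a b = 1.

Definition pred_ord n (i : 'I_n) : 'I_n :=
  Ordinal (leq_ltn_trans (leq_pred i) (ltn_ord i)).

Definition step n (x : path n) (i : 'I_n) : R :=
  if (i : nat) == 0%N then nu (x i) else Q (x (pred_ord i)) (x i).

Definition plaw n (x : path n) : R := \prod_i step x i.

Lemma plaw_ge0 n (x : path n) : 0 <= plaw x.
Proof. by apply: prodr_ge0 => i _; rewrite /step; case: ifP. Qed.

Lemma plaw_gt0 n (x : path n) :
  (forall a, 0 < nu a) -> (forall a b, 0 < Q a b) -> 0 < plaw x.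
Proof. by move=> h1 h2; apply: prodr_gt0 => i _; rewrite /step; case: ifP. Qed.

(** Every factor of the law involves only neighbouring times, which have opposite parity; no factor
    sees both [i] and [j], so exchanging their values permutes the factors. *)
Lemma plaw_cross n (i j : 'I_n) : i != j -> odd i = odd j ->
  cross (@plaw n) i j.
Proof.
move=> ij oij x a a' b b'; rewrite /plaw -!big_split/=; apply: eq_bigr => k _.
rewrite /step; case: eqP => [k0|/eqP k0].
  rewrite !updE; have [kj|kj] := eqVneq k j; last by rewrite mulrC.
  by have [ki|_] := eqVneq k i; [rewrite -ki -kj eqxx in ij|rewrite mulrC].
have ppk : (pred_ord k : nat).+1 = k by rewrite /= prednK// lt0n.
have op : odd k = ~~ odd (pred_ord k) by rewrite -[in LHS]ppk.
rewrite !updE.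
have [kj|kj] := eqVneq k j; have [ki|ki] := eqVneq k i;
have [pj|pj] := eqVneq (pred_ord k) j; have [pi|pi] := eqVneq (pred_ord k) i;
  rewrite // 1?mulrC//; exfalso.
all: try (by rewrite -?ki -?kj ?eqxx in ij);
  try (by move: op; rewrite ?pi ?pj ?ki ?kj ?oij; case: (odd _));
  try (by rewrite -?pi -?pj ?eqxx in ij).
Qed.

(* The conditional law of a label given all the others is bounded below. *)
Lemma plaw_local n (d M : R) (x : path n) (i : 'I_n) a :
  0 < d -> (forall b, d <= nu b) -> (forall b b', d <= Q b b') ->
  (forall b b', Q b b' <= M) -> d <= M ->
  d ^+ 2 * \sum_b plaw (upd x i b) <= M * plaw (upd x i a).
Proof.
move=> d0 dnu dQ QM dM.
have step_upd (j : 'I_n) b : j != i -> pred_ord j != i -> step (upd x i b) j = step x j.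
  by move=> ji pji; rewrite /step !updE (negPf ji) (negPf pji).
pose w b := if (i : nat) == 0%N then nu b else Q (x (pred_ord i)) b.
have wd b : d <= w b by rewrite /w; case: ifP.
have w1 : \sum_b w b = 1 by rewrite /w; case: ((i : nat) == 0%N).
have stepi b : step (upd x i b) i = w b.
  rewrite /step /w upd_same; case: eqP => // /eqP i0; rewrite updE.
  case: eqP => // e; have := congr1 val e; rewrite /= => e'.
  by move: i0; rewrite -e'; case: (i : nat) e' => // k /= /n_Sn.
(* If [i] has a successor j, the weight of the label b is [w b] * Q b (x j) up to a common factor:
   it is at least d^2 and its sum over b is at most M. At the last time only [w b] remains, with sum
   1. *)
have [nx|/hasPn nx] := boolP (has (fun j : 'I_n => (j != i) && (pred_ord j == i)) (index_enum 'I_n)).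
  have /hasP[j _ /andP[ji /eqP pj]] := nx.
  pose rest := \prod_(k | (k != i) && (k != j)) step x k.
  have rest0 : 0 <= rest by apply: prodr_ge0 => k _; rewrite /step; case: ifP.
  have E b : plaw (upd x i b) = w b * (Q b (x j) * rest).
    rewrite /plaw (bigD1 i)//= stepi (bigD1 j)//=; congr (_ * (_ * _)).
      rewrite /step; case: eqP => [j0|_].
        by case/eqP: ji; rewrite -pj; apply/val_inj => /=; rewrite j0.
      by rewrite pj upd_same updE (negPf ji).
    apply: eq_bigr => k /andP[ki kj]; apply: step_upd => //.
    apply: contra kj => /eqP pk; apply/eqP/val_inj.
    have j0 : (j : nat) != 0%N.
      by apply: contra ji => /eqP j0; rewrite -pj; apply/eqP/val_inj; rewrite /= j0.
    have k0 : (k : nat) != 0%N.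
      by apply: contra ki => /eqP k0; rewrite -pk; apply/eqP/val_inj; rewrite /= k0.
    have := congr1 val pk; rewrite -pj /= => e.
    by rewrite -[LHS]prednK ?lt0n// e prednK// lt0n.
  rewrite E; under eq_bigr => b _ do rewrite E mulrA.
  rewrite -mulr_suml !mulrA ler_wpM2r//.
  have h1 : \sum_b w b * Q b (x j) <= M.
    rewrite -[leRHS]mul1r -w1 mulr_suml; apply: ler_sum => b _.
    by rewrite ler_wpM2l ?(le_trans (ltW d0)).
  have h2 : d * d <= w a * Q a (x j) by apply: ler_pM => //; exact: ltW.
  have M0 : 0 <= M := le_trans (ltW d0) dM.
  apply: le_trans (_ : d ^+ 2 * M <= _); first by rewrite ler_wpM2l// sqr_ge0.
  by rewrite mulrC -mulrA ler_wpM2l// expr2.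
pose rest := \prod_(k | k != i) step x k.
have rest0 : 0 <= rest by apply: prodr_ge0 => k _; rewrite /step; case: ifP.
have E b : plaw (upd x i b) = w b * rest.
  rewrite /plaw (bigD1 i)//= stepi; congr (_ * _).
  apply: eq_bigr => k ki; apply: step_upd => //.
  by have := nx k (mem_index_enum k); rewrite ki.
rewrite E; under eq_bigr => b _ do rewrite E.
rewrite -mulr_suml w1 mul1r !mulrA ler_wpM2r// expr2.
by apply: ler_pM => //; exact: ltW.
Qed.

Lemma plaw_iid n (x : path n) : (forall a b, Q a b = nu b) ->
  plaw x = \prod_i nu (x i).
Proof. by move=> Qn; apply: eq_bigr => i _; rewrite /step Qn; case: ifP. Qed.

Definition ext n (x : path n) a : path n.+1 :=
  [ffun i => oapp x a (unlift ord_max i)].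

Lemma ext_max n (x : path n) a : ext x a ord_max = a.
Proof. by rewrite ffunE unlift_none. Qed.

Lemma ext_lift n (x : path n) a i : ext x a (lift ord_max i) = x i.
Proof. by rewrite ffunE liftK. Qed.

Lemma sum_ext n (F : path n.+1 -> R) :
  \sum_x F x = \sum_x \sum_a F (ext x a).
Proof.
rewrite pair_big/=.
pose g (y : path n.+1) := ([ffun i => y (lift ord_max i)], y ord_max).
rewrite (reindex (fun q : path n * K => ext q.1 q.2))//=.
exists g => [[x a] _|y _] /=; rewrite /g.
  by rewrite ext_max; congr pair; apply/ffunP => i; rewrite ffunE ext_lift.
apply/ffunP => i; rewrite ffunE; case: unliftP => [j ->|->] //=.
by rewrite ffunE.
Qed.

Lemma plaw_ext m (x : path m.+1) a :
  plaw (ext x a) = plaw x * Q (x ord_max) a.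
Proof.
have lw : forall j, widen_ord (leqnSn m.+1) j = lift ord_max j.
  by move=> j; apply/val_inj; exact/esym/lift_max.
rewrite /plaw big_ord_recr /=; congr (_ * _); last first.
  rewrite /step/= ext_max; congr (Q _ a).
  rewrite (_ : pred_ord _ = lift ord_max ord_max) ?ext_lift//.
  by apply/val_inj; exact/esym/lift_max.
apply: eq_bigr => i _; rewrite /step lw ext_lift lift_max.
case: ifP => // _; congr (Q _ _).
rewrite (_ : pred_ord _ = lift ord_max (pred_ord i)) ?ext_lift//.
apply/val_inj; transitivity ((i : nat).-1); last exact/esym/lift_max.
by rewrite /= /bump leqNgt ltn_ord.
Qed.

Lemma plaw_ext0 (x : path 0) a : plaw (ext x a) = nu a.
Proof.
rewrite /plaw big_ord_recl big_ord0 mulr1 /step /=.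
by rewrite (_ : ord0 = ord_max) ?ext_max//; apply/val_inj.
Qed.

Lemma plaw_sum1 n : \sum_(x : path n.+1) plaw x = 1.
Proof.
elim: n => [|n IH].
  rewrite sum_ext; under eq_bigr => x _ do under eq_bigr => a _ do rewrite plaw_ext0.
  by under eq_bigr => x _ do rewrite nu_sum1; rewrite sumr_const card_ffun card_ord expn0.
rewrite sum_ext; under eq_bigr => x _ do under eq_bigr => a _ do rewrite plaw_ext.
by under eq_bigr => x _ do rewrite -mulr_sumr Q_sum1 mulr1.
Qed.

Section Variance.
Variables (h : K -> R) (c : R).
Hypothesis h01 : forall a, 0 <= h a <= 1.
Hypothesis c01 : 0 <= c < 1.
Let Qf f a := \sum_b Q a b * f b.
(** Contraction of oscillations by one transition of the chain; c = 0 is the case of independent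
    labels. *)
Hypothesis contract : forall f w, (forall a b, f a - f b <= w) ->
  forall a b, Qf f a - Qf f b <= c * w.

Let E m (F : path m.+1 -> R) := \sum_x plaw x * F x.
Let N m (x : path m.+1) := \sum_i h (x i).
Let last m (x : path m.+1) := x ord_max.

Let E_ext m (F : path m.+1 -> R) f :
  \sum_(x : path m.+1) \sum_a plaw (ext x a) * (F x * f a) =
  E (fun x => F x * Qf f (last x)).
Proof.
apply: eq_bigr => x _; rewrite /Qf !mulr_sumr; apply: eq_bigr => a _.
rewrite plaw_ext /last; ring.
Qed.

Let E_le m (F G : path m.+1 -> R) : (forall x, F x <= G x) -> E F <= E G.
Proof. by move=> FG; apply: ler_sum => x _; rewrite ler_wpM2l// plaw_ge0. Qed.

Let ED m (F G : path m.+1 -> R) : E (fun x => F x + G x) = E F + E G.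
Proof. by rewrite /E -big_split; apply: eq_bigr => x _; rewrite mulrDr. Qed.

Let EZ m k (F : path m.+1 -> R) : E (fun x => k * F x) = k * E F.
Proof. by rewrite /E mulr_sumr; apply: eq_bigr => x _; rewrite mulrCA. Qed.

Let E1 m k : E (fun _ : path m.+1 => k) = k.
Proof. by rewrite /E -mulr_suml plaw_sum1 mul1r. Qed.

Let eqE m (F G : path m.+1 -> R) : (forall x, F x = G x) -> E F = E G.
Proof. by move=> FG; apply: eq_bigr => x _; rewrite FG. Qed.

Let cov_self m f w : (forall a b, f a - f b <= w) ->
  `|E (fun x : path m.+1 => h (last x) * f (last x)) -
    E (fun x : path m.+1 => h (last x)) *
    E (fun x : path m.+1 => f (last x))| <=
  E (fun x : path m.+1 => h (last x)) * w.
Proof.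
move=> hf; set ef := E (fun x : path m.+1 => f (last x)).
have fe (x : path m.+1) : `|f (last x) - ef| <= w.
  rewrite ler_norml; apply/andP; split.
    rewrite -lerBlDr opprK; have -> : - w + ef <= f (last x) = true; last by [].
    have : ef <= E (fun _ : path m.+1 => f (last x) + w).
      by apply: E_le => y; rewrite -lerBlDl.
    by rewrite E1; lra.
  have : E (fun _ : path m.+1 => f (last x) - w) <= ef.
    by apply: E_le => y; rewrite lerBlDr -lerBlDl.
  by rewrite E1; lra.
have -> : E (fun x : path m.+1 => h (last x) * f (last x)) -
    E (fun x : path m.+1 => h (last x)) * ef =
    E (fun x : path m.+1 => h (last x) * (f (last x) - ef)).
  rewrite [E _ * ef]mulrC -EZ -[- _]mulN1r -EZ -ED; apply: eqE => x; ring.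
rewrite /E; apply: le_trans (ler_norm_sum _ _ _) _.
rewrite mulr_suml; apply: ler_sum => x _.
rewrite !normrM (ger0_norm (plaw_ge0 x)) -mulrA ler_wpM2l ?plaw_ge0//.
by have /andP[h0 _] := h01 (last x); rewrite (ger0_norm h0) ler_wpM2l.
Qed.

(* Covariances with the last label decay geometrically by [contract]. *)
Lemma plaw_variance_aux m : exists B : R,
  [/\ 0 <= B,
   forall f w, (forall a b, f a - f b <= w) ->
     `|E (fun x : path m.+1 => N x * f (last x)) - E (@N m) *
       E (fun x : path m.+1 => f (last x))| <= B * w &
   E (fun x : path m.+1 => N x ^+ 2) - E (@N m) ^+ 2 + 2 * c / (1 - c) * B <=
     (1 + c) / (1 - c) * E (@N m)].
Proof.
move/andP: c01 => [c0 c1]; have c1' : 0 < 1 - c by rewrite subr_gt0.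
have cn : 1 - c != 0 by rewrite gt_eqF.
have kE : (1 + c) / (1 - c) = 1 + 2 * c / (1 - c) by field.
have osc_h a b : h a - h b <= 1.
  by move: (h01 a) (h01 b) => /andP[? ?] /andP[? ?]; lra.
elim: m => [|m [B [B0 hB hV]]].
  have NE (x : path 1) : N x = h (last x) by rewrite /N big_ord1 (_ : ord0 = ord_max)//; apply/val_inj.
  have ENE : E (@N 0) = E (fun x : path 1 => h (last x)) by apply: eqE.
  exists (E (@N 0)); split.
  - by rewrite -[0](E1 0 0); apply: E_le => x; rewrite NE; case/andP: (h01 (last x)).
  - move=> f w hf; rewrite ENE (eqE (G := fun x => h (last x) * f (last x))).
      exact: cov_self.
    by move=> x; rewrite NE.
  - set EN := E (@N 0); set kk := 2 * c / (1 - c).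
    suff : E (fun x : path 1 => N x ^+ 2) - EN ^+ 2 <= EN.
      by rewrite kE -/kk; lra.
    apply: le_trans (_ : E (fun x : path 1 => N x ^+ 2) <= _).
      by rewrite lerBlDr lerDl sqr_ge0.
    apply: E_le => x; rewrite NE; case/andP: (h01 (last x)) => u0 u1.
    by rewrite expr2 ler_piMl.
pose p := E (fun x : path m.+2 => h (last x)).
have lastE (f : K -> R) : E (fun x : path m.+2 => f (last x)) =
    E (fun x : path m.+1 => Qf f (last x)).
  rewrite {1}/E sum_ext; transitivity (\sum_(x : path m.+1) \sum_a
     plaw (ext x a) * (1 * f a)).
    by apply: eq_bigr => x _; apply: eq_bigr => a _; rewrite /last ext_max mul1r.
  by rewrite E_ext; apply: eqE => x; rewrite mul1r.
have N_ext (x : path m.+1) a : N (ext x a) = N x + h a.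
  rewrite /N big_ord_recr /= ext_max; congr (_ + _); apply: eq_bigr => i _.
  congr h; rewrite -(ext_lift x a); congr (ext x a _); apply/val_inj.
  exact/esym/lift_max.
have NfE (f : K -> R) : E (fun x : path m.+2 => N x * f (last x)) =
    E (fun x : path m.+1 => N x * Qf f (last x)) +
    E (fun x : path m.+2 => h (last x) * f (last x)).
  rewrite (lastE (fun a => h a * f a)) {1}/E sum_ext -E_ext.
  have -> : E (fun x : path m.+1 => Qf (fun a => h a * f a) (last x)) =
      \sum_(x : path m.+1) \sum_a plaw (ext x a) * (1 * (h a * f a)).
    by rewrite E_ext; apply: eqE => x; rewrite mul1r.
  rewrite -big_split; apply: eq_bigr => x _; rewrite -big_split; apply: eq_bigr => a _ /=.
  by rewrite N_ext /last ext_max; ring.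
have Q1 a : Qf (fun=> 1) a = 1 by rewrite /Qf; under eq_bigr do rewrite mulr1.
have ENE : E (@N m.+1) = E (@N m) + p.
  transitivity (E (fun x : path m.+2 => N x * (fun=> 1) (last x))).
    by apply: eqE => x; rewrite mulr1.
  by rewrite [LHS](NfE (fun=> 1)); congr (_ + _); apply: eqE => x; rewrite ?Q1 mulr1.
have p0 : 0 <= p.
  by rewrite -[0](E1 m.+1 0); apply: E_le => x; case/andP: (h01 (last x)).
(* Covariances of the old sum with the new label shrink by c, and the new summand adds at most p *
   w. The variance grows by at most 2 c B + p. Adding the change of 2 c / (1 - c) * B, the terms in
   B cancel and (1 + c) / (1 - c) * p remains, matching the growth of the mean. *)
exists (c * B + p); split.
- by rewrite addr_ge0// mulr_ge0.
- move=> f w hf; have C1 := hB _ _ (contract hf).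
  have C2 := @cov_self m.+1 _ _ hf; rewrite -/p in C2.
  rewrite NfE ENE mulrDl; rewrite (lastE f) in C2 *.
  set e1 := E _ in C1 C2 *; set e2 := E _ in C1 C2 *; set e3 := E _ in C1 C2 *.
  rewrite opprD addrACA; apply: le_trans (ler_normD _ _) _.
  have -> : (c * B + p) * w = B * (c * w) + p * w by ring.
  exact: lerD.
have N2 : E (fun x : path m.+2 => N x ^+ 2) =
    E (fun x : path m.+1 => N x ^+ 2) +
    2 * E (fun x : path m.+1 => N x * Qf h (last x)) +
    E (fun x : path m.+2 => h (last x) ^+ 2).
  rewrite (lastE (fun a => h a ^+ 2)) {1}/E sum_ext -E_ext.
  have -> : E (fun x : path m.+1 => Qf (fun a => h a ^+ 2) (last x)) =
      \sum_(x : path m.+1) \sum_a plaw (ext x a) * (1 * h a ^+ 2).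
    by rewrite E_ext; apply: eqE => x; rewrite mul1r.
  have -> : E (fun x : path m.+1 => N x ^+ 2) =
      \sum_(x : path m.+1) \sum_a plaw (ext x a) * (N x ^+ 2 * 1).
    by rewrite (E_ext _ (fun=> 1)); apply: eqE => x; rewrite Q1 mulr1.
  rewrite mulr_sumr -!big_split; apply: eq_bigr => x _ /=.
  rewrite mulr_sumr -!big_split; apply: eq_bigr => a _ /=.
  by rewrite N_ext; ring.
have C := hB _ _ (contract osc_h); rewrite -lastE -/p mulr1 in C.
have h2 : E (fun x : path m.+2 => h (last x) ^+ 2) <= p.
  apply: E_le => x; case/andP: (h01 (last x)) => u0 u1.
  by rewrite expr2 ler_piMl.
rewrite N2 ENE kE; rewrite kE in hV; set k := 2 * c / (1 - c) in hV *.
have kB : k * c * B + 2 * c * B = k * B by rewrite /k; field.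
move: C; rewrite ler_norml => /andP[_ C].
have p2 := sqr_ge0 p.
set e1 := E _ in C hV *; set e2 := E _ in C hV *; set e3 := E _ in C hV h2 *; set e4 := E _ in h2 *.
nra.
Qed.

Lemma plaw_variance m :
  \sum_(x : path m.+1) plaw x * (\sum_i h (x i) - \sum_(y : path m.+1) plaw y * \sum_i h (y i)) ^+ 2
  <= (1 + c) / (1 - c) * \sum_(x : path m.+1) plaw x * \sum_i h (x i).
Proof.
have [B [B0 _ hV]] := plaw_variance_aux m.
apply: le_trans hV; move/andP: c01 => [c0 c1].
pose e := E (@N m).
rewrite -[leLHS]/(E (fun x : path m.+1 => (N x - e) ^+ 2)).
have -> : E (fun x : path m.+1 => (N x - e) ^+ 2) =
    E (fun x : path m.+1 => N x ^+ 2) - E (@N m) ^+ 2.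
  have -> : E (fun x : path m.+1 => (N x - e) ^+ 2) =
      E (fun x : path m.+1 => N x ^+ 2 + - (2 * e) * N x + e ^+ 2).
    by apply: eqE => x; ring.
  rewrite (ED (fun x => N x ^+ 2 + - (2 * e) * N x)) ED EZ E1.
  by rewrite -[e]/(E (@N m)); ring.
rewrite lerDl; apply: mulr_ge0 => //; apply: divr_ge0; first exact: mulr_ge0.
by rewrite subr_ge0 ltW.
Qed.
End Variance.

Definition pair_count n (a b : K) (x : path n) : R :=
  \sum_i ((x i == a) || (x i == b))%:R.

(** Chebyshev's inequality with [plaw_variance]: falling below 3/5 of [s] is a deviation of at least
    2/5 of the mean. The union bound runs over unordered pairs, whence the factor 1/2 in front of
    the ordered sum; the size assumption makes the total at most 5/16. *)
Lemma pair_count_concentration m (c s : R) : 0 <= c < 1 ->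
  (forall f w, (forall a b, f a - f b <= w) -> forall a b,
     \sum_b0 Q a b0 * f b0 - \sum_b0 Q b b0 * f b0 <= c * w) ->
  0 < s ->
  (forall a b, a != b -> s <= \sum_(x : path m.+1) plaw x * pair_count a b x) ->
  10 * #|K|%:R * (#|K|%:R - 1) * ((1 + c) / (1 - c)) <= s ->
  \sum_(x : path m.+1) plaw x *
    [exists a, exists b, (a != b) && (pair_count a b x < 3 / 5 * s)%R]%:R <= 5 / 16.
Proof.
move=> c01 contract s0 hs big.
pose bad a b (x : path m.+1) : R := ((pair_count a b x < 3 / 5 * s)%R)%:R.
pose k := (1 + c) / (1 - c).
have k0 : 0 <= k.
  case/andP: c01 => c0 c1; apply: divr_ge0; first by rewrite addr_ge0.
  by rewrite subr_ge0 ltW.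
have badP a b : a != b ->
    \sum_(x : path m.+1) plaw x * bad a b x <= k / (4 / 25 * s).
  move=> ab; set e := \sum_(x : path m.+1) plaw x * pair_count a b x.
  have es : s <= e := hs _ _ ab.
  have e0 : 0 < e := lt_le_trans s0 es.
  pose h z : R := ((z == a) || (z == b))%:R.
  have h01 z : 0 <= h z <= 1 by rewrite /h ler0n boolr_le1.
  have V : \sum_(x : path m.+1) plaw x * (pair_count a b x - e) ^+ 2 <=
    k * e := plaw_variance h01 c01 contract m.
  apply: le_trans (_ : k / (4 / 25 * e) <= _); last first.
    rewrite ler_wpM2l// lef_pV2 ?posrE ?mulr_gt0//.
    by rewrite ler_pM2l.
  rewrite ler_pdivlMr ?mulr_gt0// -(ler_pM2r e0).
  have sq (u : R) : u * (4 / 25 * e) * e = u * (2 / 5 * e) ^+ 2 by field.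
  rewrite sq; apply: le_trans V; rewrite mulr_suml; apply: ler_sum => x _.
  rewrite -mulrA ler_wpM2l ?plaw_ge0// /bad.
  case: ltP => hx; last by rewrite mul0r sqr_ge0.
  rewrite mul1r -[leRHS]sqrrN opprB ler_sqr ?nnegrE ?mulr_ge0 ?ltW//.
    by move: hx; rewrite /pair_count -/h; lra.
  by move: hx; rewrite /pair_count -/h; lra.
apply: le_trans (_ : \sum_(x : path m.+1) plaw x *
    (2^-1 * \sum_a \sum_(b | b != a) bad a b x) <= _).
  apply: ler_sum => x _; rewrite ler_wpM2l ?plaw_ge0//.
  case: (boolP [exists a, _]) => [/existsP[a /existsP[b /andP[ab hab]]]|_]; last first.
    by rewrite mulr_ge0// ?invr_ge0//; apply: sumr_ge0 => ? _; apply: sumr_ge0.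
  have hba : bad b a x = 1.
    rewrite /bad (_ : pair_count b a x = pair_count a b x) ?hab//.
    by apply: eq_bigr => i _; rewrite orbC.
  have hab' : bad a b x = 1 by rewrite /bad hab.
  pose g a' := \sum_(b' | b' != a') bad a' b' x.
  have g0 a' : 0 <= g a' by apply: sumr_ge0.
  have r1 : 1 <= g a by rewrite /g (bigD1 b) 1?eq_sym//= hab' lerDl sumr_ge0.
  have r2 : 1 <= g b by rewrite /g (bigD1 a)//= hba lerDl sumr_ge0.
  suff h2 : 2 <= \sum_a' g a'.
    apply: le_trans (_ : 2^-1 * 2 <= _); first by rewrite mulVf.
    by apply: ler_wpM2l => //; rewrite invr_ge0.
  rewrite (bigD1 a)//= (bigD1 b)//= 1?eq_sym//.
  have : 0 <= \sum_(a' | (a' != a) && (a' != b)) g a' by apply: sumr_ge0.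
  lra.
have -> : \sum_(x : path m.+1) plaw x * (2^-1 * \sum_a \sum_(b | b != a) bad a b x)
   = 2^-1 * \sum_a \sum_(b | b != a) \sum_(x : path m.+1) plaw x * bad a b x.
  rewrite (eq_bigr (fun a => \sum_(x : path m.+1) plaw x * \sum_(b | b != a) bad a b x)).
    rewrite exchange_big/= mulr_sumr; apply: eq_bigr => x _.
    by rewrite mulrCA mulr_sumr.
  move=> a _; rewrite exchange_big/=; apply: eq_bigr => x _.
  by rewrite mulr_sumr.
apply: le_trans (_ : 2^-1 * (#|K|%:R * ((#|K|%:R - 1) * (k / (4 / 25 * s)))) <= _).
  rewrite ler_pM2l ?invr_gt0// mulr_natl -sumr_const; apply: ler_sum => a _.
  apply: le_trans (_ : \sum_(b | b != a) (k / (4 / 25 * s)) <= _).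
    by apply: ler_sum => b ba; apply: badP; rewrite eq_sym.
  rewrite sumr_const -[leLHS]mulr_natl; apply: ler_wpM2r.
    by rewrite divr_ge0// mulr_ge0// ltW.
  have K0 : (0 < #|K|)%N by apply/card_gt0P; exists a.
  by rewrite (cardC1 a : #|[pred b | b != a]| = _) -subn1 natrB.
have -> : 2^-1 * (#|K|%:R * ((#|K|%:R - 1) * (k / (4 / 25 * s)))) =
   (10 * #|K|%:R * (#|K|%:R - 1) * k) / s * (5 / 16).
  by field; rewrite gt_eqF.
rewrite -[leRHS]mul1r ler_wpM2r// ler_pdivrMr// mul1r; exact: big.
Qed.
End MarkovLaw.

Local Open Scope classical_set_scope.

(** * Bounded measurable functions and functionals on them *)

Section WeightedIntegral.
Context {R : realType} {d : measure_display} {T : measurableType d}.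
Variables (mu : {measure set T -> \bar R}) (V : T -> R).

Definition bm (f : T -> R) : Prop :=
  measurable_fun setT f /\ exists M, forall t, `|f t| <= M.

Lemma bm_cst k : bm (fun=> k).
Proof. by split; [exact: measurable_cst|exists `|k|]. Qed.

Lemma bmD f g : bm f -> bm g -> bm (fun t => f t + g t).
Proof.
move=> [mf [M hM]] [mg [N hN]]; split; first exact: measurable_funD.
by exists (M + N) => t; apply: le_trans (ler_normD _ _) (lerD _ _).
Qed.

Lemma bmM f g : bm f -> bm g -> bm (fun t => f t * g t).
Proof.
move=> [mf [M hM]] [mg [N hN]]; split; first exact: measurable_funM.
by exists (M * N) => t; rewrite normrM ler_pM.
Qed.

Lemma bmZ k f : bm f -> bm (fun t => k * f t).
Proof. by apply: bmM; exact: bm_cst. Qed.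

Lemma bm_sum (I : Type) (s : seq I) (p : pred I) (f : I -> T -> R) :
  (forall i, bm (f i)) -> bm (fun t => \sum_(i <- s | p i) f i t).
Proof.
move=> hf; elim: s => [|i s IH].
  by rewrite (_ : (fun t => _) = (fun=> 0)); [exact: bm_cst|apply/funext => t; rewrite big_nil].
case pi: (p i); last first.
  by rewrite (_ : (fun t => _) = (fun t => \sum_(i <- s | p i) f i t))//; apply/funext => t; rewrite big_cons pi.
rewrite (_ : (fun t => _) = (fun t => f i t + \sum_(i <- s | p i) f i t)); first exact: bmD.
by apply/funext => t; rewrite big_cons pi.
Qed.

Lemma bm_prod (I : Type) (s : seq I) (p : pred I) (f : I -> T -> R) :
  (forall i, bm (f i)) -> bm (fun t => \prod_(i <- s | p i) f i t).
Proof.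
move=> hf; elim: s => [|i s IH].
  by rewrite (_ : (fun t => _) = (fun=> 1)); [exact: bm_cst|apply/funext => t; rewrite big_nil].
case pi: (p i); last first.
  by rewrite (_ : (fun t => _) = (fun t => \prod_(i <- s | p i) f i t))//; apply/funext => t; rewrite big_cons pi.
rewrite (_ : (fun t => _) = (fun t => f i t * \prod_(i <- s | p i) f i t)); first exact: bmM.
by apply/funext => t; rewrite big_cons pi.
Qed.

Lemma bm_indic (A : set T) : measurable A -> bm (\1_A).
Proof.
move=> mA; split; first exact: measurable_indic.
by exists 1 => t; rewrite indicE normr_nat boolr_le1.
Qed.

Hypothesis V_ge0 : forall t, 0 <= V t.
Hypothesis mV : measurable_fun setT V.
Hypothesis V_fin : (\int[mu]_t (V t)%:E < +oo)%E.

Definition wint (f : T -> R) : R := \int[mu]_t (f t * V t).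

Lemma bm_integrable f : bm f -> mu.-integrable setT (EFin \o (fun t => f t * V t)).
Proof.
move=> [mf [M hM]].
rewrite (_ : EFin \o _ = ((EFin \o f) \* (EFin \o V))%E)//.
apply: integrableMr => //.
  by exists M; split; rewrite ?num_real// => x Mx t _; exact: le_trans (hM t) (ltW Mx).
apply/integrableP; split; first exact/measurable_EFinP.
by under eq_integral => t _ do rewrite /= ger0_norm//.
Qed.

Lemma wintD f g : bm f -> bm g -> wint (fun t => f t + g t) = wint f + wint g.
Proof.
move=> hf hg; rewrite /wint -RintegralD//; try exact: bm_integrable.
by apply: eq_Rintegral => t _; rewrite mulrDl.
Qed.

Lemma wintZ k f : bm f -> wint (fun t => k * f t) = k * wint f.
Proof.
move=> hf; rewrite /wint -RintegralZl//; last exact: bm_integrable.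
by apply: eq_Rintegral => t _; rewrite mulrA.
Qed.

Lemma wint_ext f g : (forall t, f t = g t) -> wint f = wint g.
Proof. by move=> fg; apply: eq_Rintegral => t _; rewrite fg. Qed.

Lemma wint0 : wint (fun=> 0) = 0.
Proof.
transitivity (wint (fun t => 0 * (fun=> 0) t)).
  by apply: wint_ext => t; rewrite mul0r.
by rewrite (wintZ 0 (bm_cst 0)) mul0r.
Qed.

Lemma wint_le f g : bm f -> bm g -> (forall t, f t <= g t) -> wint f <= wint g.
Proof.
move=> hf hg fg; apply: le_Rintegral => //; try exact: bm_integrable.
by move=> t _; rewrite ler_wpM2r.
Qed.

Lemma wint_ge0 f : (forall t, 0 <= f t) -> 0 <= wint f.
Proof. by move=> f0; apply: Rintegral_ge0 => t _; rewrite mulr_ge0. Qed.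

Lemma wint_sum (I : Type) (s : seq I) (p : pred I) (f : I -> T -> R) :
  (forall i, bm (f i)) ->
  wint (fun t => \sum_(i <- s | p i) f i t) = \sum_(i <- s | p i) wint (f i).
Proof.
move=> hf; elim: s => [|i s IH].
  rewrite [RHS]big_nil; transitivity (wint (fun=> 0)); last exact: wint0.
  by apply: wint_ext => t; rewrite big_nil.
rewrite big_cons -IH; case pi: (p i); last first.
  by apply: wint_ext => t; rewrite big_cons pi.
rewrite -(wintD (hf i) (bm_sum _ _ hf)).
by apply: wint_ext => t; rewrite big_cons pi.
Qed.

Lemma wint_abs f M : bm f -> (forall t, `|f t| <= M) -> `|wint f| <= M * wint (fun=> 1).
Proof.
move=> hf hM; have -> : M * wint (fun=> 1) = wint (fun=> M).
  rewrite -wintZ; last exact: bm_cst.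
  by apply: wint_ext => t; rewrite mulr1.
rewrite ler_norml; apply/andP; split; last first.
  by apply: wint_le => //; [exact: bm_cst|move=> t; exact: le_trans (ler_norm _) (hM t)].
rewrite lerNl -mulN1r -wintZ//; apply: wint_le; [exact: bmZ|exact: bm_cst|].
by move=> t; rewrite mulN1r; apply: le_trans (hM t); rewrite -normrN ler_norm.
Qed.

Lemma wint_indic A : measurable A -> wint (\1_A) = \int[mu]_(t in A) V t.
Proof.
move=> mA; rewrite [RHS]Rintegral_mkcond /wint; apply: eq_Rintegral => t _.
by rewrite patchE indicE; case: (t \in A); rewrite ?mul1r ?mul0r.
Qed.

Lemma wint_indicE A : measurable A ->
  (wint (\1_A))%:E = (\int[mu]_(t in A) (V t)%:E)%E.
Proof.
move=> mA; rewrite wint_indic// /Rintegral fineK//.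
rewrite ge0_fin_numE; last by apply: integral_ge0 => t _; rewrite lee_fin.
apply: le_lt_trans V_fin; apply: ge0_subset_integral => //; first exact/measurable_EFinP.
by move=> t _; rewrite lee_fin.
Qed.

End WeightedIntegral.

Section BoundedFunctional.
Context {R : realType} {d : measure_display} {T : measurableType d}.
Variables (F : (T -> R) -> R) (C : R).
Hypothesis F_ext : forall f g, (forall t, f t = g t) -> F f = F g.
Hypothesis FD : forall f g, bm f -> bm g -> F (fun t => f t + g t) = F f + F g.
Hypothesis FZ : forall k f, bm f -> F (fun t => k * f t) = k * F f.
Hypothesis F_bound : forall f M, bm f -> (forall t, `|f t| <= M) -> `|F f| <= C * M.
Hypothesis F_indic : forall A, measurable A -> F (\1_A) = 0.

Let F_sum (N : nat) (f : nat -> T -> R) : (forall k, bm (f k)) ->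
  (forall k, F (f k) = 0) -> F (fun t => \sum_(k < N) f k t) = 0.
Proof.
move=> hf h0; elim: N => [|N IH].
  rewrite (@F_ext _ (fun t => 0 * f 0%N t)); first by rewrite FZ// mul0r.
  by move=> t; rewrite big_ord0 mul0r.
rewrite (@F_ext _ (fun t => \sum_(k < N) f k t + f N t)).
  by rewrite FD ?IH ?h0 ?addr0//; exact: bm_sum.
by move=> t; rewrite big_ord_recr.
Qed.

(** The sum counts the positive integers up to [v], that is, the integer part of [v]; it provides
    the step function approximating a bounded function within one step. *)
Let count_floor (N : nat) (v : R) : 0 <= v <= N%:R ->
  v - 1 <= \sum_(k < N) ((k.+1%:R <= v)%R)%:R <= v.
Proof.
elim: N => [|N IH] /andP[v0 vN]; first by rewrite big_ord0 v0; lra.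
rewrite big_ord_recr /=; have [vN'|vN'] := leP v N%:R.
  have -> : (N.+1%:R <= v)%R = false by apply/negbTE; rewrite -ltNge -natr1; lra.
  by rewrite addr0; apply: IH; rewrite v0.
have -> : \sum_(k < N) ((k.+1%:R <= v)%R)%:R = N%:R :> R.
  rewrite (eq_bigr (fun=> 1)) ?sumr_const ?card_ord// => k _.
  by rewrite (le_trans _ (ltW vN'))// ler_nat.
have e : N.+1%:R = N%:R + 1 :> R by rewrite natr1.
by rewrite e in vN *; case: (leP (N%:R + 1) v) => h /=; apply/andP; split; lra.
Qed.

(* A functional vanishing on indicators vanishes on bounded functions, which are
   uniform limits of step functions. *)
Lemma bounded_functional_eq0 f : bm f -> F f = 0.
Proof.
move=> hf; have [mf [M hM]] := hf.
pose M' := `|M| + 1.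
have M0 : 0 < M' by rewrite ltr_wpDl.
have fM t : - M' < f t < M'.
  have : `|f t| < M' by rewrite (le_lt_trans (hM t))// /M' (le_lt_trans (ler_norm M))// ltrDl.
  by rewrite ltr_norml.
have Fcst k : F (fun=> k) = 0.
  rewrite (@F_ext _ (fun t => k * \1_[set: T] t)); first by rewrite FZ ?F_indic ?mulr0//; exact: bm_indic.
  by move=> t; rewrite indicT /= mulr1.
suff h (N : nat) : `|F f| * N.+1%:R <= C * (2 * M').
  apply/normr0_eq0/le_anti; rewrite normr_ge0 andbT leNgt; apply/negP => F0.
  have := h (Num.truncn (C * (2 * M') / `|F f|)).
  move=> h'; have := truncnS_gt (C * (2 * M') / `|F f|).
  by rewrite ltr_pdivrMr// [X in _ < X]mulrC ltNge h'.
pose e := 2 * M' / N.+1%:R.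
have e0 : 0 < e by rewrite divr_gt0// mulr_gt0.
have eN : e * N.+1%:R = 2 * M' by rewrite divfK.
pose A k := [set t | k.+1%:R * e <= f t + M'].
have mA k : measurable (A k).
  rewrite -[A k]setTI; apply: (measurable_fun_le (f := fun=> k.+1%:R * e) (g := fun t => f t + M')).
  - exact: measurableT.
  - exact: measurable_cst.
  - by apply: measurable_funD => //; exact: measurable_cst.
pose s t := \sum_(k < N.+1) e * \1_(A k) t + (- M').
have bs : bm (fun t => \sum_(k < N.+1) e * \1_(A k) t).
  by apply: bm_sum => k; apply/bmZ/bm_indic.
have Fs : F s = 0.
  rewrite FD ?Fcst ?addr0//; last exact: bm_cst.
  apply: (@F_sum _ (fun k t => e * \1_(A k) t)) => k; first by apply/bmZ/bm_indic.
  by rewrite FZ ?F_indic ?mulr0//; exact: bm_indic.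
have sf t : `|f t - s t| <= e.
  pose v := (f t + M') / e.
  have /andP[f1 f2] := fM t.
  have v01 : 0 <= v <= N.+1%:R.
    by rewrite divr_ge0 ?ler_pdivrMr ?[_ * e]mulrC ?eN; lra.
  have /andP[c1 c2] := count_floor v01.
  have -> : s t = e * (\sum_(k < N.+1) ((k.+1%:R <= v)%R)%:R) - M'.
    rewrite /s mulr_sumr; congr (_ - _); apply: eq_bigr => k _; congr (_ * _).
    have -> : (k.+1%:R <= v)%R = (t \in A k); last by rewrite indicE.
    rewrite /v ler_pdivlMr//; apply/idP/idP => [h|/set_mem//].
    exact/mem_set.
  have ev : f t = e * v - M' by rewrite /v; field; rewrite gt_eqF.
  rewrite ev ler_norml; apply/andP; nra.
have bf : bm (fun t => f t + -1 * s t).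
  by apply: bmD => //; apply/bmZ/bmD => //; exact: bm_cst.
have : `|F (fun t => f t + -1 * s t)| <= C * e.
  by apply: F_bound => // t; rewrite mulN1r.
rewrite FD//; last by apply/bmZ/bmD => //; exact: bm_cst.
rewrite FZ; last by apply/bmD => //; exact: bm_cst.
by rewrite Fs mulr0 addr0 => h; rewrite -eN mulrA ler_wpM2r.
Qed.
End BoundedFunctional.

Lemma bm_comp {R : realType} d1 d2 (T1 : measurableType d1) (T2 : measurableType d2)
    (f : T2 -> R) (g : T1 -> T2) :
  bm f -> measurable_fun setT g -> bm (fun t => f (g t)).
Proof.
move=> [mf [M hM]] mg; split; last by exists M.
exact: (measurableT_comp mf mg).
Qed.

Lemma measurable_inv_ge0 {R : realType} d1 (T1 : measurableType d1) (f : T1 -> R) :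
  (forall t, 0 <= f t) -> measurable_fun setT f -> measurable_fun setT (fun t => (f t)^-1).
Proof.
move=> f0 mf; rewrite (_ : (fun t => _) = (fun t => f t `^ (-1))).
  exact: (measurableT_comp (measurable_powR (-1)) mf).
by apply/funext => t; rewrite powR_inv1.
Qed.

(** * Joint law of the label path and the observations *)

Section HmmLaw.
Context {R : realType} {J : nat} {dY : measure_display} {TY : measurableType dY}.
Context {L : {measure set TY -> \bar R}} (theta : hmm_param J L).
Context {d : measure_display} {Omega : measurableType d}.
Variables (P : probability Omega R) (X : nat -> Omega -> 'I_J) (Y : nat -> Omega -> TY).
Hypothesis XY : is_hmm P X Y theta.
Variable n : nat.
Local Notation path := {ffun 'I_n -> 'I_J}.
Implicit Types (x : path) (a b : 'I_J).

Let f a := hmm_f theta a.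
Let f_ge0 a y : 0 <= f a y. Proof. exact: hmm_f_ge0. Qed.
Let mf a : measurable_fun setT (f a). Proof. exact: hmm_f_measurable. Qed.
Let f_fin a : (\int[L]_t (f a t)%:E < +oo)%E.
Proof. by rewrite /f hmm_f_int1 ltry. Qed.

Definition fint a : (TY -> R) -> R := wint L (f a).

Definition EE : (Omega -> R) -> R := wint P (fun=> 1).

Let one_ge0 (w : Omega) : 0 <= (1 : R). Proof. exact: ler01. Qed.
Let m_one : measurable_fun [set: Omega] (fun=> 1 : R). Proof. exact: measurable_cst. Qed.
Let one_fin : (\int[P]_w (1 : R)%:E < +oo)%E.
Proof. by rewrite integral_cst// mul1e (le_lt_trans (probability_le1 P _))// ltry. Qed.

Lemma EED g h : bm g -> bm h -> EE (fun w => g w + h w) = EE g + EE h.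
Proof. exact: wintD. Qed.
Lemma EEZ k g : bm g -> EE (fun w => k * g w) = k * EE g.
Proof. exact: wintZ. Qed.
Lemma EE_le g h : bm g -> bm h -> (forall w, g w <= h w) -> EE g <= EE h.
Proof. exact: wint_le. Qed.
Lemma EE_ge0 g : (forall w, 0 <= g w) -> 0 <= EE g.
Proof. exact: wint_ge0. Qed.
Lemma EE_sum (I : Type) (s : seq I) (p : pred I) (g : I -> Omega -> R) :
  (forall i, bm (g i)) ->
  EE (fun w => \sum_(i <- s | p i) g i w) = \sum_(i <- s | p i) EE (g i).
Proof. exact: wint_sum. Qed.
Lemma EE_ext g h : (forall w, g w = h w) -> EE g = EE h.
Proof. exact: wint_ext. Qed.

Lemma EE_indic (A : set Omega) : measurable A -> EE (\1_A) = fine (P A).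
Proof. by move=> mA; rewrite /EE wint_indic// Rintegral_cst// mul1r. Qed.

Lemma EE_expectation g : fine 'E_P[g] = EE g.
Proof.
rewrite unlock /EE /wint; congr fine; apply: eq_integral => w _.
by rewrite mulr1.
Qed.

Lemma EE1 : EE (fun=> 1) = 1.
Proof.
rewrite (@EE_ext _ (\1_[set: Omega])) => [|w]; last by rewrite indicT.
by rewrite EE_indic// (probability_setT P).
Qed.

Lemma fint1 a : fint a (fun=> 1) = 1.
Proof.
rewrite /fint /wint /Rintegral (eq_integral (fun t => (f a t)%:E)).
  by rewrite /f hmm_f_int1.
by move=> t _; rewrite mul1r.
Qed.

Definition cyl x : set Omega := [set w | forall i : 'I_n, X i w = x i].
Definition path_of w : path := [ffun i : 'I_n => X i w].
Definition plawP x : R := fine (P (cyl x)).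

Lemma in_cyl x w : \1_(cyl x) w = (x == path_of w)%:R :> R.
Proof.
rewrite indicE; congr (nat_of_bool _)%:R; apply/idP/eqP => [/set_mem h|->].
  by apply/ffunP => i; rewrite ffunE h.
by apply/mem_set => i; rewrite /= ffunE.
Qed.

Definition xtend (a0 : 'I_J) x (k : nat) : 'I_J := oapp x a0 (insub k : option 'I_n).

Lemma xtendE a0 x (i : 'I_n) : xtend a0 x i = x i.
Proof. by rewrite /xtend valK. Qed.

Lemma cylE a0 x : cyl x = label_path X (xtend a0 x) n.
Proof.
apply/seteqP; split => w /= h.
  by move=> i hi; rewrite (h (Ordinal hi)) -(xtendE a0).
by move=> i; rewrite h ?xtendE.
Qed.

Let mXi i b : measurable (X i @^-1` [set b]).
Proof. by have [[mX _ _] _] := XY; exact: mX. Qed.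

Let mY i : measurable_fun [set: Omega] (Y i).
Proof. by have [_ [mY _]] := XY; exact: mY. Qed.

Lemma measurable_cyl x : measurable (cyl x).
Proof.
rewrite (_ : cyl x = \bigcap_k
   (if (insub k : option 'I_n) is Some i then X k @^-1` [set x i] else setT)).
  by apply: bigcapT_measurable => k; case: insub.
apply/seteqP; split => w /= h.
  by move=> k _; case: insubP => [i hi <-|//] /=.
by move=> i; have := h (i : nat) I; rewrite valK.
Qed.

Lemma bm_Y i (g : TY -> R) : bm g -> bm (fun w => g (Y i w)).
Proof. by move=> hg; exact: bm_comp. Qed.

Lemma bm_cyl x : bm (\1_(cyl x) : Omega -> R).
Proof. exact/bm_indic/measurable_cyl. Qed.

Lemma joint_indic x (A : 'I_n -> set TY) : (forall i, measurable (A i)) ->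
  EE (fun w => \1_(cyl x) w * \prod_i \1_(A i) (Y i w)) =
  plawP x * \prod_i fint (x i) (\1_(A i)).
Proof.
move=> mA.
(* A finite path is extended to all times by a default label, taken to be its first one; without any
   time there is no such label, and the identity is direct. *)
have [n0|] := posnP n.
  have noI (i : 'I_n) : False by have := ltn_ord i; rewrite {2}n0.
  rewrite big1 ?mulr1; last by move=> i; case: (noI i).
  rewrite (@EE_ext _ (\1_(cyl x))) ?EE_indic//; first exact: measurable_cyl.
  by move=> w; rewrite big1 ?mulr1// => i; case: (noI i).
move=> n0; pose i0 := Ordinal n0; pose a0 := x i0.
pose A' k := oapp A setT (insub k : option 'I_n).
have mA' k : measurable (A' k) by rewrite /A'; case: insub => //= i; exact: mA.
have A'E (i : 'I_n) : A' i = A i by rewrite /A' valK.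
pose E := label_path X (xtend a0 x) n `&` [set w | forall i, (i < n)%N -> A' i (Y i w)].
have mE : measurable E.
  apply: measurableI; first by rewrite -cylE; exact: measurable_cyl.
  rewrite (_ : [set w | _] = \bigcap_k (if (k < n)%N then Y k @^-1` (A' k) else setT)).
    apply: bigcapT_measurable => k; case: ifP => // _.
    by rewrite -[_ @^-1` _]setTI; exact: mY.
  apply/seteqP; split => w /= h k; first by move=> _; case: ifP => // /h.
  by move=> kn; have := h k I; rewrite kn.
rewrite (@EE_ext _ (\1_E)); last first.
  move=> w; rewrite -cylE in E mE *.
  have -> : \prod_i \1_(A i) (Y i w) =
      \1_[set w | forall i, (i < n)%N -> A' i (Y i w)] w :> R.
    rewrite indicE; case: (boolP (w \in _)) => [/set_mem/= h|/negP h].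
      by apply: big1 => i _; rewrite indicE mem_set// -A'E; exact: h.
    apply/eqP/prodf_eq0; have : exists i : 'I_n, ~ A i (Y i w).
      apply: contrapT => ne; apply: h; apply/mem_set => i hi /=.
      by apply: contrapT => nA; apply: ne; exists (Ordinal hi); rewrite -A'E.
    by move=> [i nA]; exists i => //; rewrite indicE memNset.
  by rewrite -[RHS]/((\1_(cyl x `&` _)) w) indicI.
rewrite EE_indic// /E (proj2 (proj2 XY))// -cylE.
rewrite fineM// ?fin_num_measure//; last exact: measurable_cyl.
congr (_ * _); rewrite /=; apply: eq_bigr => i _.
by rewrite xtendE A'E /fint wint_indic.
Qed.

(** Indicators are replaced by bounded functions one coordinate at a time: with the other factors
    frozen, the difference of the two sides is a bounded linear functional of one factor and
    vanishes on indicators, so [bounded_functional_eq0] applies. *)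
Lemma joint_prod x (psi : 'I_n -> TY -> R) : (forall i, bm (psi i)) ->
  EE (fun w => \1_(cyl x) w * \prod_i psi i (Y i w)) =
  plawP x * \prod_i fint (x i) (psi i).
Proof.
suff h k : forall psi, (forall i, bm (psi i)) ->
    (forall i : 'I_n, (k <= i)%N -> exists2 A, measurable A & psi i = \1_A) ->
    EE (fun w => \1_(cyl x) w * \prod_i psi i (Y i w)) =
    plawP x * \prod_i fint (x i) (psi i).
  move=> bpsi; apply: (h n) => // i; by rewrite leqNgt ltn_ord.
elim: k => [|k IH] {}psi bpsi hpsi.
  have [A hA] := choice (fun i => let: ex_intro2 A mA e := hpsi i (leq0n _) in
    ex_intro (fun A => measurable A /\ psi i = \1_A) A (conj mA e)).
  have -> : psi = fun i => \1_(A i) by apply/funext => i; case: (hA i).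
  by apply: joint_indic => i; case: (hA i).
have [kn|kn] := ltnP k n; last first.
  apply: IH => // i ki; have := leq_ltn_trans ki (ltn_ord i).
  by rewrite ltnNge kn.
pose i0 := Ordinal kn.
pose rest w := \1_(cyl x) w * \prod_(i | i != i0) psi i (Y i w).
pose kap := plawP x * \prod_(i | i != i0) fint (x i) (psi i).
have brest : bm rest.
  by apply: bmM; [exact: bm_cyl|apply: bm_prod => i; exact: bm_Y].
pose F phi := EE (fun w => phi (Y i0 w) * rest w) + (- kap) * fint (x i0) phi.
suff : F (psi i0) = 0.
  rewrite /F mulNr => /eqP; rewrite subr_eq0 => /eqP e.
  rewrite (@EE_ext _ (fun w => psi i0 (Y i0 w) * rest w)).
    by rewrite e /kap [in RHS](bigD1 i0)//=; ring.
  by move=> w; rewrite (bigD1 i0)//= /rest; ring.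
have [_ [C hC]] := brest.
apply: (@bounded_functional_eq0 _ _ _ F (C + `|kap|)) => //.
- move=> g h gh; rewrite /F (_ : g = h)//; exact/funext.
- move=> g h bg bh; rewrite /F.
  rewrite (@EE_ext _ (fun w => g (Y i0 w) * rest w + h (Y i0 w) * rest w)).
    rewrite EED ?[fint _ (fun t => _)](wintD _ _ _ bg bh)//;
      try (by apply: bmM => //; exact: bm_Y).
    by rewrite /fint; ring.
  by move=> w; ring.
- move=> c g bg; rewrite /F.
  rewrite (@EE_ext _ (fun w => c * (g (Y i0 w) * rest w))).
    rewrite EEZ ?[fint _ (fun t => _)](wintZ _ _ _ _ bg)//;
      last by apply: bmM => //; exact: bm_Y.
    by rewrite /fint; ring.
  by move=> w; ring.
- move=> g M bg hM; rewrite /F mulrDl; apply: le_trans (ler_normD _ _) _.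
  apply: lerD.
    have bgr : bm (fun w => g (Y i0 w) * rest w) by apply: bmM => //; exact: bm_Y.
    have := wint_abs one_ge0 m_one one_fin bgr (M := C * M).
    rewrite -/EE EE1 mulr1; apply => w; rewrite normrM mulrC.
    by rewrite ler_pM.
  rewrite normrM normrN ler_wpM2l//.
  have := wint_abs (f_ge0 _) (mf _) (f_fin _) bg hM.
  by move/(_ (x i0)); rewrite -/(fint (x i0)) fint1 mulr1.
- move=> A mA; rewrite /F mulNr; apply/eqP; rewrite subr_eq0; apply/eqP.
  pose psi' i := if i == i0 then \1_A else psi i.
  have bpsi' i : bm (psi' i) by rewrite /psi'; case: ifP => // _; exact: bm_indic.
  have := IH psi' bpsi'.
  rewrite (@EE_ext _ (fun w => \1_A (Y i0 w) * rest w)); last first.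
    move=> w; rewrite (bigD1 i0)//= {1}/psi' eqxx /rest mulrCA; congr (_ * (_ * _)).
    by apply: eq_bigr => i /negPf ii; rewrite /psi' ii.
  move=> ->.
    rewrite [in LHS](bigD1 i0)//= {1}/psi' eqxx /kap.
    rewrite (eq_bigr (fun i => fint (x i) (psi i))) => [|i /negPf ii]; first by ring.
    by rewrite /psi' ii.
  move=> i; rewrite leq_eqVlt => /orP[/eqP ki|/hpsi [B mB eB]].
    by exists A => //; rewrite /psi' (_ : i = i0) ?eqxx//; exact/val_inj.
  have [->|ii] := eqVneq i i0; first by exists A => //; rewrite /psi' eqxx.
  by exists B => //; rewrite /psi' (negPf ii).
Qed.
End HmmLaw.

(** * Change of measure to uniform independent labels *)

Section HmmChange.
Context {R : realType} {J : nat} {dY : measure_display} {TY : measurableType dY}.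
Context {L : {measure set TY -> \bar R}} (theta : hmm_param J L).
Context {d : measure_display} {Omega : measurableType d}.
Variables (P : probability Omega R) (X : nat -> Omega -> 'I_J) (Y : nat -> Omega -> TY).
Hypothesis XY : is_hmm P X Y theta.
Variable n : nat.
Hypothesis J_gt0 : (0 < J)%N.
Hypothesis p_gt0 : forall x : {ffun 'I_n -> 'I_J}, 0 < plawP P X x.
Local Notation path := {ffun 'I_n -> 'I_J}.
Local Notation f := (hmm_f theta).
Local Notation fi := (fint theta).
Local Notation E := (EE P).
Local Notation p := (plawP P X).
Implicit Types (x : path) (a b : 'I_J).

Let f_ge0 a y : 0 <= f a y. Proof. exact: hmm_f_ge0. Qed.
Let mf a : measurable_fun setT (f a). Proof. exact: hmm_f_measurable. Qed.
Let f_fin a : (\int[L]_t (f a t)%:E < +oo)%E.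
Proof. by rewrite hmm_f_int1 ltry. Qed.
Let mY i : measurable_fun [set: Omega] (Y i).
Proof. by have [_ [mY _]] := XY; exact: mY. Qed.
Let bmYi i (g : TY -> R) : bm g -> bm (fun w => g (Y i w)).
Proof. by move=> hg; exact: bm_comp. Qed.
Let bmc x : bm (\1_(cyl X x) : Omega -> R). Proof. exact (bm_cyl XY x). Qed.

Lemma fint_ge0 a g : (forall y, 0 <= g y) -> 0 <= fi a g.
Proof. by move=> g0; exact: wint_ge0. Qed.

Lemma fint_le a g h : bm g -> bm h -> (forall y, g y <= h y) -> fi a g <= fi a h.
Proof. by move=> bg bh gh; exact: wint_le. Qed.

Lemma fintD a g h : bm g -> bm h -> fi a (fun y => g y + h y) = fi a g + fi a h.
Proof. by move=> bg bh; exact: wintD. Qed.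

Lemma fintZ a k g : bm g -> fi a (fun y => k * g y) = k * fi a g.
Proof. by move=> bg; exact: wintZ. Qed.

Lemma fint_ext a g h : (forall y, g y = h y) -> fi a g = fi a h.
Proof. by move=> gh; exact: wint_ext. Qed.

Lemma fint_le_cst a g M : bm g -> (forall y, g y <= M) -> fi a g <= M.
Proof.
move=> bg gM; rewrite -[M]mulr1 -(fint1 theta a) -fintZ; last exact: bm_cst.
by apply: fint_le => // [|y]; [apply: bmZ; exact: bm_cst|rewrite mulr1].
Qed.

Lemma sum_fint (s : seq 'I_J) (g : 'I_J -> TY -> R) : (forall a, bm (g a)) ->
  L.-integrable setT (EFin \o (fun y => \sum_(a <- s) g a y * f a y)) /\
  \sum_(a <- s) fi a (g a) = \int[L]_y \sum_(a <- s) g a y * f a y.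
Proof.
move=> bg; elim: s => [|a s [IH1 IH2]].
  split; last first.
    rewrite big_nil /Rintegral (eq_integral (fun=> 0%E)) ?integral0//.
    by move=> y _; rewrite big_nil.
  rewrite (_ : EFin \o _ = (fun=> 0%E)); first exact: integrable0.
  by apply/funext => y; rewrite /= big_nil.
have ga := bm_integrable (f_ge0 a) (mf a) (f_fin a) (bg a).
have e : (fun y => \sum_(b <- a :: s) g b y * f b y) =
    (fun y => g a y * f a y + \sum_(b <- s) g b y * f b y).
  by apply/funext => y; rewrite big_cons.
rewrite e; split.
  exact: (integrableD measurableT ga IH1).
by rewrite RintegralD// big_cons IH2.
Qed.

Lemma sum_fint_eq (g h : 'I_J -> TY -> R) : (forall a, bm (g a)) -> (forall a, bm (h a)) ->
  (forall y, \sum_a g a y * f a y = \sum_a h a y * f a y) ->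
  \sum_a fi a (g a) = \sum_a fi a (h a).
Proof.
move=> bg bh gh; rewrite (sum_fint _ bg).2 (sum_fint _ bh).2.
by apply: eq_Rintegral => y _; exact: gh.
Qed.

(** Expectation after reweighting each label path from its probability to J^(-n). Under this law the
    observations are i.i.d. with the average of the emission densities, as [Eunif_prod]
    expresses. *)
Definition Eunif (g : Omega -> R) : R :=
  \sum_(x : path) (J%:R^-1 ^+ n / p x) * E (fun w => \1_(cyl X x) w * g w).

Let c x := J%:R^-1 ^+ n / p x.
Let c_ge0 x : 0 <= c x.
Proof. by rewrite divr_ge0 ?exprn_ge0 ?invr_ge0// ltW. Qed.

Lemma Eunif_ext g h : (forall w, g w = h w) -> Eunif g = Eunif h.
Proof. by move=> gh; rewrite (_ : g = h)//; exact/funext. Qed.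

Lemma EunifD g h : bm g -> bm h -> Eunif (fun w => g w + h w) = Eunif g + Eunif h.
Proof.
move=> bg bh; rewrite /Eunif -big_split; apply: eq_bigr => x _ /=.
rewrite -mulrDr -(EED P (bmM (bmc x) bg) (bmM (bmc x) bh)).
by congr (_ * _); apply: EE_ext => w; rewrite mulrDr.
Qed.

Lemma EunifZ k g : bm g -> Eunif (fun w => k * g w) = k * Eunif g.
Proof.
move=> bg; rewrite /Eunif mulr_sumr; apply: eq_bigr => x _ /=.
rewrite mulrCA -(EEZ P k (bmM (bmc x) bg)).
by congr (_ * _); apply: EE_ext => w; rewrite mulrCA.
Qed.

Lemma Eunif_le g h : bm g -> bm h -> (forall w, g w <= h w) -> Eunif g <= Eunif h.
Proof.
move=> bg bh gh; apply: ler_sum => x _; rewrite ler_wpM2l ?c_ge0//.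
apply: EE_le; [exact: (bmM (bmc x) bg)|exact: (bmM (bmc x) bh)|].
by move=> w; rewrite ler_wpM2l// indicE ler0n.
Qed.

Lemma Eunif_sum (I : finType) (q : pred I) (g : I -> Omega -> R) : (forall i, bm (g i)) ->
  Eunif (fun w => \sum_(i | q i) g i w) = \sum_(i | q i) Eunif (g i).
Proof.
move=> bg; rewrite /Eunif exchange_big; apply: eq_bigr => x _ /=.
rewrite -mulr_sumr -EE_sum; last by move=> i; exact: (bmM (bmc x) (bg i)).
by congr (_ * _); apply: EE_ext => w; rewrite mulr_sumr.
Qed.

Definition unif_mean (g : TY -> R) : R := J%:R^-1 * \sum_a fi a g.

Lemma Eunif_prod (psi : 'I_n -> TY -> R) : (forall i, bm (psi i)) ->
  Eunif (fun w => \prod_i psi i (Y i w)) = \prod_i unif_mean (psi i).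
Proof.
move=> bpsi; rewrite /unif_mean; under [RHS]eq_bigr => i _ do rewrite mulr_sumr.
rewrite bigA_distr_bigA; apply: eq_bigr => x _ /=.
rewrite (joint_prod XY)// mulrA divfK ?gt_eqF// big_split/=; congr (_ * _).
by rewrite prodr_const card_ord.
Qed.

(** Density of the emission law of [a] with respect to the average of all emission laws; it is
    bounded by J, unlike [f a]. Where all the densities vanish it is 0, and [dens_sum] still
    holds. *)
Definition dens a y : R := J%:R * f a y / \sum_b f b y.

Let S_ge0 y : 0 <= \sum_b f b y. Proof. exact: sumr_ge0. Qed.

Lemma dens_ge0 a y : 0 <= dens a y.
Proof. by rewrite divr_ge0// mulr_ge0. Qed.

Lemma dens_sum a y : dens a y * (\sum_b f b y) = J%:R * f a y.
Proof.
rewrite /dens; have [S0|S0] := eqVneq (\sum_b f b y) 0; last by rewrite divfK.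
rewrite S0 mulr0; move/eqP: S0; rewrite psumr_eq0// => /allP/(_ a (mem_index_enum _)).
by move=> /eqP ->; rewrite mulr0.
Qed.

Lemma bm_div (g h : TY -> R) : (forall y, 0 <= h y) -> measurable_fun setT g ->
  measurable_fun setT h -> (exists M, forall y, `|g y| <= M * h y) ->
  bm (fun y : TY => g y / h y : R).
Proof.
move=> h0 mg mh [M hM]; split.
  by apply: measurable_funM => //; exact: measurable_inv_ge0.
exists `|M| => y; have [hy|hy] := eqVneq (h y) 0.
  by rewrite hy invr0 mulr0 normr0.
have hp : 0 < h y by rewrite lt_neqAle eq_sym hy h0.
rewrite normrM (@gtr0_norm _ (h y)^-1) ?invr_gt0// ler_pdivrMr//.
by rewrite (le_trans (hM y))// ler_wpM2r// ler_norm.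
Qed.

Lemma bm_dens a : bm (dens a).
Proof.
apply: bm_div => //.
- by apply: measurable_funM => //; exact: measurable_cst.
- exact: measurable_sum.
- exists J%:R => y; rewrite ger0_norm ?mulr_ge0// ler_wpM2l//.
  by rewrite (bigD1 a)//= lerDl sumr_ge0.
Qed.

Lemma unif_mean_dens a psi : bm psi -> unif_mean (fun y => dens a y * psi y) = fi a psi.
Proof.
move=> bpsi; rewrite /unif_mean.
have J0 : J%:R != 0 :> R by rewrite pnatr_eq0 gt_eqF.
apply: (mulfI J0); rewrite mulrA divff// mul1r -fintZ//.
transitivity (\sum_b fi b (fun y => if b == a then J%:R * psi y else 0)); last first.
  rewrite (bigD1 a)//= eqxx big1 ?addr0// => b /negPf ba.
  rewrite (@fint_ext _ _ (fun y => 0 * (fun=> 1) y)) => [|y]; last by rewrite ba mul0r.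
  by rewrite fintZ ?mul0r//; exact: bm_cst.
apply: sum_fint_eq.
- by move=> b; apply: bmM => //; exact: bm_dens.
- by move=> b; case: (b == a); [exact: bmZ|exact: bm_cst].
move=> y; rewrite -mulr_sumr mulrAC dens_sum (bigD1 a)//= eqxx big1 ?addr0.
  by rewrite mulrAC.
by move=> b /negPf ->; rewrite mul0r.
Qed.

Lemma Eunif_dens x (psi : 'I_n -> TY -> R) : (forall i, bm (psi i)) ->
  Eunif (fun w => \prod_i (dens (x i) (Y i w) * psi i (Y i w))) =
  \prod_i fi (x i) (psi i).
Proof.
move=> bpsi; rewrite (Eunif_prod (psi := fun i y => dens (x i) y * psi i y)).
  by apply: eq_bigr => i _; exact: unif_mean_dens.
by move=> i; apply: bmM => //; exact: bm_dens.
Qed.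

Lemma measurable_obs : measurable_fun setT (obs Y n : Omega -> n.-tuple TY).
Proof.
apply/measurable_fun_tnthP => i.
rewrite (_ : _ \o _ = Y i); first exact: mY.
by apply/funext => w /=; rewrite tnth_mktuple.
Qed.

Let rect (B : 'I_n -> set TY) : set (n.-tuple TY) := [set t | forall i, B i (tnth t i)].
Let G : set (set (n.-tuple TY)) :=
  [set A | exists2 B : 'I_n -> set TY, (forall i, measurable (B i)) & A = rect B].

Let GE : @measurable _ (n.-tuple TY) = <<s G>>.
Proof.
apply/seteqP; split.
  apply: smallest_sub; first exact: smallest_sigma_algebra.
  move=> A /=; rewrite -bigcup_seq /= => -[i _ [B mB <-]].
  apply: sub_sigma_algebra.
  exists (fun j => if j == i then B else setT); first by move=> j; case: ifP.
  rewrite setTI; apply/seteqP; split => t /=; first by move=> h j; case: eqP => // ->.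
  by move=> /(_ i); rewrite eqxx.
apply: smallest_sub; first exact: sigma_algebra_measurable.
move=> _ [B mB ->].
rewrite (_ : rect B = \bigcap_k (if (insub k : option 'I_n) is Some i
   then (fun t => tnth t i) @^-1` (B i) else setT)).
  apply: bigcapT_measurable => k; case: insub => // i.
  by rewrite -[_ @^-1` _]setTI; apply: measurable_tnth.
apply/seteqP; split => t /= h.
  by move=> k _; case: insub => [i|//] /=.
by move=> i; have := h (i : nat) I; rewrite valK.
Qed.

Section SetFunction.
Variable V : Omega -> R.
Hypotheses (V_ge0 : forall w, 0 <= V w) (bV : bm V).
Let mV : measurable_fun setT V := bV.1.
Lemma density_fin : (\int[P]_w (V w)%:E < +oo)%E.
Proof.
have [_ [M hM]] := bV.
apply: (@le_lt_trans _ _ (\int[P]_w (`|M|%:E))%E).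
  apply: ge0_le_integral => //; try exact/measurable_EFinP.
  - by move=> w _; rewrite lee_fin; exact: V_ge0.
  - move=> w _; rewrite lee_fin.
    exact: le_trans (ler_norm _) (le_trans (hM w) (ler_norm _)).
rewrite integral_cst//; apply: (@le_lt_trans _ _ (`|M|%:E * 1)%E).
  by apply: lee_wpmul2l; [rewrite lee_fin|exact: probability_le1].
by rewrite mule1 ltry.
Qed.

Lemma set_fun_bigcup (A : (set (n.-tuple TY))^nat) :
  (forall k, measurable (A k)) -> trivIset setT A ->
  (wint P V (\1_(obs Y n @^-1` \bigcup_k A k)))%:E =
  (\sum_(0 <= k <oo) (wint P V (\1_(obs Y n @^-1` A k)))%:E)%E.
Proof.
move=> mA tA.
have mo B : measurable B -> measurable (obs Y n @^-1` B : set Omega).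
  by move=> mB; rewrite -[_ @^-1` _]setTI; exact: measurable_obs.
rewrite (wint_indicE V_ge0 mV density_fin)//; last exact/mo/bigcup_measurable.
rewrite preimage_bigcup ge0_integral_bigcup//.
- by apply: eq_eseriesr => k _; rewrite (wint_indicE V_ge0 mV density_fin)//; exact: mo.
- by move=> k; exact: mo.
- by apply/measurable_EFinP; exact: measurable_funS mV.
- by move=> w _; rewrite lee_fin.
- apply/classical_sets.trivIsetP => i j _ _ ij.
  move/classical_sets.trivIsetP: tA => /(_ i j I I ij) ijE.
  by rewrite -preimage_setI ijE preimage_set0.
Qed.
End SetFunction.

(** Two finite measures on tuples that agree on rectangles are equal, rectangles being stable under
    intersection and generating the product sigma-algebra ([GE]). *)
Lemma set_fun_eq V1 V2 : (forall w, 0 <= V1 w) -> (forall w, 0 <= V2 w) ->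
  bm V1 -> bm V2 ->
  (forall B, (forall i, measurable (B i)) ->
     wint P V1 (\1_(obs Y n @^-1` rect B)) = wint P V2 (\1_(obs Y n @^-1` rect B))) ->
  forall A : set (n.-tuple TY), measurable A ->
    wint P V1 (\1_(obs Y n @^-1` A)) = wint P V2 (\1_(obs Y n @^-1` A)).
Proof.
move=> V10 V20 b1 b2 hr A mA.
have mo B : measurable B -> measurable (obs Y n @^-1` B : set Omega).
  by move=> mB; rewrite -[_ @^-1` _]setTI; exact: measurable_obs.
have hT : wint P V1 (\1_(obs Y n @^-1` setT)) = wint P V2 (\1_(obs Y n @^-1` setT)).
  have := hr (fun=> setT) (fun=> measurableT).
  by rewrite (_ : rect _ = setT)//; apply/seteqP; split.
apply: (@dynkin_induction _ _ G (fun A => wint P V1 (\1_(obs Y n @^-1` A)) =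
   wint P V2 (\1_(obs Y n @^-1` A))) GE) => //.
- move=> _ _ [B mB ->] [C mC ->]; exists (fun i => B i `&` C i).
    by move=> i; exact: measurableI.
  by apply/seteqP; split => t /= => [[h1 h2] i|h]; [split|split=> i; case: (h i)].
- by move=> _ [B mB ->]; exact: hr.
- move=> S mS hS.
  have cE w : \1_(obs Y n @^-1` ~` S) w =
      \1_(obs Y n @^-1` setT) w + (-1) * \1_(obs Y n @^-1` S) w :> R.
    rewrite preimage_setC preimage_setT indicT !indicE mulN1r.
    case: (boolP (w \in obs Y n @^-1` S)) => [/set_mem h|/negP h].
      by rewrite memNset ?subrr//; apply.
    by rewrite mem_set ?subr0// => h'; apply: h; exact/mem_set.
  have bS := @bm_indic R _ _ _ (mo _ mS).
  have bT : bm (\1_(obs Y n @^-1` setT) : Omega -> R) by apply/bm_indic/mo.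
  have fin V (V0 : forall w, 0 <= V w) (bV : bm V) := density_fin V0 bV.
  rewrite !(wint_ext _ _ cE).
  rewrite (wintD V10 b1.1 (fin _ V10 b1) bT (bmZ _ bS)) (wintZ V10 b1.1 (fin _ V10 b1) _ bS).
  rewrite (wintD V20 b2.1 (fin _ V20 b2) bT (bmZ _ bS)) (wintZ V20 b2.1 (fin _ V20 b2) _ bS).
  by rewrite hS hT.
- move=> F mF tF hF; apply: EFin_inj; rewrite !set_fun_bigcup//.
  by apply: eq_eseriesr => k _; rewrite hF.
- by rewrite -GE.
Qed.

Let wintE (V g : Omega -> R) : wint P V g = E (fun w => g w * V w).
Proof. by rewrite /EE /wint; apply: eq_Rintegral => w _; rewrite mulr1. Qed.

(** Both sides are finite measures in [A]. On rectangles, [joint_indic] computes the left one and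
    [Eunif_dens] the right one, with the same result. *)
Lemma change_cyl x A : measurable A ->
  E (fun w => \1_(obs Y n @^-1` A) w * \1_(cyl X x) w) =
  p x * Eunif (fun w => \1_(obs Y n @^-1` A) w * \prod_i dens (x i) (Y i w)).
Proof.
move=> mA.
have mo B : measurable B -> measurable (obs Y n @^-1` B : set Omega).
  by move=> mB; rewrite -[_ @^-1` _]setTI; exact: measurable_obs.
pose D w := \prod_i dens (x i) (Y i w).
have bD : bm D by apply: bm_prod => i; apply: bmYi; exact: bm_dens.
have D0 w : 0 <= D w by apply: prodr_ge0 => i _; exact: dens_ge0.
(* This density with respect to [P] represents the right-hand measure, so that both sides have the
   form required by [set_fun_eq]. *)
pose V w := \sum_(x' : path) (p x * c x') * (\1_(cyl X x') w * D w).
have V0 w : 0 <= V w.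
  apply: sumr_ge0 => x' _; apply: mulr_ge0.
    by apply: mulr_ge0; [exact: ltW|exact: c_ge0].
  by apply: mulr_ge0 => //; rewrite indicE ler0n.
have bV : bm V by apply: bm_sum => x'; apply/bmZ/bmM.
have EV g : bm g -> wint P V g = p x * Eunif (fun w => g w * D w).
  move=> bg; rewrite wintE.
  rewrite (@EE_ext _ _ _ P _ (fun w => \sum_(x' : path) (p x * c x') *
    (\1_(cyl X x') w * (g w * D w)))); last first.
    by move=> w; rewrite /V mulr_sumr; apply: eq_bigr => x' _; ring.
  rewrite EE_sum; last by move=> x'; apply/bmZ/bmM => //; exact: bmM.
  rewrite /Eunif mulr_sumr; apply: eq_bigr => x' _; rewrite EEZ ?mulrA//.
  by apply: bmM => //; exact: bmM.
rewrite -wintE -EV; last exact/bm_indic/mo.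
apply: set_fun_eq => //.
move=> B mB; rewrite EV; last first.
  apply/bm_indic/mo; rewrite GE; apply: sub_sigma_algebra; by exists B.
have rE w : \1_(obs Y n @^-1` rect B) w = \prod_i \1_(B i) (Y i w) :> R.
  rewrite indicE; case: (boolP (w \in _)) => [/set_mem/= h|/negP h].
    apply/esym/big1 => i _; rewrite indicE mem_set//.
    by have := h i; rewrite tnth_mktuple.
  apply/esym/eqP/prodf_eq0; have : exists i : 'I_n, ~ B i (Y i w).
    apply: contrapT => ne; apply: h; apply/mem_set => i /=.
    by rewrite tnth_mktuple; apply: contrapT => nA; apply: ne; exists i.
  by move=> [i nA]; exists i => //; rewrite indicE memNset.
rewrite wintE (@EE_ext _ _ _ P _ (fun w => \1_(cyl X x) w * \prod_i \1_(B i) (Y i w))).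
  rewrite (joint_indic XY)//; congr (_ * _).
  rewrite -Eunif_dens; last by move=> i; exact: bm_indic.
  by apply: Eunif_ext => w; rewrite rE big_split/= mulrC.
by move=> w; rewrite rE mulrC.
Qed.

(** The true label path is replaced by a sum over all paths weighted by an unnormalised posterior
    that depends on the observations only. The decision takes finitely many values, so [change_cyl]
    is applied to each of its level sets. *)
Lemma expectation_change (C : finType) (g : n.-tuple TY -> C) (l : C -> path -> R) :
  (forall k, measurable (g @^-1` [set k])) ->
  E (fun w => l (g (obs Y n w)) (path_of X n w)) =
  Eunif (fun w => \sum_x p x * (\prod_i dens (x i) (Y i w)) * l (g (obs Y n w)) x).
Proof.
move=> mg.
pose A k := g @^-1` [set k].
have mo B : measurable B -> measurable (obs Y n @^-1` B : set Omega).
  by move=> mB; rewrite -[_ @^-1` _]setTI; exact: measurable_obs.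
have bA k : bm (\1_(obs Y n @^-1` A k) : Omega -> R) := bm_indic (mo _ (mg k)).
have iA w k : \1_(obs Y n @^-1` A k) w = (k == g (obs Y n w))%:R :> R.
  rewrite indicE; congr (nat_of_bool _)%:R; apply/idP/eqP => [/set_mem/= ->//|->].
  exact/mem_set.
have bD x : bm (fun w => \prod_i dens (x i) (Y i w)).
  by apply: bm_prod => i; apply: bmYi; exact: bm_dens.
rewrite (@EE_ext _ _ _ P _ (fun w => \sum_x \sum_k l k x *
   (\1_(obs Y n @^-1` A k) w * \1_(cyl X x) w))); last first.
  move=> w; rewrite (bigD1 (path_of X n w))//= [X in _ + X]big1 ?addr0.
    rewrite (bigD1 (g (obs Y n w)))//= [X in _ + X]big1 ?addr0.
      by rewrite iA in_cyl !eqxx !mulr1.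
    by move=> k /negPf kg; rewrite iA kg mul0r mulr0.
  by move=> x /negPf xw; apply: big1 => k _; rewrite in_cyl xw !mulr0.
have bt x k : bm (fun w => l k x * (\1_(obs Y n @^-1` A k) w * \1_(cyl X x) w)).
  by apply/bmZ/bmM.
have bt' x k : bm (fun w => l k x * p x * (\1_(obs Y n @^-1` A k) w * \prod_i dens (x i) (Y i w))).
  by apply/bmZ/bmM.
rewrite EE_sum; last by move=> x; exact: bm_sum.
rewrite (@Eunif_ext _ (fun w => \sum_x \sum_k l k x * p x *
   (\1_(obs Y n @^-1` A k) w * \prod_i dens (x i) (Y i w)))); last first.
  move=> w; apply: eq_bigr => x _; rewrite (bigD1 (g (obs Y n w)))//= [X in _ + X]big1 ?addr0.
    by rewrite iA eqxx /=; ring.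
  by move=> k /negPf kg; rewrite iA kg mul0r mulr0.
rewrite Eunif_sum; last by move=> x; exact: bm_sum.
apply: eq_bigr => x _; rewrite EE_sum// Eunif_sum//; apply: eq_bigr => k _.
rewrite EEZ; last exact: (bmM (bA k) (bmc x)).
rewrite EunifZ; last exact: (bmM (bA k) (bD x)).
by rewrite change_cyl; [rewrite mulrA|exact: mg].
Qed.
End HmmChange.

(** * From posterior bounds to risk bounds *)

Section RiskBounds.
Context {R : realType} {J : nat} {dY : measure_display} {TY : measurableType dY}.
Context {L : {measure set TY -> \bar R}} (theta : hmm_param J L).
Context {d : measure_display} {Omega : measurableType d}.
Variables (P : probability Omega R) (X : nat -> Omega -> 'I_J) (Y : nat -> Omega -> TY).
Hypothesis XY : is_hmm P X Y theta.
Variable n : nat.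
Hypothesis J_gt0 : (0 < J)%N.
Hypothesis n_gt0 : (0 < n)%N.
Hypothesis p_gt0 : forall x : {ffun 'I_n -> 'I_J}, 0 < plawP P X x.
Local Notation path := {ffun 'I_n -> 'I_J}.
Local Notation f := (hmm_f theta).
Local Notation fi := (fint theta).
Local Notation p := (plawP P X (n := n)).
Local Notation Eunif := (Eunif P X n).
Local Notation dens := (dens theta).
Implicit Types (x : path) (a b : 'I_J) (i j : 'I_n) (w : Omega).

Let f_ge0 a y : 0 <= f a y. Proof. exact: hmm_f_ge0. Qed.
Let mf a : measurable_fun setT (f a). Proof. exact: hmm_f_measurable. Qed.
Let mY i : measurable_fun [set: Omega] (Y i).
Proof. by have [_ [mY _]] := XY; exact: mY. Qed.
Let bmYi i (g : TY -> R) : bm g -> bm (fun w => g (Y i w)).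
Proof. by move=> hg; exact: bm_comp. Qed.
Let p_ge0 x : 0 <= p x. Proof. exact: ltW. Qed.

Lemma path_law (g : path -> R) : EE P (fun w => g (path_of X n w)) = \sum_x p x * g x.
Proof.
rewrite (@EE_ext _ _ _ P _ (fun w => \sum_(x : path) g x * \1_(cyl X x) w)); last first.
  move=> w; rewrite (bigD1 (path_of X n w))//= in_cyl eqxx mulr1 big1 ?addr0// => x /negPf xw.
  by rewrite in_cyl xw mulr0.
have bc x : bm (\1_(cyl X x) : Omega -> R) := bm_cyl XY x.
rewrite EE_sum; last by move=> x; exact: bmZ.
apply: eq_bigr => x _; rewrite EEZ// EE_indic; last exact (measurable_cyl XY x).
by rewrite mulrC.
Qed.

Lemma plawP_sum1 : \sum_(x : path) p x = 1.
Proof.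
have := path_law (fun=> 1); rewrite EE1 => ->.
by apply: eq_bigr => x _; rewrite mulr1.
Qed.

Definition post w x : R := p x * \prod_i dens (x i) (Y i w).

Lemma post_ge0 w x : 0 <= post w x.
Proof. by rewrite mulr_ge0//; apply: prodr_ge0 => i _; exact: dens_ge0. Qed.

Lemma post_cross w i j : i != j -> cross p i j -> cross (post w) i j.
Proof.
move=> ij cr x a a' b b'; rewrite /post.
have e (u v z t : R) : u * v * (z * t) = (u * z) * (v * t) by ring.
rewrite [LHS]e [RHS]e cr; congr (_ * _); rewrite -!big_split/=; apply: eq_bigr => k _.
rewrite !updE; have [kj|kj] := eqVneq k j; last by rewrite mulrC.
by have [ki|_] := eqVneq k i; [rewrite -ki -kj eqxx in ij|rewrite mulrC].
Qed.

Lemma post_upd w x i a : post w (upd x i a) =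
  p (upd x i a) * (dens a (Y i w) * \prod_(j | j != i) dens (x j) (Y j w)).
Proof.
rewrite /post (bigD1 i)//= upd_same; congr (_ * (_ * _)).
by apply: eq_bigr => j ji; rewrite updE (negPf ji).
Qed.

Lemma Eunif_post (h : path -> R) (psi : path -> 'I_n -> TY -> R) :
  (forall x i, bm (psi x i)) ->
  Eunif (fun w => \sum_x post w x * (h x * \prod_i psi x i (Y i w))) =
  \sum_x p x * (h x * \prod_i fi (x i) (psi x i)).
Proof.
move=> bpsi.
have bt x : bm (fun w => \prod_i (dens (x i) (Y i w) * psi x i (Y i w))).
  by apply: bm_prod => i; apply: bmM; apply: bmYi => //; exact: bm_dens.
rewrite (@Eunif_ext _ _ _ _ P X n _ (fun w => \sum_x (p x * h x) *
  \prod_i (dens (x i) (Y i w) * psi x i (Y i w)))); last first.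
  by move=> w; apply: eq_bigr => x _; rewrite /post mulrACA -big_split.
rewrite (Eunif_sum XY)//; last by move=> x; exact: bmZ.
apply: eq_bigr => x _; rewrite (EunifZ XY)// (Eunif_dens XY)//.
by rewrite mulrA.
Qed.

Lemma bm_post (h : path -> Omega -> R) : (forall x, bm (h x)) ->
  bm (fun w => \sum_x post w x * h x w).
Proof.
move=> bh; apply: bm_sum => x; apply: bmM => //; apply: bmZ.
by apply: bm_prod => i; apply: bmYi; exact: bm_dens.
Qed.

Lemma clusterers_nonempty : (@clusterers n _ TY) !=set0.
Proof.
exists (fun=> finset.preim_partition (fun=> tt) [set: 'I_n]%SET); split=> [y|q].
  exact: finset.preim_partitionP.
rewrite preimage_cst; case: ifP => _; [exact: measurableT|exact: measurable0].
Qed.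

(** For a given observation a clusterer proposes one partition, so a posterior bound valid for all
    partitions holds for its output and integrates to a bound on every risk. *)
Lemma risk_ge (LB : Omega -> R) : bm LB ->
  (forall w A, finset.partition A [set: 'I_n]%SET ->
     LB w <= \sum_x post w x * (n%:R - (gain A x)%:R)) ->
  Eunif LB / n%:R <= inf_clust_risk P X Y n.
Proof.
move=> bLB hLB; apply: lb_le_inf.
  by have [g Gg] := clusterers_nonempty; exists (clust_risk P X Y g), g.
move=> _ [g [gp mg] <-]; rewrite /clust_risk EE_expectation.
rewrite ler_pdivrMr ?ltr0n// mulrC.
pose l A x := clust_loss R A (finset.preim_partition x [set: 'I_n]%SET).
rewrite (@EE_ext _ _ _ P _ (fun w => l (g (obs Y n w)) (path_of X n w))); last first.
  move=> w; rewrite /l /label_partition; congr clust_loss; congr finset.preim_partition.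
  by apply/funext => i; rewrite ffunE.
have bl : bm (fun w => \sum_x p x * (\prod_i dens (x i) (Y i w)) * l (g (obs Y n w)) x).
  have mo B : measurable B -> measurable (obs Y n @^-1` B : set Omega).
    by move=> mB; rewrite -[_ @^-1` _]setTI; apply: (measurable_obs XY).
  apply: bm_post => x.
  rewrite (_ : (fun w => _) = (fun w => \sum_A l A x * \1_(obs Y n @^-1` (g @^-1` [set A])) w)).
    by apply: bm_sum => A; apply: bmZ; exact: bm_indic (mo _ (mg A)).
  apply/funext => w; rewrite (bigD1 (g (obs Y n w)))//= big1 ?addr0.
    by rewrite indicE mem_set ?mulr1.
  by move=> A /eqP Ag; rewrite indicE memNset ?mulr0// => /= /esym.
rewrite (expectation_change XY J_gt0 p_gt0 l mg) -(EunifZ XY)//.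
apply: (Eunif_le XY) => //; first exact: bmZ.
move=> w; apply: le_trans (hLB w _ (gp _)) _; rewrite mulr_sumr; apply: ler_sum => x _.
rewrite mulrCA ler_wpM2l ?post_ge0//; apply: clust_loss_ge => //; exact: gp.
Qed.

Section LocalError.
(* [mm] is a lower bound, integrating to [local_mass], of the joint density of the
   observation and of an error on its label, given all the other variables. *)
Variables (mm : TY -> R) (B : R).
Hypothesis mm_ge0 : forall y, 0 <= mm y.
Hypothesis mmm : measurable_fun setT mm.
Hypothesis J_gt1 : (1 < J)%N.
Hypothesis mm_le : forall i x b y, mm y <= \sum_(a | a != b) cp p i a x * f a y.
Hypothesis mm_leB : forall i x y, mm y <= B * \sum_a cp p i a x * f a y.
Hypothesis p_cross : forall i j, i != j -> odd i = odd j -> cross p i j.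

Let Sw i x y := \sum_a cp p i a x * f a y.
(** Lower bound for the conditional error of any guess of label [i], given the other labels and all
    the observations; [Sw] is the conditional density of the observation [y] given the other
    labels. *)
Definition mt i x y := mm y / Sw i x y.
Definition local_mass := \int[L]_y mm y.

Let cp0 i a x : 0 <= cp p i a x. Proof. exact: cp_ge0. Qed.

Let Sw_ge0 i x y : 0 <= Sw i x y.
Proof. by apply: sumr_ge0 => a _; exact: mulr_ge0. Qed.

Let fib_gt0 i x : 0 < fib p i x.
Proof. by apply: lt_le_trans (pi_le_fib p_ge0 i x (x i)); exact: p_gt0. Qed.

Let sum_cp i x : \sum_a cp p i a x = 1.
Proof. by rewrite -mulr_suml divff// gt_eqF// fib_gt0. Qed.

Let mm_leS i x y : mm y <= Sw i x y.
Proof.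
apply: le_trans (mm_le i x (x i) y) _; rewrite /Sw [leRHS](bigD1 (x i))//= lerDr.
exact: mulr_ge0.
Qed.

Let mt_Sw i x y : mt i x y * Sw i x y = mm y.
Proof.
rewrite /mt; have [S0|S0] := eqVneq (Sw i x y) 0; last by rewrite divfK.
by rewrite S0 mulr0; apply/le_anti; rewrite mm_ge0/= -S0 mm_leS.
Qed.

Lemma mt_ge0 i x y : 0 <= mt i x y.
Proof. by rewrite divr_ge0. Qed.

Lemma mt_leB i x y : 0 <= B -> mt i x y <= B.
Proof.
move=> B0; rewrite /mt; have [S0|S0] := eqVneq (Sw i x y) 0.
  by rewrite S0 invr0 mulr0.
have Sp : 0 < Sw i x y by rewrite lt_neqAle eq_sym S0 Sw_ge0.
by rewrite ler_pdivrMr// mm_leB.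
Qed.

Lemma mt_upd i x a y : mt i (upd x i a) y = mt i x y.
Proof. by rewrite /mt /Sw; congr (_ / _); apply: eq_bigr => b _; rewrite cp_upd. Qed.

Lemma bm_mt i x : bm (mt i x).
Proof.
apply: bm_div.
- by move=> y; exact: Sw_ge0.
- exact: mmm.
- by apply: measurable_sum => a; apply: measurable_funM => //; exact: measurable_cst.
- by exists 1 => y; rewrite mul1r ger0_norm//; exact: mm_leS.
Qed.

Lemma mt_post w i x b :
  mt i x (Y i w) * fib (post w) i x <= \sum_(a | a != b) post w (upd x i a).
Proof.
set y := Y i w; set S := \sum_a f a y.
have S0 : 0 <= S by apply: sumr_ge0 => a _.
pose rest := \prod_(j | j != i) dens (x j) (Y j w).
have r0 : 0 <= rest by apply: prodr_ge0 => j _; exact: dens_ge0.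
pose k := fib p i x * (J%:R / S) * rest.
have k0 : 0 <= k by apply: mulr_ge0 => //; apply: mulr_ge0; [exact: ltW|exact: divr_ge0].
have E a : post w (upd x i a) = k * (cp p i a x * f a y).
  by rewrite post_upd -(cp_fib p_ge0) /k /dens -/y -/S -/rest; ring.
rewrite /fib; under eq_bigr => a _ do rewrite E.
under [leRHS]eq_bigr => a _ do rewrite E.
rewrite -!mulr_sumr mulrCA ler_wpM2l// mt_Sw; exact: mm_le.
Qed.

Definition mloc i x := fi (x i) (mt i x).

(** Averaging over label [i] with its conditional probabilities produces [Sw], which cancels the
    denominator of [mt] and leaves the integral of [mm]. *)
Lemma sum_mloc i x : \sum_a p (upd x i a) * mloc i (upd x i a) =
  \sum_a p (upd x i a) * local_mass.
Proof.
have -> : \sum_a p (upd x i a) * mloc i (upd x i a) =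
    \sum_a fi a (fun y => p (upd x i a) * mt i x y).
  apply: eq_bigr => a _; rewrite /mloc upd_same fintZ; last exact: bm_mt.
  by congr (_ * _); apply: fint_ext => y; rewrite mt_upd.
have bg a : bm (fun y => p (upd x i a) * mt i x y) by apply: bmZ; exact: bm_mt.
rewrite (sum_fint theta _ bg).2 -mulr_suml -/(fib p i x).
have -> : fib p i x * local_mass = \int[L]_y (fib p i x * mm y).
  have bh a : bm (fun y => mt i x y * cp p i a x).
    by apply: bmM; [exact: bm_mt|exact: bm_cst].
  have [ih _] := sum_fint theta (index_enum 'I_J) bh.
  rewrite /local_mass RintegralZl//.
  rewrite (_ : EFin \o mm = EFin \o (fun y => \sum_a mt i x y * cp p i a x * f a y))//.
  apply/funext => y /=; congr EFin; rewrite -[LHS](mt_Sw i x) mulr_sumr.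
  by apply: eq_bigr => a _; rewrite mulrA.
apply: eq_Rintegral => y _; rewrite -(mt_Sw i x y) /Sw !mulr_sumr.
by apply: eq_bigr => a _; rewrite -(cp_fib p_ge0); ring.
Qed.

Lemma mean_mloc i (G : path -> R) : (forall x a, G (upd x i a) = G x) ->
  \sum_x p x * (mloc i x * G x) = local_mass * \sum_x p x * G x.
Proof.
move=> hG; rewrite mulr_sumr; apply: (fiber_eq (i := i)) => x.
have -> : \sum_a p (upd x i a) * (mloc i (upd x i a) * G (upd x i a)) =
    (\sum_a p (upd x i a) * mloc i (upd x i a)) * G x.
  by rewrite mulr_suml; apply: eq_bigr => a _; rewrite hG mulrA.
rewrite sum_mloc mulr_suml; apply: eq_bigr => a _; rewrite hG; ring.
Qed.

(** The conditional law of label [j] does not depend on a conditionally independent label [i];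
    positivity of [p] lets the weights in [cross_cp] be cancelled. *)
Lemma mloc_upd i j x a : i != j -> odd i = odd j -> mloc j (upd x i a) = mloc j x.
Proof.
move=> ij oij; have cr := p_cross ij oij.
rewrite /mloc updE eq_sym (negPf ij); apply: fint_ext => y.
rewrite /mt; congr (_ / _); apply: eq_bigr => b _; congr (_ * _).
have [k hk] := cross_cp p_ge0 x b cr.
have pn c : p (upd x i c) != 0 by rewrite gt_eqF.
by rewrite (mulfI (pn a) (hk a)) -(mulfI (pn (x i)) (hk (x i))) upd_id.
Qed.

Let one_psi (i : 'I_n) (g : TY -> R) (k : 'I_n) : TY -> R :=
  if k == i then g else fun=> 1.

Let bm_one_psi i g k : bm g -> bm (one_psi i g k).
Proof. by move=> bg; rewrite /one_psi; case: ifP => // _; exact: bm_cst. Qed.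

Let prod_one_psi (F : 'I_n -> (TY -> R) -> R) i g :
  (forall k, F k (fun=> 1) = 1) -> \prod_k F k (one_psi i g k) = F i g.
Proof.
move=> F1; rewrite (bigD1 i)//= /one_psi eqxx big1 ?mulr1// => k /negPf->.
exact: F1.
Qed.

Lemma Eunif_one i (h : path -> R) (g : path -> TY -> R) : (forall x, bm (g x)) ->
  Eunif (fun w => \sum_x post w x * (h x * g x (Y i w))) =
  \sum_x p x * (h x * fi (x i) (g x)).
Proof.
move=> bg; rewrite (@Eunif_ext _ _ _ _ P X n _ (fun w => \sum_x post w x *
    (h x * \prod_k one_psi i (g x) k (Y k w)))); last first.
  move=> w; apply: eq_bigr => x _; congr (_ * (_ * _)).
  by rewrite (prod_one_psi (F := fun k g => g (Y k w))).
rewrite (Eunif_post h (psi := fun x => one_psi i (g x))); last by move=> x k; exact: bm_one_psi.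
apply: eq_bigr => x _; rewrite (prod_one_psi (F := fun k => fi (x k)))// => k.
exact: fint1.
Qed.

Lemma Eunif_two i j (g1 g2 : path -> TY -> R) : i != j ->
  (forall x, bm (g1 x)) -> (forall x, bm (g2 x)) ->
  Eunif (fun w => \sum_x post w x * (g1 x (Y i w) * g2 x (Y j w))) =
  \sum_x p x * (fi (x i) (g1 x) * fi (x j) (g2 x)).
Proof.
move=> ij b1 b2.
pose psi x k : TY -> R := if k == i then g1 x else one_psi j (g2 x) k.
have hp (F : 'I_n -> (TY -> R) -> R) x : (forall k, F k (fun=> 1) = 1) ->
    \prod_k F k (psi x k) = F i (g1 x) * F j (g2 x).
  move=> F1; rewrite (bigD1 i)//= /psi eqxx (bigD1 j)/=; last by rewrite eq_sym.
  rewrite [j == i]eq_sym (negPf ij).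
  rewrite {1}/one_psi eqxx big1 ?mulr1// => k /andP[/negPf-> /negPf kj].
  by rewrite /one_psi kj.
rewrite (@Eunif_ext _ _ _ _ P X n _ (fun w => \sum_x post w x *
    (1 * \prod_k psi x k (Y k w)))); last first.
  move=> w; apply: eq_bigr => x _; rewrite mul1r.
  by rewrite (hp (fun k g => g (Y k w))).
rewrite (Eunif_post (fun=> 1) (psi := psi)); last by move=> x k; rewrite /psi; case: ifP => // _; exact: bm_one_psi.
apply: eq_bigr => x _; rewrite (hp (fun k => fi (x k))) ?mul1r// => k.
exact: fint1.
Qed.

Lemma Eunif_cst (h : path -> R) :
  Eunif (fun w => \sum_x post w x * h x) = \sum_x p x * h x.
Proof.
pose i0 := Ordinal n_gt0.
have := @Eunif_one i0 h (fun _ _ => 1) (fun=> bm_cst 1).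
rewrite (@Eunif_ext _ _ _ _ P X n _ (fun w => \sum_x post w x * h x)) => [->|w].
  by apply: eq_bigr => x _; rewrite fint1 mulr1.
by apply: eq_bigr => x _; rewrite mulr1.
Qed.

Let Mt w i x := mt i x (Y i w).

Let bMt i x : bm (fun w => Mt w i x). Proof. by apply: bmYi; exact: bm_mt. Qed.

Lemma Eunif_mt i (G : path -> R) : (forall x a, G (upd x i a) = G x) ->
  Eunif (fun w => \sum_x post w x * (Mt w i x * G x)) = local_mass * \sum_x p x * G x.
Proof.
move=> hG; rewrite -(mean_mloc hG).
under [RHS]eq_bigr => x _ do rewrite [mloc i x * _]mulrC.
rewrite -(Eunif_one i G (g := mt i) (bm_mt i)).
apply: Eunif_ext => w; apply: eq_bigr => x _; congr (_ * _); exact: mulrC.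
Qed.
Definition Epost (F : Omega -> path -> R) := Eunif (fun w => \sum_x post w x * F w x).

Lemma Epost_ext F G : (forall w x, F w x = G w x) -> Epost F = Epost G.
Proof. by move=> FG; apply: Eunif_ext => w; apply: eq_bigr => x _; rewrite FG. Qed.

Lemma EpostD F G : (forall x, bm (F ^~ x)) -> (forall x, bm (G ^~ x)) ->
  Epost (fun w x => F w x + G w x) = Epost F + Epost G.
Proof.
move=> bF bG; rewrite /Epost -(EunifD XY _ (bm_post bF) (bm_post bG)).
apply: Eunif_ext => w; rewrite -big_split/=; apply: eq_bigr => x _; exact: mulrDr.
Qed.

Lemma EpostZ k F : (forall x, bm (F ^~ x)) ->
  Epost (fun w x => k * F w x) = k * Epost F.
Proof.
move=> bF; rewrite /Epost -(EunifZ XY)//; last exact: (bm_post bF).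
by apply: Eunif_ext => w; rewrite mulr_sumr; apply: eq_bigr => x _; exact: mulrCA.
Qed.

Lemma Epost_le F G : (forall x, bm (F ^~ x)) -> (forall x, bm (G ^~ x)) ->
  (forall w x, F w x <= G w x) -> Epost F <= Epost G.
Proof.
move=> bF bG FG; apply: (Eunif_le XY) => //; [exact: (bm_post bF)|exact: (bm_post bG)|].
by move=> w; apply: ler_sum => x _; rewrite ler_wpM2l ?post_ge0.
Qed.

Lemma Epost_sum (I : finType) (q : pred I) (F : I -> Omega -> path -> R) :
  (forall k x, bm (F k ^~ x)) ->
  Epost (fun w x => \sum_(k | q k) F k w x) = \sum_(k | q k) Epost (F k).
Proof.
move=> bF; rewrite /Epost -(Eunif_sum XY)//; last by move=> k; exact: (bm_post (bF k)).
apply: Eunif_ext => w; rewrite exchange_big/=; apply: eq_bigr => x _.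
by rewrite mulr_sumr.
Qed.

Lemma Epost_cst k : Epost (fun _ _ => k) = k.
Proof. by rewrite /Epost Eunif_cst -mulr_suml plawP_sum1 mul1r. Qed.

Lemma Epost_mt i (G : path -> R) : (forall x a, G (upd x i a) = G x) ->
  Epost (fun w x => Mt w i x * G x) = local_mass * \sum_x p x * G x.
Proof. exact: Eunif_mt. Qed.

Lemma Epost_mt1 i : Epost (Mt ^~ i) = local_mass.
Proof.
transitivity (local_mass * \sum_x p x * 1).
  rewrite -(@Epost_mt i (fun=> 1))//; apply: Epost_ext => w x; by rewrite mulr1.
by under eq_bigr => x _ do rewrite mulr1; rewrite plawP_sum1 mulr1.
Qed.

(** Given the labels, the two observations are independent, which leaves the product of the two
    [mloc]. The one at [j] does not depend on label [i], so [mean_mloc] integrates them out one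
    after the other. *)
Lemma Epost_mt_mt i j : i != j -> odd i = odd j ->
  Epost (fun w x => Mt w i x * Mt w j x) = local_mass ^+ 2.
Proof.
move=> ij oij; rewrite /Epost /Mt Eunif_two//; try exact: bm_mt.
rewrite (mean_mloc (i := i) (G := mloc j)); last by move=> x a; exact: mloc_upd.
have := mean_mloc (i := j) (G := fun=> 1) (fun _ _ => erefl).
under eq_bigr => x _ do rewrite mulr1; move=> ->.
by under eq_bigr => x _ do rewrite mulr1; rewrite plawP_sum1 mulr1 expr2.
Qed.

Lemma Epost_mt_sq i : 0 <= B -> Epost (fun w x => Mt w i x * Mt w i x) <= B * local_mass.
Proof.
move=> B0; rewrite -(Epost_mt1 i) -EpostZ; last exact: bMt.
apply: Epost_le => [x|x|w x]; [exact/bmM|exact/bmZ|].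
by rewrite ler_wpM2r// ?mt_ge0// mt_leB.
Qed.

(** Local errors at distinct times of equal parity are uncorrelated, and each has variance at most
    [local_mass] * (B - [local_mass]) because [mt] is at most [B]; the factor 2 is the parity
    splitting. *)
Lemma Epost_variance : 0 <= B ->
  Epost (fun w x => (\sum_i Mt w i x - n%:R * local_mass) ^+ 2) <= 2 * (n%:R * (local_mass * (B - local_mass))).
Proof.
move=> B0; pose e w x i := Mt w i x + - local_mass.
have be i x : bm (fun w => e w x i) by apply: bmD => //; exact: bm_cst.
have bee x i j : bm (fun w => e w x i * e w x j) by exact: bmM.
have E i j : Epost (fun w x => e w x i * e w x j) =
    Epost (fun w x => Mt w i x * Mt w j x) - local_mass ^+ 2.
  rewrite (@Epost_ext _ (fun w x => (Mt w i x * Mt w j x + - local_mass * Mt w i x) +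
     (- local_mass * Mt w j x + local_mass ^+ 2))); last by move=> w x; rewrite /e; ring.
  have b1 x : bm (fun w => Mt w i x * Mt w j x) by exact: bmM.
  have b2 k x : bm (fun w => - local_mass * Mt w k x) by exact: bmZ.
  rewrite EpostD => [|x|x]; [|exact: bmD|apply: bmD => //; exact: bm_cst].
  rewrite EpostD// EpostD// => [|x]; last exact: bm_cst.
  have P1 k : Epost (fun w x => Mt w k x) = local_mass := Epost_mt1 k.
  rewrite (EpostZ _ (bMt i)) (EpostZ _ (bMt j)) (P1 i) (P1 j) Epost_cst; ring.
apply: le_trans (_ : Epost (fun w x => 2 * \sum_(i < n) \sum_(j < n | odd j == odd i)
   e w x i * e w x j) <= _).
  apply: Epost_le => [x|x|w x].
  - by rewrite /=; apply: bmM; apply: bmD; (try exact: bm_cst); exact: bm_sum.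
  - by apply/bmZ/bm_sum => i; exact: bm_sum.
  rewrite (_ : _ - _ = \sum_i e w x i) ?sq_sum_parity//.
  by rewrite sumrB sumr_const card_ord mulr_natl.
rewrite EpostZ; last by move=> x; apply/bm_sum => i; exact: bm_sum.
rewrite ler_pM2l// Epost_sum; last by move=> i x; exact: bm_sum.
apply: le_trans (_ : \sum_(i < n) local_mass * (B - local_mass) <= _); last first.
  by rewrite sumr_const card_ord mulr_natl.
apply: ler_sum => i _; rewrite Epost_sum// (bigD1 i)//= [X in _ + X]big1 ?addr0.
  by rewrite E; have := Epost_mt_sq i B0; lra.
move=> j /andP[/eqP oj ji]; rewrite E Epost_mt_mt ?subrr//; by rewrite eq_sym.
Qed.
Lemma risk_ge_Epost (F : Omega -> path -> R) : (forall x, bm (F ^~ x)) ->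
  (forall w A, finset.partition A [set: 'I_n]%SET ->
     \sum_x post w x * F w x <= \sum_x post w x * (n%:R - (gain A x)%:R)) ->
  Epost F <= n%:R * inf_clust_risk P X Y n.
Proof.
move=> bF hF; have := risk_ge (bm_post bF) hF.
by rewrite ler_pdivrMr ?ltr0n// mulrC.
Qed.

Lemma post_mt_le_mu w i x : post w x * Mt w i x <= post w x * mu (post w) i x.
Proof.
have p0 := post_ge0 w; have [fz|fz] := eqVneq (fib (post w) i x) 0.
  have -> : post w x = 0 by rewrite -(upd_id x i) fib0_pi.
  by rewrite !mul0r.
apply: ler_wpM2l => //; have fp : 0 < fib (post w) i x.
  by rewrite lt_neqAle eq_sym fz fib_ge0.
have [b ->] := mu_attained p0 i x; rewrite -(ler_pM2r fp) mulrBl mul1r cp_fib//.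
apply: le_trans (mt_post w i x b) _.
by rewrite lerBrDl /fib [leRHS](bigD1 b).
Qed.

Lemma Epost_sum_mt : Epost (fun w x => \sum_i Mt w i x) = n%:R * local_mass.
Proof.
rewrite (Epost_sum _ bMt) (eq_bigr (fun=> local_mass)) => [|i _]; last exact: Epost_mt1.
by rewrite sumr_const card_ord mulr_natl.
Qed.

(** The condition 2 <= [s] makes the coefficient 1 - 2 / [s] nonnegative, so that [mu] may be
    replaced by its lower bound [mt], whose mean is known. *)
Lemma dense_risk s : 2 <= s ->
  (1 - 2 / s) * (n%:R * local_mass) - J%:R * s / 2 <= n%:R * inf_clust_risk P X Y n.
Proof.
move=> s2; have s0 : 0 < s by lra.
have c0 : 0 <= 1 - 2 / s by rewrite subr_ge0 ler_pdivrMr// mul1r.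
have bS x : bm (fun w => \sum_i Mt w i x) by exact: bm_sum.
have <- : Epost (fun w x => (1 - 2 / s) * (\sum_i Mt w i x) + - (J%:R * s / 2)) =
    (1 - 2 / s) * (n%:R * local_mass) - J%:R * s / 2.
  rewrite EpostD => [|x|x]; [|exact: bmZ|exact: bm_cst].
  by rewrite EpostZ// Epost_cst Epost_sum_mt.
apply: risk_ge_Epost => [x|w A pA]; first by apply: bmD; [exact: bmZ|exact: bm_cst].
have pc i j (ij : i != j) (oij : odd i = odd j) := post_cross w ij (p_cross ij oij).
apply: le_trans (dense_bound (post_ge0 w) pc pA s0).
rewrite card_ord.
have -> : \sum_x post w x * ((1 - 2 / s) * (\sum_i Mt w i x) + - (J%:R * s / 2)) =
    (1 - 2 / s) * (\sum_x post w x * \sum_i Mt w i x) - J%:R * s / 2 * \sum_x post w x.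
  by rewrite !mulr_sumr -sumrB; apply: eq_bigr => x _; ring.
rewrite lerB// ler_wpM2l//.
apply: ler_sum => x _; rewrite !mulr_sumr; apply: ler_sum => i _.
exact: post_mt_le_mu.
Qed.

Lemma sparse_risk (ok : 'I_n -> path -> bool) (t0 t1 : R) : 0 <= B ->
  (forall i x a, ok i (upd x i a) = ok i x) ->
  (forall i x a b, ok i x -> a != b ->
    2 * t1 <= \sum_(j | j != i) ((x j == a) || (x j == b))%:R) ->
  n%:R * local_mass < t0 -> t0 < t1 ->
  local_mass * (\sum_i \sum_x p x * (ok i x)%:R) - n%:R * local_mass / (t1 - t0) -
    n%:R * (local_mass * (B - local_mass)) / (2 * (t0 - n%:R * local_mass)) <=
  n%:R * inf_clust_risk P X Y n.
Proof.
move=> B0 ok_upd ok_pair mt0 t01; set m := n%:R * local_mass; set g := t0 - m.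
have g0 : 0 < g by rewrite subr_gt0.
(* Smooth substitute for the positive part of sum_i mt_i - [t0]: with g = [t0] - m, expanding the
   square of sum_i mt_i - m - 2 g shows that it dominates. Its mean is controlled by
   [Epost_variance]. *)
pose q w x := (4 * g)^-1 * (\sum_i Mt w i x - m) ^+ 2.
have bS x : bm (fun w => \sum_i Mt w i x) by exact: bm_sum.
have bk i x : bm (fun w => Mt w i x * (ok i x)%:R) by apply: bmM => //; exact: bm_cst.
have bK x : bm (fun w => \sum_i Mt w i x * (ok i x)%:R) by exact: bm_sum.
have bd x : bm (fun w => \sum_i Mt w i x - m) by apply: bmD => //; exact: bm_cst.
have bsq x : bm (fun w => (\sum_i Mt w i x - m) ^+ 2) by exact: (bmM (bd x) (bd x)).
have bN x : bm (fun w => - (t1 - t0)^-1 * \sum_i Mt w i x) by exact: bmZ.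
have bq x : bm (fun w => - (4 * g)^-1 * (\sum_i Mt w i x - m) ^+ 2) by exact: bmZ.
pose F w x := \sum_i Mt w i x * (ok i x)%:R +
  (- (t1 - t0)^-1 * \sum_i Mt w i x + - (4 * g)^-1 * (\sum_i Mt w i x - m) ^+ 2).
apply: le_trans (_ : Epost F <= _).
  rewrite EpostD// => [|x]; last exact: bmD.
  rewrite EpostD// EpostZ// EpostZ// Epost_sum_mt Epost_sum//.
  have -> : \sum_i Epost (fun w x => Mt w i x * (ok i x)%:R) =
      local_mass * \sum_i \sum_x p x * (ok i x)%:R.
    rewrite mulr_sumr; apply: eq_bigr => i _; rewrite (@Epost_mt i (fun x => (ok i x)%:R))//.
    by move=> x a; rewrite ok_upd.
  rewrite -/m.
  have := Epost_variance B0; rewrite -/m => hV.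
  rewrite -addrA lerD2l mulNr mulrC lerD2l mulNr lerN2.
  apply: le_trans (ler_wpM2l _ hV) _; first by rewrite invr_ge0 mulr_ge0// ltW.
  by rewrite le_eqVlt; apply/orP; left; apply/eqP; field; rewrite gt_eqF.
apply: risk_ge_Epost => [x|w A pA]; first by do 2 apply: bmD => //.
apply: le_trans (sparse_bound (pi := post w) (mt := Mt w) (ok := ok) (q := q w) pA
  (post_ge0 w) _ _ _ ok_upd ok_pair t01 _ _).
- by apply: ler_sum => x _; rewrite /F /q !mulNr addrA.
- by move=> i x; exact: mt_ge0.
- by move=> i x a; exact: mt_upd.
- by move=> i x b; exact: mt_post.
- by move=> x; rewrite mulr_ge0 ?sqr_ge0// invr_ge0 mulr_ge0// ltW.
move=> x; rewrite /q; set u := \sum_i _.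
rewrite mulrC ler_pdivlMr ?mulr_gt0//.
have := sqr_ge0 (u - m - 2 * g); rewrite /g; nra.
Qed.
End LocalError.
End RiskBounds.

(** * Bounds for the labels of the model in terms of the minimal transition probability *)

Lemma sum_neq_cst (R : pzRingType) J (k : R) (a : 'I_J) :
  \sum_(b < J | b != a) k = (J%:R - 1) * k.
Proof.
have : \sum_(b < J) k = J%:R * k by rewrite sumr_const card_ord mulr_natl.
by rewrite (bigD1 a)//= mulrBl mul1r => <-; rewrite addrC addrK.
Qed.

Section HmmPaths.
Context {R : realType} {J : nat} {dY : measure_display} {TY : measurableType dY}.
Context {L : {measure set TY -> \bar R}} (theta : hmm_param J L).
Context {d : measure_display} {Omega : measurableType d}.
Variables (P : probability Omega R) (X : nat -> Omega -> 'I_J) (Y : nat -> Omega -> TY).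
Hypothesis XY : is_hmm P X Y theta.
Local Notation nu := (hmm_nu theta).
Local Notation Q := (hmm_Q theta : 'I_J -> 'I_J -> R).
Local Notation f := (hmm_f theta).
Local Notation fi := (fint theta).

Let plaw_prefix (u : nat -> 'I_J) m :
  P (label_path X u m.+1) = (plaw nu Q [ffun i : 'I_m.+1 => u i])%:E.
Proof.
have [_ h0 h1] := XY.1; elim: m => [|m IH].
  rewrite (_ : label_path X u 1 = X 0%N @^-1` [set u 0%N]).
    by rewrite h0 /plaw big_ord1 /step /= ffunE.
  apply/seteqP; split => w /=; first exact.
  by move=> h [|i].
have := plaw_ext nu Q [ffun i : 'I_m.+1 => u i] (u m.+1); rewrite ffunE => e.
rewrite h1 IH -EFinM -e; congr (_%:E); congr plaw.
  apply/ffunP => i; rewrite [RHS]ffunE; case: (unliftP ord_max i) => [j ->|->].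
    by rewrite ext_lift ffunE; congr u; exact/esym/lift_max.
  by rewrite ext_max.
Qed.

Lemma plawP_plaw m (x : {ffun 'I_m.+1 -> 'I_J}) : plawP P X x = plaw nu Q x.
Proof.
rewrite /plawP (cylE X (x ord0)) plaw_prefix; congr plaw.
by apply/ffunP => i; rewrite ffunE xtendE.
Qed.

Section Bounded.
Variable dl : R.
Hypothesis dl_gt0 : 0 < dl.
Hypothesis dl_nu : forall a, dl <= nu a.
Hypothesis dl_Q : forall a b, dl <= Q a b.

Lemma plawP_gt0 n (x : {ffun 'I_n -> 'I_J}) : (0 < n)%N -> 0 < plawP P X x.
Proof.
case: n x => // m x _; rewrite plawP_plaw; apply: plaw_gt0 => *;
exact: lt_le_trans dl_gt0 _.
Qed.

Lemma plawP_cross n (i j : 'I_n) : i != j -> odd i = odd j ->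
  cross (plawP P X (n := n)) i j.
Proof.
case: n i j => [[]//|m] i j ij oij x a a' b b'.
by rewrite !plawP_plaw; exact: plaw_cross.
Qed.

Lemma label_law i a : fine (P (X i @^-1` [set a])) =
  \sum_(x : {ffun 'I_i.+1 -> 'I_J}) plaw nu Q x * (x ord_max == a)%:R.
Proof.
have mX : measurable (X i @^-1` [set a]) by have [h _ _] := XY.1; exact: h.
rewrite -EE_indic//.
under eq_bigr => x _ do rewrite -plawP_plaw.
rewrite -(path_law XY (fun x : {ffun 'I_i.+1 -> 'I_J} => (x ord_max == a)%:R)).
apply: EE_ext => w; rewrite indicE ffunE /=; congr (nat_of_bool _)%:R.
by apply/idP/eqP => [/set_mem//|h]; exact/mem_set.
Qed.

Lemma label_ge i a : dl <= fine (P (X i @^-1` [set a])).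
Proof.
rewrite label_law; case: i => [|m]; rewrite sum_ext.
  have s1 : \sum_(x : {ffun 'I_0 -> 'I_J}) dl = dl.
    by rewrite sumr_const card_ffun !card_ord expn0.
  rewrite -[leLHS]s1; apply: ler_sum => x _.
  rewrite (bigD1 a)//= plaw_ext0 ext_max eqxx !mulr1 big1 ?addr0// => b /negPf ba.
  by rewrite ext_max ba mulr0.
have s1 := plaw_sum1 (hmm_nu_sum1 theta) (hmm_Q_sum1 theta) m.
have -> : dl = \sum_(x : {ffun 'I_m.+1 -> 'I_J}) plaw nu Q x * dl.
  by rewrite -mulr_suml s1 mul1r.
apply: ler_sum => x _.
rewrite (bigD1 a)//= plaw_ext ext_max eqxx mulr1 big1 ?addr0 => [|b /negPf ba].
  by rewrite ler_wpM2l// plaw_ge0//; [exact: hmm_nu_ge0|exact: hmm_Q_ge0].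
by rewrite ext_max ba mulr0.
Qed.

Lemma label_sum1 i : \sum_a fine (P (X i @^-1` [set a])) = 1.
Proof.
under eq_bigr => a _ do rewrite label_law.
rewrite exchange_big/= -[RHS](plaw_sum1 (hmm_nu_sum1 theta) (hmm_Q_sum1 theta) i).
apply: eq_bigr => x _; rewrite (bigD1 (x ord_max))//= eqxx mulr1 big1 ?addr0//.
by move=> b /negPf; rewrite eq_sym => ->; rewrite mulr0.
Qed.

Lemma label_le i a : fine (P (X i @^-1` [set a])) <= 1 - (J%:R - 1) * dl.
Proof.
have := label_sum1 i; rewrite (bigD1 a)//= => h.
have : \sum_(b < J | b != a) dl <= \sum_(b < J | b != a) fine (P (X i @^-1` [set b])).
  by apply: ler_sum => b _; exact: label_ge.
rewrite sum_neq_cst.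
by move: h; lra.
Qed.

Lemma plawP_iid n (x : {ffun 'I_n -> 'I_J}) : (0 < n)%N -> Theta_ind theta ->
  plawP P X x = \prod_i nu (x i).
Proof. by case: n x => // m x _ ind; rewrite plawP_plaw plaw_iid. Qed.

Lemma cp_iid n (i : 'I_n) a x : Theta_ind theta -> cp (plawP P X (n := n)) i a x = nu a.
Proof.
case: n i x => [[]//|m] i x ind.
have e b : plawP P X (upd x i b) = nu b * \prod_(j | j != i) nu (x j).
  rewrite plawP_iid// (bigD1 i)//= upd_same; congr (_ * _).
  by apply: eq_bigr => j /negPf ji; rewrite updE ji.
rewrite /cp /fib; under eq_bigr => b _ do rewrite e.
rewrite -mulr_suml hmm_nu_sum1 mul1r e mulfK// gt_eqF// prodr_gt0// => j _.
exact: lt_le_trans dl_gt0 (dl_nu _).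
Qed.

Lemma transition_le (b b' : 'I_J) : Q b b' <= 1 - (J%:R - 1) * dl.
Proof.
have := hmm_Q_sum1 theta b; rewrite (bigD1 b')//= => h.
have : \sum_(c < J | c != b') dl <= \sum_(c < J | c != b') Q b c.
  by apply: ler_sum => c _; exact: dl_Q.
rewrite sum_neq_cst.
by move: h; lra.
Qed.

(** [plaw_local] with transition probabilities between [dl] and 1 - [dl]; the upper bound holds
    because another label exists and takes at least [dl]. *)
Lemma local_ge_dep n (i : 'I_n) a x : (1 < J)%N ->
  dl ^+ 2 / (1 - dl) <= cp (plawP P X (n := n)) i a x.
Proof.
case: n i x => [[]//|m] i x J1.
have J2 : 1 <= J%:R - 1 :> R by rewrite lerBrDr -[1 + 1]/(2%:R) ler_nat.
have M b b' : Q b b' <= 1 - dl.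
  by apply: le_trans (transition_le b b') _; rewrite lerD2l lerN2 ler_peMl// ltW.
have d1 : dl <= 1 - dl := le_trans (dl_Q a a) (M a a).
have p0 : 0 < 1 - dl := lt_le_trans dl_gt0 d1.
have fp : 0 < fib (plawP P X (n := m.+1)) i x.
  apply: lt_le_trans (plawP_gt0 x _) _ => //.
  rewrite -{1}(upd_id x i); apply: pi_le_fib => y; exact/ltW/plawP_gt0.
rewrite /cp ler_pdivlMr// mulrAC ler_pdivrMr// [leRHS]mulrC /fib.
under eq_bigr => b _ do rewrite plawP_plaw.
rewrite plawP_plaw; apply: plaw_local => //; first exact: hmm_nu_ge0.
- exact: hmm_nu_sum1.
- exact: hmm_Q_ge0.
- exact: hmm_Q_sum1.
Qed.
End Bounded.
End HmmPaths.

(** * The plug-in classifier and the upper bound on the risk *)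

Section Tables.
Context {dT : measure_display} {T : measurableType dT} (I C : finType) (h : I -> T -> C).
Hypothesis mh : forall i c, measurable (h i @^-1` [set c]).

Let fiber c := [set t | [ffun i => h i t] = c].

Let m_fiber c : measurable (fiber c).
Proof.
rewrite (_ : fiber c = \bigcap_i (h i @^-1` [set c i])).
  by apply: fin_bigcap_measurable => // i _; exact: mh.
apply/seteqP; split => t /= => [<- i _|H]; first by rewrite ffunE.
by apply/ffunP => i; rewrite ffunE; exact: H.
Qed.

(** Finitely many measurable finite-valued functions form a table with finitely many values, so
    anything computed from the table is measurable. This covers the plug-in rule, the classifiers
    and the partitions built from them. *)
Lemma measurable_table D (K : {ffun I -> C} -> D) e :
  measurable ((fun t => K [ffun i => h i t]) @^-1` [set e]).
Proof.
rewrite (_ : _ @^-1` _ = \bigcup_(c in [set c | K c = e]) fiber c).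
  by apply: fin_bigcup_measurable => // c _; exact: m_fiber.
by apply/seteqP; split => t /= => [<-|[c <- <-//]]; exists [ffun i => h i t].
Qed.

Lemma bm_table (R : realType) (K : {ffun I -> C} -> R) :
  bm (fun t => K [ffun i => h i t]).
Proof.
rewrite (_ : (fun t => _) = (fun t => \sum_c K c * \1_(fiber c) t)).
  by apply: bm_sum => c; apply/bmZ/bm_indic/m_fiber.
apply/funext => t; rewrite (bigD1 [ffun i => h i t])//= big1 ?addr0.
  by rewrite indicE mem_set// mulr1.
by move=> c /eqP ct; rewrite indicE memNset ?mulr0// => /= /esym.
Qed.
End Tables.

Section MinDensity.
Context {R : realType} {J : nat} {dY : measure_display} {TY : measurableType dY}.
Context {L : {measure set TY -> \bar R}} (theta : hmm_param J L).
Hypothesis J_gt0 : (0 < J)%N.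
Local Notation f := (hmm_f theta).
Local Notation fi := (fint theta).

Let F a y := \sum_(x | x != a) f x y.
Let f_ge0 a y : 0 <= f a y. Proof. exact: hmm_f_ge0. Qed.
Let F_ge0 a y : 0 <= F a y. Proof. exact: sumr_ge0. Qed.
Let mF a : measurable_fun setT (F a).
Proof.
rewrite (_ : F a = (fun y => \sum_(x <- [seq x <- index_enum 'I_J | x != a]) f x y)).
  by apply: measurable_sum => x; exact: hmm_f_measurable.
by apply/funext => y; rewrite big_filter.
Qed.

Definition fmin y : R := inf [set \sum_(x | x != x0) f x y | x0 in [set: 'I_J]].

Let cmp (p : 'I_J * 'I_J) y := F p.1 y <= F p.2 y.

(** Label with the largest density at [y], expressed as a minimiser of the sum of the other
    densities. A minimiser exists, so the default value is never returned. *)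
Definition plug_in y : 'I_J :=
  odflt (Ordinal J_gt0) [pick a | [forall b, F a y <= F b y]].

Let plug_in_le y b : F (plug_in y) y <= F b y.
Proof.
rewrite /plug_in; case: pickP => [a /forallP//|h].
have [a _ ha] := @arg_minP _ _ _ (Ordinal J_gt0) xpredT (F ^~ y) isT.
by have /forallP := h a; case => c; exact: ha.
Qed.

Lemma fmin_plug_in y : fmin y = \sum_(x | x != plug_in y) f x y.
Proof.
apply/le_anti/andP; split.
  apply: ge_inf; last by exists (plug_in y).
  by exists 0 => _ [a _ <-]; exact: F_ge0.
apply: lb_le_inf; first by exists (F (plug_in y) y); exists (plug_in y).
by move=> _ [a _ <-]; exact: plug_in_le.
Qed.

Lemma fmin_le a y : fmin y <= \sum_(x | x != a) f x y.
Proof. by rewrite fmin_plug_in; exact: plug_in_le. Qed.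

Lemma fmin_ge0 y : 0 <= fmin y.
Proof. by rewrite fmin_plug_in; exact: F_ge0. Qed.

Lemma measurable_plug_in a : measurable (plug_in @^-1` [set a]).
Proof.
pose K (c : {ffun 'I_J * 'I_J -> bool}) : 'I_J :=
  odflt (Ordinal J_gt0) [pick a | [forall b, c (a, b)]].
rewrite (_ : plug_in = (fun y => K [ffun p => cmp p y])).
  apply: measurable_table => -[a1 a2] b.
  rewrite -[_ @^-1` _]setTI; exact: (measurable_fun_ler (mF a1) (mF a2)).
apply/funext => y; rewrite /plug_in /K; congr odflt; apply: eq_pick => c /=.
by apply: eq_forallb => b; rewrite ffunE.
Qed.

Lemma measurable_fmin : measurable_fun setT fmin.
Proof.
rewrite (_ : fmin = (fun y => \sum_a \1_(plug_in @^-1` [set a]) y * F a y)).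
  apply: measurable_sum => a; apply: measurable_funM => //.
  by have [] := @bm_indic R _ _ _ (measurable_plug_in a).
apply/funext => y; rewrite fmin_plug_in [RHS](bigD1 (plug_in y))//= [X in _ + X]big1 ?addr0.
  by rewrite indicE mem_set// mul1r.
by move=> a /eqP ha; rewrite indicE memNset ?mul0r// => /= /esym.
Qed.

Lemma bm_plug_in_neq a : bm (fun y => (plug_in y != a)%:R : R).
Proof.
rewrite (_ : (fun y => _) = (fun y => 1 + (-1) * \1_(plug_in @^-1` [set a]) y)).
  apply: bmD; first exact: bm_cst.
  apply: bmZ; exact: bm_indic (measurable_plug_in a).
apply/funext => y; rewrite indicE; have [e|/eqP e] := eqVneq (plug_in y) a.
  by rewrite mem_set//= mulr1 subrr.
by rewrite memNset//= mulr0 addr0.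
Qed.

Lemma Lambda_plug_in : Lambda theta = \sum_a fi a (fun y => (plug_in y != a)%:R).
Proof.
have bg := bm_plug_in_neq.
rewrite (sum_fint theta _ bg).2 /Lambda; apply: eq_Rintegral => y _.
rewrite -[LHS]/(fmin y) fmin_plug_in big_mkcond; apply: eq_bigr => a _.
by rewrite eq_sym; case: (plug_in y == a); rewrite ?mul0r ?mul1r.
Qed.

Section UpperBound.
Context {d : measure_display} {Omega : measurableType d}.
Variables (P : probability Omega R) (X : nat -> Omega -> 'I_J) (Y : nat -> Omega -> TY).
Hypothesis XY : is_hmm P X Y theta.
Variable n : nat.
Hypothesis n_gt0 : (0 < n)%N.
Local Notation path := {ffun 'I_n -> 'I_J}.
Local Notation p := (plawP P X (n := n)).

Let mX i b : measurable (X i @^-1` [set b]).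
Proof. by have [[mX _ _] _] := XY; exact: mX. Qed.
Let mY i : measurable_fun [set: Omega] (Y i).
Proof. by have [_ [mY _]] := XY; exact: mY. Qed.

Lemma clust_loss_ge0 A (x : path) : finset.partition A [set: 'I_n]%SET ->
  0 <= clust_loss R A (finset.preim_partition x [set: 'I_n]%SET).
Proof.
move=> pA; have n0 : 0 < n%:R :> R by rewrite ltr0n.
rewrite -(pmulr_rge0 _ n0); apply: le_trans (clust_loss_ge R x n_gt0 pA).
have := missesE R A x; rewrite /misses => ->.
by apply: sumr_ge0.
Qed.

Lemma clust_risk_ge0 g : (@clusterers n _ TY) g -> 0 <= clust_risk P X Y g.
Proof.
move=> [pg _]; rewrite /clust_risk EE_expectation; apply: EE_ge0 => w.
have -> : label_partition X n w = finset.preim_partition (path_of X n w) [set: 'I_n]%SET.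
  by congr finset.preim_partition; apply/funext => i; rewrite ffunE.
exact: clust_loss_ge0.
Qed.

Lemma inf_clust_risk_ge0 : 0 <= inf_clust_risk P X Y n.
Proof.
apply: lb_le_inf; last by move=> _ [g Gg <-]; exact: clust_risk_ge0.
by have [g Gg] := @clusterers_nonempty _ TY n; exists (clust_risk P X Y g), g.
Qed.

Lemma EE_at (i : 'I_n) (psi : 'I_J -> TY -> R) : (forall a, bm (psi a)) ->
  EE P (fun w => psi (X i w) (Y i w)) =
  \sum_a fine (P (X i @^-1` [set a])) * fi a (psi a).
Proof.
move=> bpsi.
have bc (x : path) : bm (\1_(cyl X x) : Omega -> R) by exact (bm_cyl XY x).
have bY a : bm (fun w => psi a (Y i w)) by exact: bm_comp.
transitivity (\sum_(x : path) p x * fi (x i) (psi (x i))).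
  rewrite (@EE_ext _ _ _ P _ (fun w => \sum_(x : path) \1_(cyl X x) w *
      \prod_k (if k == i then psi (x i) else fun=> 1) (Y k w))); last first.
    move=> w; rewrite (bigD1 (path_of X n w))//= in_cyl eqxx mul1r.
    rewrite [X in _ + X]big1 ?addr0 => [|x /negPf xw]; last by rewrite in_cyl xw mul0r.
    rewrite (bigD1 i)//= eqxx big1 ?mulr1 => [|k /negPf ->//].
    by rewrite /path_of ffunE.
  have bk x k : bm ((if k == i then psi (x i) else fun=> 1) : TY -> R).
    by case: ifP => // _; exact: bm_cst.
  rewrite EE_sum; last first.
    by move=> x; apply: bmM => //; apply: bm_prod => k; exact: bm_comp.
  apply: eq_bigr => x _.
  rewrite (joint_prod XY x (psi := fun k => if k == i then psi (x i) else fun=> 1))//.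
  congr (_ * _).
  rewrite (bigD1 i)//= eqxx big1 ?mulr1// => k /negPf ->; exact: fint1.
rewrite -(path_law XY (fun x : path => fi (x i) (psi (x i)))).
rewrite (@EE_ext _ _ _ P _ (fun w => \sum_a fi a (psi a) * \1_(X i @^-1` [set a]) w)).
  rewrite EE_sum; last by move=> a; apply/bmZ/bm_indic.
  apply: eq_bigr => a _; rewrite EEZ; last exact: bm_indic.
  by rewrite EE_indic// mulrC.
move=> w; rewrite ffunE (bigD1 (X i w))//= big1 ?addr0.
  by rewrite indicE mem_set// mulr1.
by move=> a /eqP ha; rewrite indicE memNset ?mulr0// => /= /esym.
Qed.

(** The risk of the plug-in partition is at most its classification error. At time i this is a
    combination, with weights P(X_i = a) <= [M], of the terms whose sum is [Lambda] by
    [Lambda_plug_in]. *)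
Lemma risk_upper (M : R) : (forall (i : 'I_n) a, fine (P (X i @^-1` [set a])) <= M) ->
  inf_clust_risk P X Y n <= M * Lambda theta.
Proof.
move=> hM; have n0 : 0 < n%:R :> R by rewrite ltr0n.
pose g (y : n.-tuple TY) :=
  finset.preim_partition [ffun i => plug_in (tnth y i)] [set: 'I_n]%SET.
have Gg : (@clusterers n _ TY) g.
  split=> [y|q]; first exact: finset.preim_partitionP.
  have mh (i : 'I_n) c : measurable ((fun y : n.-tuple TY => plug_in (tnth y i)) @^-1` [set c]).
    rewrite -[_ @^-1` _]setTI.
    exact: (measurable_tnth i measurableT (measurable_plug_in c)).
  exact: (measurable_table mh (fun c : path => finset.preim_partition c [set: 'I_n]%SET) q).
apply: le_trans (_ : clust_risk P X Y g <= _).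
  apply: ge_inf; last by exists g.
  by exists 0 => _ [h Gh <-]; exact: clust_risk_ge0.
rewrite /clust_risk EE_expectation.
have bt := bm_plug_in_neq.
pose h (i : 'I_n + 'I_n) w : 'I_J :=
  match i with inl i => X i w | inr i => plug_in (Y i w) end.
have mh i c : measurable (h i @^-1` [set c]).
  case: i => i /=; first exact: mX.
  rewrite -[_ @^-1` _]setTI.
  exact: (mY i measurableT (measurable_plug_in c)).
pose K (c : {ffun 'I_n + 'I_n -> 'I_J}) := clust_loss R
  (finset.preim_partition [ffun i => c (inr i)] [set: 'I_n]%SET)
  (finset.preim_partition [ffun i => c (inl i)] [set: 'I_n]%SET).
pose D i (c : {ffun 'I_n + 'I_n -> 'I_J}) : R := (c (inr i) != c (inl i))%:R.
rewrite (@EE_ext _ _ _ P _ (fun w => K [ffun i => h i w])); last first.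
  move=> w; rewrite /K /g /label_partition; congr clust_loss;
    congr finset.preim_partition; apply/funext => i; rewrite !ffunE//=.
  by rewrite tnth_mktuple.
have bi (i : 'I_n) : bm (fun w => (plug_in (Y i w) != X i w)%:R : R).
  rewrite (_ : (fun w => _) = (fun w => D i [ffun i => h i w])); first exact: bm_table.
  by apply/funext => w; rewrite /D !ffunE.
apply: le_trans (_ : EE P (fun w => n%:R^-1 * \sum_(i < n) (plug_in (Y i w) != X i w)%:R) <= _).
  apply: EE_le; [exact: bm_table|by apply/bmZ/bm_sum|move=> w].
  rewrite -ler_pdivrMl ?invr_gt0// invrK.
  apply: le_trans (clust_loss_le R [ffun i => [ffun i => h i w] (inl i)]
    [ffun i => [ffun i => h i w] (inr i)] n_gt0) _.
  by apply: ler_sum => i _; rewrite !ffunE.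
rewrite EEZ; last exact: bm_sum.
rewrite EE_sum// ler_pdivrMl//.
have -> : n%:R * (M * Lambda theta) = \sum_(i < n) M * Lambda theta.
  by rewrite sumr_const card_ord mulr_natl.
apply: ler_sum => i _; rewrite (@EE_at i (fun a y => (plug_in y != a)%:R))//.
rewrite Lambda_plug_in mulr_sumr; apply: ler_sum => a _.
by rewrite ler_wpM2r// fint_ge0.
Qed.
End UpperBound.
End MinDensity.

(** * Two labels: residual and exponential risk bounds, and the Bayes error *)

Section BinaryRisk.
Context {R : realType} {dY : measure_display} {TY : measurableType dY}.
Context {L : {measure set TY -> \bar R}} (theta : hmm_param 2 L).
Context {d : measure_display} {Omega : measurableType d}.
Variables (P : probability Omega R) (X : nat -> Omega -> 'I_2) (Y : nat -> Omega -> TY).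
Hypothesis XY : is_hmm P X Y theta.
Variable n : nat.
Hypothesis n_gt0 : (0 < n)%N.
Hypothesis p_gt0 : forall x : {ffun 'I_n -> 'I_2}, 0 < plawP P X x.
Local Notation path := {ffun 'I_n -> 'I_2}.
Local Notation nu := (hmm_nu theta).
Local Notation f := (hmm_f theta).
Local Notation fi := (fint theta).
Local Notation p := (plawP P X (n := n)).
Local Notation Eunif := (Eunif P X n).
Local Notation lam := (unif_mean theta).
Let J0 : (0 < 2)%N := isT.
Implicit Types (x : path) (a b : 'I_2) (i j : 'I_n) (w : Omega).

Let mY i : measurable_fun [set: Omega] (Y i).
Proof. by have [_ [mY _]] := XY; exact: mY. Qed.
Let bmYi i (g : TY -> R) : bm g -> bm (fun w => g (Y i w)).
Proof. by move=> hg; exact: bm_comp. Qed.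

Lemma binary_dense_risk (mm : TY -> R) s :
  (forall y, 0 <= mm y) -> measurable_fun setT mm ->
  (forall i x b y, mm y <= \sum_(a | a != b) cp p i a x * f a y) ->
  (forall i j, i != j -> odd i = odd j -> cross p i j) -> 0 < s ->
  n%:R * (\int[L]_y mm y) - (s / 2 + n%:R / s) / 2 <= n%:R * inf_clust_risk P X Y n.
Proof.
move=> mm_ge0 mmm mm_le p_cross s0.
pose K := (s / 2 + n%:R / s) / 2.
have bt i x := bmYi i (bm_mt p_gt0 mm_ge0 mmm mm_le i x).
have bS x : bm (fun w => \sum_(i < n) mt theta P X mm i x (Y i w)) by exact: bm_sum.
have <- : Epost theta P X Y (fun w x => \sum_(i < n) mt theta P X mm i x (Y i w) + - K) =
    n%:R * (\int[L]_y mm y) - K.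
  rewrite (EpostD XY)// => [|x]; last exact: bm_cst.
  by rewrite (Epost_cst XY)// (Epost_sum_mt XY).
apply: (risk_ge_Epost XY) => // [x|w A pA]; first by apply: bmD => //; exact: bm_cst.
have pc i j (ij : i != j) (oij : odd i = odd j) :=
  post_cross theta Y w ij (p_cross i j ij oij).
have po x := post_ge0 theta Y p_gt0 w x.
apply: le_trans (binary_dense_bound po pA pc s0).
have -> : \sum_(x : path) post theta P X Y w x * (\sum_(i < n) mt theta P X mm i x (Y i w) + - K) =
  \sum_(x : path) post theta P X Y w x * (\sum_(i < n) mt theta P X mm i x (Y i w)) -
  K * \sum_(x : path) post theta P X Y w x.
  by rewrite !mulr_sumr -sumrB; apply: eq_bigr => x _; ring.
rewrite lerB//; apply: ler_sum => x _; rewrite !mulr_sumr; apply: ler_sum => i _.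
exact: (post_mt_le_mu Y p_gt0 mm_ge0 mm_le).
Qed.

Hypothesis p_iid : forall x, p x = \prod_i nu (x i).

Let q a y := nu a * dens theta a y.
Let Z y := q ord0 y + q ord_max y.
Let M y := Num.min (q ord0 y) (q ord_max y).
Definition bayes := \int[L]_y Num.min (nu ord0 * f ord0 y) (nu ord_max * f ord_max y).

Let nu_ge0 a : 0 <= nu a. Proof. exact: hmm_nu_ge0. Qed.
Let nu1 : nu ord0 + nu ord_max = 1.
Proof. by rewrite -big_ord2; exact: hmm_nu_sum1. Qed.
Let q_ge0 a y : 0 <= q a y. Proof. by rewrite mulr_ge0// dens_ge0. Qed.
Let bq a : bm (q a). Proof. by apply: bmZ; exact: bm_dens. Qed.
Let bZ : bm Z. Proof. exact: bmD. Qed.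
Let M_ge0 y : 0 <= M y. Proof. by rewrite le_min !q_ge0. Qed.
Let bM : bm M.
Proof.
split; first by apply: measurable_minr; exact: (bq _).1.
have [_ [C hC]] := bq ord0; exists C => y.
rewrite ger0_norm//; apply: le_trans (hC y); rewrite ger0_norm//.
by rewrite ge_min lexx.
Qed.

Let post_q w x : post theta P X Y w x = \prod_i q (x i) (Y i w).
Proof. by rewrite /post p_iid -big_split. Qed.

Let lam_add g h : bm g -> bm h -> lam (fun y => g y + h y) = lam g + lam h.
Proof.
move=> bg bh; rewrite /unif_mean -mulrDr -big_split/=; congr (_ * _).
by apply: eq_bigr => a _; exact: fintD.
Qed.

Let lam_scale k g : bm g -> lam (fun y => k * g y) = k * lam g.
Proof.
move=> bg; rewrite /unif_mean [RHS]mulrCA [in RHS]mulr_sumr; congr (_ * _).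
by apply: eq_bigr => a _; exact: fintZ.
Qed.

Let lamq a : lam (q a) = nu a.
Proof.
rewrite lam_scale; last exact: bm_dens.
rewrite (_ : dens theta a = fun y => dens theta a y * 1).
  by rewrite (unif_mean_dens theta J0) ?fint1 ?mulr1//; exact: bm_cst.
by apply/funext => y; rewrite mulr1.
Qed.

Let lamZ : lam Z = 1.
Proof. by rewrite lam_add// !lamq. Qed.

Let lamM : lam M = bayes.
Proof.
have -> : bayes = \int[L]_y (\sum_a (2^-1 * M y) * f a y).
  apply: eq_Rintegral => y _; rewrite -mulr_sumr; set S := \sum_a f a y.
  have S0 : 0 <= S by apply: sumr_ge0 => a _; exact: hmm_f_ge0.
  have e a : q a y * S = 2 * (nu a * f a y).
    by rewrite /q -mulrA dens_sum; ring.
  by rewrite -mulrA /M minr_pMl// !e -minr_pMr// mulKf.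
have bm2 (a : 'I_2) : bm (fun y => 2^-1 * M y) by exact: bmZ.
rewrite -(sum_fint theta _ bm2).2.
by rewrite /unif_mean mulr_sumr; apply: eq_bigr => a _; rewrite fintZ.
Qed.

Lemma bayes_ge0 : 0 <= bayes.
Proof.
by apply: Rintegral_ge0 => y _; rewrite le_min !mulr_ge0// hmm_f_ge0.
Qed.

Lemma bayes_le : bayes <= 1 / 2.
Proof.
have : lam (fun y => 2 * M y) <= lam Z.
  rewrite /unif_mean ler_wpM2l ?invr_ge0//; apply: ler_sum => a _.
  apply: fint_le => // [|y]; first exact: bmZ.
  have h0 : M y <= q ord0 y by rewrite /M ge_min lexx.
  have h1 : M y <= q ord_max y by rewrite /M ge_min lexx orbT.
  by rewrite /Z; lra.
rewrite lam_scale// lamZ lamM; lra.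
Qed.

(** For independent labels the posterior is a product, so [binary_independent_le] applies for each
    observation. The observations being i.i.d. under [Eunif], the products integrate to powers of
    the means of Z (which is 1), of Z - 2 M (which is 1 - 2 [bayes]) and of the exponential
    factor. *)
Lemma chernoff_risk l : 0 < l ->
  n%:R * bayes - l^-1 * (expR l * bayes + expR (- l) * (1 - bayes)) ^+ n <=
  n%:R * inf_clust_risk P X Y n.
Proof.
move=> l0.
pose D y := Z y + (- 2) * M y.
have bD : bm D by apply: bmD => //; exact: bmZ.
pose W y := expR l * M y + (expR (- l) * Z y + (- expR (- l)) * M y).
have bW : bm W by apply: bmD; [exact: bmZ|apply: bmD; exact: bmZ].
have lamD : lam D = 1 - 2 * bayes.
  rewrite lam_add//; last exact: bmZ.
  by rewrite lam_scale// lamZ lamM; ring.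
have lamW : lam W = expR l * bayes + expR (- l) * (1 - bayes).
  rewrite lam_add//; [|exact: bmZ|by apply: bmD; exact: bmZ].
  rewrite lam_add; [|exact: bmZ|exact: bmZ].
  by rewrite !lam_scale// lamZ lamM; ring.
pose psiD i j : TY -> R := if j == i then D else Z.
have bpsi i j : bm (psiD i j) by rewrite /psiD; case: ifP.
pose Pd w := \sum_i \prod_j psiD i j (Y j w).
pose Pw w := \prod_(j < n) W (Y j w).
pose Pz w := \prod_(j < n) Z (Y j w).
have bPd : bm Pd by apply: bm_sum => i; apply: bm_prod => j; exact: bmYi.
have bPw : bm Pw by apply: bm_prod => j; exact: bmYi.
have bPz : bm Pz by apply: bm_prod => j; exact: bmYi.
pose LB w := (n%:R / 2) * Pz w + ((- 2^-1) * Pd w + (- l^-1) * Pw w).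
have bLB : bm LB by apply: bmD; [exact: bmZ|apply: bmD; exact: bmZ].
have EPd : Eunif Pd = n%:R * (1 - 2 * bayes).
  rewrite (Eunif_sum XY); last by move=> i; apply: bm_prod => j; exact: bmYi.
  transitivity (\sum_(i < n) (1 - 2 * bayes)); last first.
    by rewrite sumr_const card_ord [RHS]mulr_natl.
  apply: eq_bigr => i _; rewrite (Eunif_prod XY p_gt0 (bpsi i)).
  rewrite (bigD1 i)//= /psiD eqxx lamD big1 ?mulr1// => j /negPf ->.
  exact: lamZ.
have ELB : Eunif LB = n%:R * bayes - l^-1 * (expR l * bayes + expR (- l) * (1 - bayes)) ^+ n.
  rewrite (EunifD XY)//; [|exact: bmZ|by apply: bmD; exact: bmZ].
  rewrite (EunifD XY)//; [|exact: bmZ|exact: bmZ].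
  rewrite !(EunifZ XY)// EPd.
  rewrite (Eunif_prod XY p_gt0 (psi := fun=> Z))// (Eunif_prod XY p_gt0 (psi := fun=> W))//.
  rewrite lamW lamZ !prodr_const card_ord expr1n; field.
  by rewrite gt_eqF.
rewrite -ELB; have := @risk_ge _ _ _ _ _ theta _ _ P X Y XY n J0 n_gt0 p_gt0 LB bLB.
rewrite ler_pdivrMr ?ltr0n// [_ * n%:R]mulrC; apply => w A pA.
have po x := post_ge0 theta Y p_gt0 w x.
pose Bd := Pd w + 2 / l * Pw w.
have hZ : \sum_(x : path) post theta P X Y w x = Pz w.
  have Zs y : Z y = \sum_a q a y by rewrite big_ord2.
  rewrite /Pz; under [RHS]eq_bigr => j _ do rewrite Zs.
  by rewrite bigA_distr_bigA; apply: eq_bigr => x _; exact: post_q.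
have := binary_misses_ge po pA (B := Bd) _.
rewrite hZ => hB; apply: le_trans (hB _).
  by rewrite /LB /Bd le_eqVlt; apply/orP; left; apply/eqP; field; rewrite gt_eqF.
move=> e he; under eq_bigr => x _ do rewrite post_q.
apply: le_trans (binary_independent_le (q := fun i a => q a (Y i w)) _ he l0) _.
  by move=> i a; exact: q_ge0.
rewrite /Bd; apply: lerD.
  rewrite /Pd le_eqVlt; apply/orP; left; apply/eqP; apply: eq_bigr => i _.
  rewrite [RHS](bigD1 i)//= /psiD eqxx; congr (_ * _).
    by rewrite /D /Z /M; ring.
  by apply: eq_bigr => j /negPf ->.
apply: ler_wpM2l; first by rewrite divr_ge0// ltW.
rewrite le_eqVlt; apply/orP; left; apply/eqP; apply: eq_bigr => i _.
by rewrite /W /Z /M; ring.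
Qed.

Let psiM i j : TY -> R := if j == i then M else Z.
Let Ef w := n%:R^-1 * \sum_(i < n) \prod_j psiM i j (Y j w).

Let bpsiM i j : bm (psiM i j). Proof. by rewrite /psiM; case: ifP. Qed.

Let bEf : bm Ef.
Proof. by apply/bmZ/bm_sum => i; apply: bm_prod => j; exact: bmYi. Qed.

Let Eunif_Ef : Eunif Ef = bayes.
Proof.
have n0 : n%:R != 0 :> R by rewrite pnatr_eq0 gt_eqF.
rewrite (EunifZ XY); last by apply/bm_sum => i; apply: bm_prod => j; exact: bmYi.
rewrite (Eunif_sum XY); last by move=> i; apply: bm_prod => j; exact: bmYi.
transitivity (n%:R^-1 * \sum_(i < n) bayes); last first.
  by rewrite sumr_const card_ord -[bayes *+ n]mulr_natl mulKf.
congr (_ * _); apply: eq_bigr => i _; rewrite (Eunif_prod XY p_gt0 (bpsiM i)).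
rewrite (bigD1 i)//= /psiM eqxx lamM big1 ?mulr1// => j /negPf ->.
exact: lamZ.
Qed.

Let other c y := \sum_a q a y * (c != a)%:R.

Let other_ge c y : M y <= other c y.
Proof.
have h0 : M y <= q ord0 y by rewrite /M ge_min lexx.
have h1 : M y <= q ord_max y by rewrite /M ge_min lexx orbT.
by rewrite /other big_ord2; elim/ord2P: c => /=; rewrite ?mulr0 ?mulr1 ?add0r ?addr0.
Qed.

Let likeliest y : 'I_2 :=
  if nu ord_max * f ord_max y <= nu ord0 * f ord0 y then ord0 else ord_max.

Let qE a y : q a y = nu a * f a y * (2 / \sum_b f b y).
Proof. by rewrite /q /dens; ring. Qed.

Let other_likeliest y : other (likeliest y) y = M y.
Proof.
have s0 : 0 <= 2 / \sum_b f b y.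
  by rewrite divr_ge0// sumr_ge0// => b _; exact: hmm_f_ge0.
rewrite /other big_ord2 /M /likeliest; case: ifP => h /=; rewrite mulr0 mulr1 ?add0r ?addr0.
  by rewrite min_r// !qE ler_wpM2r.
by rewrite min_l// !qE ler_wpM2r// ltW// ltNge h.
Qed.

Let sum_miss w i c : \sum_x post theta P X Y w x * (c != x i)%:R =
  other c (Y i w) * \prod_(j | j != i) Z (Y j w).
Proof.
pose k j a : R := if j == i then (c != a)%:R else 1.
transitivity (\sum_(x : path) \prod_j (q (x j) (Y j w) * k j (x j))).
  apply: eq_bigr => x _; rewrite post_q [RHS]big_split/=; congr (_ * _).
  by rewrite (bigD1 i)//= /k eqxx big1 ?mulr1// => j /negPf ->.
rewrite -(bigA_distr_bigA (fun j a => q a (Y j w) * k j a)) (bigD1 i)//=.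
congr (_ * _); first by apply: eq_bigr => a _; rewrite /k eqxx.
apply: eq_bigr => j /negPf ji; rewrite big_ord2 /k ji !mulr1 //.
Qed.

Let risk_w (z : n.-tuple 'I_2) w := n%:R^-1 *
  \sum_(i < n) other (tnth z i) (Y i w) * \prod_(j | j != i) Z (Y j w).

Let risk_wE z w :
  \sum_x post theta P X Y w x * (n%:R^-1 * \sum_(i < n) (tnth z i != x i)%:R) = risk_w z w.
Proof.
rewrite /risk_w; under [in RHS]eq_bigr => i _ do rewrite -sum_miss.
rewrite exchange_big/= mulr_sumr; apply: eq_bigr => x _.
by rewrite mulrCA -mulr_sumr.
Qed.

Let EfE w : Ef w = n%:R^-1 * \sum_(i < n) M (Y i w) * \prod_(j | j != i) Z (Y j w).
Proof.
congr (_ * _); apply: eq_bigr => i _; rewrite (bigD1 i)//= /psiM eqxx; congr (_ * _).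
by apply: eq_bigr => j /negPf ->.
Qed.

Let Z_ge0 y : 0 <= Z y. Proof. by rewrite addr_ge0. Qed.

Let class_riskE h : (@classifiers 2 n _ TY) h ->
  class_risk P X Y h = Eunif (fun w => risk_w (h (obs Y n w)) w).
Proof.
move=> mh; pose l (z : n.-tuple 'I_2) (x : path) := n%:R^-1 * \sum_(i < n) (tnth z i != x i)%:R : R.
rewrite /class_risk EE_expectation (@EE_ext _ _ _ P _ (fun w => l (h (obs Y n w)) (path_of X n w))).
  rewrite (expectation_change XY J0 p_gt0 l mh).
  by apply: Eunif_ext => w; rewrite -risk_wE.
by move=> w; congr (_ * _); apply: eq_bigr => i _; rewrite ffunE.
Qed.

Let bm_risk h : (@classifiers 2 n _ TY) h -> bm (fun w => risk_w (h (obs Y n w)) w).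
Proof.
move=> mh.
have mo A : measurable A -> measurable (obs Y n @^-1` A : set Omega).
  by move=> mA; rewrite -[_ @^-1` _]setTI; apply: (measurable_obs XY).
rewrite (_ : (fun w => _) = (fun w => \sum_z
   \1_(obs Y n @^-1` (h @^-1` [set z])) w * risk_w z w)).
  apply: bm_sum => z; apply: bmM; first exact: bm_indic (mo _ (mh z)).
  apply/bmZ/bm_sum => i; apply: bmM; last by apply: bm_prod => j; exact: bmYi.
  by apply: bm_sum => a; apply: bmM; [exact: bmYi|exact: bm_cst].
apply/funext => w; rewrite (bigD1 (h (obs Y n w)))//= big1 ?addr0.
  by rewrite indicE mem_set ?mul1r.
by move=> z /eqP zh; rewrite indicE memNset ?mul0r// => /= /esym.
Qed.

(** The posterior factorises, so a classifier cannot do better at a time than the smaller of its two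
    label weights, and choosing the likelier label at every time attains this. It identifies the
    classification risk in [epsilon] with an integral. *)
Lemma inf_class_risk_bayes : inf_class_risk P X Y n = bayes.
Proof.
have lb h : (@classifiers 2 n _ TY) h -> bayes <= class_risk P X Y h.
  move=> mh; rewrite class_riskE// -Eunif_Ef; apply: (Eunif_le XY) => //; first exact: bm_risk.
  move=> w; rewrite EfE ler_wpM2l ?invr_ge0//; apply: ler_sum => i _.
  by rewrite ler_wpM2r// prodr_ge0.
pose h (y : n.-tuple TY) := [tuple likeliest (tnth y i) | i < n].
have ml a : measurable (likeliest @^-1` [set a]).
  have mf b : measurable_fun setT (fun y => nu b * f b y).
    by apply: measurable_funM => //; exact: hmm_f_measurable.
  have := measurable_fun_ler (mf ord_max) (mf ord0) => ml.
  pose g (c : {ffun unit -> bool}) : 'I_2 := if c tt then ord0 else ord_max.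
  have mc (u : unit) (b : bool) : measurable
      ((fun y => nu ord_max * f ord_max y <= nu ord0 * f ord0 y) @^-1` [set b]).
    by rewrite -[_ @^-1` _]setTI; exact: ml.
  rewrite (_ : likeliest = fun y => g [ffun=> nu ord_max * f ord_max y <= nu ord0 * f ord0 y]).
    exact: (measurable_table mc g a).
  by apply/funext => y; rewrite /g ffunE.
have mh : (@classifiers 2 n _ TY) h.
  move=> z; pose K (c : path) : n.-tuple 'I_2 := [tuple c i | i < n].
  have mc (i : 'I_n) c : measurable ((fun y : n.-tuple TY => likeliest (tnth y i)) @^-1` [set c]).
    by rewrite -[_ @^-1` _]setTI; exact: (measurable_tnth i measurableT (ml c)).
  rewrite (_ : h = fun y => K [ffun i => likeliest (tnth y i)]).
    exact: (measurable_table mc K z).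
  by apply/funext => y; apply/eq_from_tnth => i; rewrite !tnth_mktuple ffunE.
apply/le_anti/andP; split.
  apply: le_trans (_ : class_risk P X Y h <= _).
    by apply: ge_inf; [exists bayes => _ [k mk <-]; exact: lb|exists h].
  rewrite class_riskE// -Eunif_Ef (@Eunif_ext _ _ _ _ P X n _ Ef)// => w.
  rewrite EfE; congr (_ * _); apply: eq_bigr => i _.
  by rewrite !tnth_mktuple other_likeliest.
apply: lb_le_inf; first by exists (class_risk P X Y h); exists h.
by move=> _ [k mk <-]; exact: lb.
Qed.
End BinaryRisk.

(** * Contraction constants and mean pair counts *)

Lemma osc_le (R : realFieldType) (K : finType) (f u v : K -> R) c w (b0 : K) :
  (forall a b, f a - f b <= w) -> (forall a, 0 <= u a) -> (forall a, 0 <= v a) ->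
  \sum_a u a = c -> \sum_a v a = c -> \sum_a u a * f a - \sum_a v a * f a <= c * w.
Proof.
move=> fw u0 v0 uc vc; have [b _ hb] := @arg_minP _ _ _ b0 xpredT f isT.
have : \sum_a u a * f a <= \sum_a u a * (f b + w).
  by apply: ler_sum => a _; rewrite ler_wpM2l//; have := fw a b; lra.
have : \sum_a v a * f b <= \sum_a v a * f a.
  by apply: ler_sum => a _; rewrite ler_wpM2l// hb.
rewrite -!mulr_suml uc vc mulrDr; lra.
Qed.

Section PairCounts.
Context {R : realType} {J : nat} {dY : measure_display} {TY : measurableType dY}.
Context {L : {measure set TY -> \bar R}} (theta : hmm_param J L).
Context {d : measure_display} {Omega : measurableType d}.
Variables (P : probability Omega R) (X : nat -> Omega -> 'I_J) (Y : nat -> Omega -> TY).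
Hypothesis XY : is_hmm P X Y theta.
Local Notation nu := (hmm_nu theta).
Local Notation Q := (hmm_Q theta : 'I_J -> 'I_J -> R).
Local Notation f := (hmm_f theta).

Let mX i b : measurable (X i @^-1` [set b]).
Proof. by have [[mX _ _] _] := XY; exact: mX. Qed.

Lemma contraction_ind : Theta_ind theta -> forall g w, (forall a b, g a - g b <= w) ->
  forall a b, \sum_b0 Q a b0 * g b0 - \sum_b0 Q b b0 * g b0 <= 0 * w.
Proof.
move=> ind g w _ a b; rewrite mul0r.
have e c : \sum_b0 Q c b0 * g b0 = \sum_b0 nu b0 * g b0.
  by apply: eq_bigr => b0 _; rewrite ind.
by rewrite !e subrr.
Qed.

(** Doeblin's argument: all rows share the constant part [dl], which cancels in the difference; the
    remainders are nonnegative with common mass 1 - J [dl]. *)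
Lemma contraction_dep (dl : R) : (forall a b, dl <= Q a b) ->
  forall g w, (forall a b, g a - g b <= w) ->
  forall a b, \sum_b0 Q a b0 * g b0 - \sum_b0 Q b b0 * g b0 <= (1 - J%:R * dl) * w.
Proof.
move=> dQ g w gw a b.
have e c : \sum_b0 Q c b0 * g b0 = \sum_b0 (Q c b0 - dl) * g b0 + \sum_b0 dl * g b0.
  by rewrite -big_split; apply: eq_bigr => b0 _ /=; ring.
have s c : \sum_b0 (Q c b0 - dl) = 1 - J%:R * dl.
  by rewrite sumrB hmm_Q_sum1 sumr_const card_ord mulr_natl.
rewrite !e.
have := osc_le a gw (u := fun b0 => Q a b0 - dl) (v := fun b0 => Q b b0 - dl) _ _ (s a) (s b).
have h c b0 : 0 <= Q c b0 - dl by rewrite subr_ge0.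
by move=> /(_ (h a) (h b)); lra.
Qed.

Lemma fine_pair i a b : a != b -> fine (P (X i @^-1` [set a; b])) =
  fine (P (X i @^-1` [set a])) + fine (P (X i @^-1` [set b])).
Proof.
move=> ab; rewrite preimage_setU measureU//.
  by rewrite fineD// fin_num_measure.
by rewrite -subset0 => w /= [-> /eqP]; apply/negP.
Qed.

Variable n : nat.
Hypothesis n_gt0 : (0 < n)%N.
Local Notation beta := (pair_beta P X n).

Lemma pair_beta_le (i : 'I_n) a b : a != b ->
  beta <= fine (P (X i @^-1` [set a])) + fine (P (X i @^-1` [set b])).
Proof.
move=> ab; rewrite -fine_pair//; apply: ge_inf; last by exists i, a, b.
by exists 0 => _ [j [a' [b' [_ ->]]]]; exact: fine_ge0.
Qed.

Lemma pair_beta_ge (dl : R) : (1 < J)%N -> 0 < dl -> (forall a, dl <= nu a) ->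
  (forall a b, dl <= Q a b) -> 2 * dl <= beta.
Proof.
move=> J1 dl0 dnu dQ; apply: lb_le_inf.
  pose a := Ordinal (ltnW J1); pose b := Ordinal J1.
  by eexists; exists (Ordinal n_gt0), a, b; split; [|reflexivity].
move=> _ [i [a [b [ab ->]]]]; rewrite fine_pair//.
have ha := label_ge XY dnu dQ i a; have hb := label_ge XY dnu dQ i b.
lra.
Qed.

(** For one time, summing P(X = a) + P(X = b) over all ordered pairs of distinct labels gives 2 (J -
    1), while each of the J (J - 1) terms is at least [beta]. *)
Lemma pair_beta_upper : (1 < J)%N -> J%:R * beta <= 2.
Proof.
move=> J1; pose i0 := Ordinal n_gt0; pose q a := fine (P (X i0 @^-1` [set a])).
have qs : \sum_a q a = 1 := label_sum1 XY i0.
have Jp : 0 < J%:R - 1 :> R by rewrite subr_gt0 ltr1n.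
have h a : (J%:R - 1) * beta <= (J%:R - 2) * q a + 1.
  rewrite -(sum_neq_cst beta a).
  apply: le_trans (_ : \sum_(b | b != a) (q a + q b) <= _).
    by apply: ler_sum => b ba; apply: pair_beta_le; rewrite eq_sym.
  rewrite big_split/= sum_neq_cst.
  by move: qs; rewrite (bigD1 a)//=; lra.
have : \sum_(a < J) (J%:R - 1) * beta <= \sum_a ((J%:R - 2) * q a + 1).
  by apply: ler_sum => a _; exact: h.
have -> : \sum_a ((J%:R - 2) * q a + 1) = (J%:R - 1) * 2.
  by rewrite big_split/= -mulr_sumr qs sumr_const card_ord -[1 *+ J]/(J%:R); ring.
rewrite sumr_const card_ord -[_ *+ J]mulr_natl => H.
by rewrite -(ler_pM2l Jp) mulrCA.
Qed.

Lemma pair_count_mean a b : a != b ->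
  n%:R * beta <= \sum_(x : {ffun 'I_n -> 'I_J}) plawP P X x * pair_count R a b x.
Proof.
move=> ab.
have -> : \sum_(x : {ffun 'I_n -> 'I_J}) plawP P X x * pair_count R a b x =
    \sum_(i < n) \sum_(x : {ffun 'I_n -> 'I_J}) plawP P X x * ((x i == a) || (x i == b))%:R.
  by rewrite exchange_big/=; apply: eq_bigr => x _; rewrite mulr_sumr.
have -> : n%:R * beta = \sum_(i < n) beta by rewrite sumr_const card_ord mulr_natl.
apply: ler_sum => i _; apply: le_trans (pair_beta_le i ab) _.
rewrite -(path_law XY (fun x : {ffun 'I_n -> 'I_J} => ((x i == a) || (x i == b))%:R)).
rewrite -fine_pair// -EE_indic; last by rewrite preimage_setU; exact: measurableU.
apply: EE_le; first by apply: bm_indic; rewrite preimage_setU; exact: measurableU.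
  rewrite (_ : (fun w => _) = (\1_(X i @^-1` [set a; b]))).
    by apply: bm_indic; rewrite preimage_setU; exact: measurableU.
  apply/funext => w; rewrite ffunE indicE; congr (nat_of_bool _)%:R.
  apply/idP/idP => [/orP[/eqP h|/eqP h]|/set_mem/=]; first by apply/mem_set; left.
    by apply/mem_set; right.
  by case=> ->; rewrite eqxx ?orbT.
move=> w; rewrite ffunE indicE; case: (boolP (w \in _)) => //= /set_mem/= h.
by case: h => ->; rewrite eqxx ?orbT.
Qed.
End PairCounts.

(** * More than two labels: combining the dense and sparse bounds *)

Section MultiRisk.
Context {R : realType} {J : nat} {dY : measure_display} {TY : measurableType dY}.
Context {L : {measure set TY -> \bar R}} (theta : hmm_param J L).
Context {d : measure_display} {Omega : measurableType d}.
Variables (P : probability Omega R) (X : nat -> Omega -> 'I_J) (Y : nat -> Omega -> TY).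
Hypothesis XY : is_hmm P X Y theta.
Local Notation nu := (hmm_nu theta).
Local Notation Q := (hmm_Q theta : 'I_J -> 'I_J -> R).
Local Notation f := (hmm_f theta).
Variable n : nat.
Hypothesis J_gt1 : (1 < J)%N.
Hypothesis n_gt0 : (0 < n)%N.
Local Notation path := {ffun 'I_n -> 'I_J}.
Local Notation p := (plawP P X (n := n)).
Local Notation beta := (pair_beta P X n).
Hypothesis p_gt0 : forall x : path, 0 < p x.
Implicit Types (x : path) (i j : 'I_n) (a b : 'I_J).

Let J_gt0 : (0 < J)%N := ltnW J_gt1.

Lemma pair_counts_ge c : 0 <= c < 1 ->
  (forall g w, (forall a b, g a - g b <= w) -> forall a b,
     \sum_b0 Q a b0 * g b0 - \sum_b0 Q b b0 * g b0 <= c * w) ->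
  0 < n%:R * beta ->
  10 * J%:R * (J%:R - 1) * ((1 + c) / (1 - c)) <= n%:R * beta ->
  11 / 16 <= \sum_x p x *
    [forall a, forall b, (a != b) ==> (3 / 5 * (n%:R * beta) <= pair_count R a b x)%R]%:R.
Proof.
move=> c01 contract s0 big; set s := n%:R * beta.
have : \sum_x p x * [exists a, exists b, (a != b) && (pair_count R a b x < 3 / 5 * s)%R]%:R
    <= 5 / 16.
  have := @pair_count_concentration R _ nu Q (hmm_nu_ge0 theta) (hmm_nu_sum1 theta)
    (hmm_Q_ge0 theta) (hmm_Q_sum1 theta) n.-1 c s c01 contract s0.
  have e := prednK n_gt0; rewrite card_ord => /(_ _ big).
  have mean a b (ab : a != b) := pair_count_mean XY n ab.
  move: n e @s s0 big mean p_gt0; case=> // m _ /= s0 big mean _ H.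
  under eq_bigr => x _ do rewrite (plawP_plaw XY).
  apply: H => a b ab; have := mean a b ab.
  by under eq_bigr => x _ do rewrite (plawP_plaw XY).
have s1 := plawP_sum1 XY n.
have e x : [exists a, exists b, (a != b) && (pair_count R a b x < 3 / 5 * s)%R]
    = ~~ [forall a, forall b, (a != b) ==> (3 / 5 * s <= pair_count R a b x)%R].
  rewrite negb_forall; apply: eq_existsb => a; rewrite negb_forall; apply: eq_existsb => b.
  by rewrite negb_imply -ltNge.
pose G x := [forall a, forall b, (a != b) ==> (3 / 5 * s <= pair_count R a b x)%R].
rewrite -[X in _ -> _ <= X]/(\sum_x p x * (G x)%:R).
have sG : \sum_x p x * (G x)%:R + \sum_x p x * (~~ G x)%:R = 1.
  rewrite -[RHS]s1 -big_split; apply: eq_bigr => x _ /=; case: (G x) => /=.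
    by rewrite mulr1 mulr0 addr0.
  by rewrite mulr1 mulr0 add0r.
by under eq_bigr => x _ do rewrite e -/(G x); move: sG; lra.
Qed.

Lemma multi_risk (mm : TY -> R) c :
  (forall y, 0 <= mm y) -> measurable_fun setT mm ->
  (forall i x b y, mm y <= \sum_(a | a != b) cp p i a x * f a y) ->
  (forall i j, i != j -> odd i = odd j -> cross p i j) ->
  0 <= c < 1 ->
  (forall g w, (forall a b, g a - g b <= w) -> forall a b,
     \sum_b0 Q a b0 * g b0 - \sum_b0 Q b b0 * g b0 <= c * w) ->
  10 * J%:R * (J%:R - 1) * ((1 + c) / (1 - c)) <= n%:R * beta ->
  40 * J%:R <= n%:R * beta -> 3 <= J%:R :> R ->
  (\int[L]_y mm y) / 4 <= inf_clust_risk P X Y n.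
Proof.
move=> mm_ge0 mmm mm_le p_cross c01 contract big1 big2 J3.
have n0 : 0 < n%:R :> R by rewrite ltr0n.
rewrite -(ler_pM2l n0); set s := n%:R * beta in big1 big2 *.
set t := \int[L]_y mm y; set m := n%:R * t.
have t0 : 0 <= t by apply: Rintegral_ge0 => y _; exact: mm_ge0.
have m0 : 0 <= m by rewrite mulr_ge0// ltW.
(* With parameter 16/3 the dense bound is 5/8 m - 8/3 J, which exceeds m / 4 exactly when m is at
   least 64/9 J. *)
rewrite mulrA -/m; have [mbig|msmall] := leP (64 / 9 * J%:R) m.
  have := dense_risk XY J_gt0 n_gt0 p_gt0 mm_ge0 mmm mm_le p_cross (s := 16 / 3).
  have -> : (1 - 2 / (16 / 3)) * (n%:R * local_mass (L := L) mm) = 5 / 8 * m.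
    by rewrite -[n%:R * _]/m; field.
  have -> : J%:R * (16 / 3) / 2 = 8 / 3 * J%:R :> R by field.
  by move=> H; apply: le_trans (H _); lra.
have s0 : 0 < s by lra.
have H := pair_counts_ge c01 contract s0 big1.
(* Pair counts are at least 3/5 s on the good event; removing label i costs at most 1, and halving
   gives [t1]. The value [t0'] leaves room on both sides: [t1] - [t0'] is at least 20/3 and [t0'] -
   m at least 7, so the losses are 3/20 m and m / 14. What remains of 11/16 m exceeds m / 4. *)
pose t1 : R := 3 / 10 * s - 1 / 2; pose t0' : R := 6 / 25 * s.
pose ok i x := [forall a, forall b, (a != b) ==>
  (2 * t1 <= \sum_(j | j != i) ((x j == a) || (x j == b))%:R)%R].
have ok_upd i x a : ok i (upd x i a) = ok i x.
  apply: eq_forallb => b; apply: eq_forallb => b'; congr (_ ==> (_ <= _)).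
  by apply: eq_bigr => j /negPf ji; rewrite updE ji.
have ok_pair i x a b : ok i x -> a != b ->
    2 * t1 <= \sum_(j | j != i) ((x j == a) || (x j == b))%:R.
  by move=> /forallP/(_ a)/forallP/(_ b)/implyP; exact.
have mm_leB i x y : mm y <= 1 * \sum_a cp p i a x * f a y.
  rewrite mul1r; apply: le_trans (mm_le i x (x i) y) _.
  rewrite [leRHS](bigD1 (x i))//= lerDr mulr_ge0 ?hmm_f_ge0//.
  by apply: cp_ge0 => z; exact: ltW.
have t01 : t0' < t1 by rewrite /t0' /t1; lra.
have mt0 : n%:R * local_mass (L := L) mm < t0' by rewrite -[n%:R * _]/m /t0'; lra.
apply: le_trans (sparse_risk XY J_gt0 n_gt0 p_gt0 mm_ge0 mmm mm_le mm_leB p_cross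
  ler01 ok_upd ok_pair mt0 t01).
rewrite -[local_mass _]/t -/m.
have okE : n%:R * (11 / 16) <= \sum_i \sum_x p x * (ok i x)%:R.
  have -> : n%:R * (11 / 16) = \sum_(i < n) (11 / 16 : R).
    by rewrite sumr_const card_ord mulr_natl.
  apply: ler_sum => i _; apply: le_trans H _; apply: ler_sum => x _.
  apply: ler_wpM2l; first exact: ltW.
  have [g|_] :=
    boolP [forall a, forall b, (a != b) ==> (3 / 5 * (n%:R * beta) <= pair_count R a b x)%R]; last first.
    by rewrite /= ler0n.
  suff -> : ok i x by [].
  apply/forallP => a; apply/forallP => b; apply/implyP => ab.
  move/forallP/(_ a)/forallP/(_ b)/implyP/(_ ab): g.
  rewrite /pair_count (bigD1 i)//= => g.
  have b1 : ((x i == a) || (x i == b))%:R <= 1 :> R by case: (_ || _); rewrite ?ler01.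
  by rewrite /t1; move: g b1; rewrite -/s; lra.
have h1 : 11 / 16 * m <= t * \sum_i \sum_x p x * (ok i x)%:R.
  have -> : 11 / 16 * m = t * (n%:R * (11 / 16)) by rewrite /m; ring.
  exact: ler_wpM2l.
have h2 : m / (t1 - t0') <= 3 / 20 * m.
  rewrite ler_pdivrMr ?subr_gt0//.
  have : 0 <= m * (t1 - t0' - 20 / 3) by apply: mulr_ge0 => //; rewrite /t1 /t0'; lra.
  lra.
have h3 : n%:R * (t * (1 - t)) / (2 * (t0' - m)) <= m / 14.
  have g0 : 7 <= t0' - m by rewrite /t0'; lra.
  rewrite ler_pdivrMr; last lra.
  have : 0 <= m * (t0' - m - 7) by apply: mulr_ge0 => //; lra.
  have : 0 <= m * t by apply: mulr_ge0.
  have -> : n%:R * (t * (1 - t)) = m - m * t by rewrite /m; ring.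
  lra.
lra.
Qed.
End MultiRisk.

(** * Numerical estimates for the rates *)

Section Numerics.
Variable R : realType.
Implicit Types (b dl r t x y : R) (n J : nat).

(** The inequality 1 + x <= exp x at 1/16 and -1/16 encloses exp(1/16) between 17/16 and 16/15; four
    squarings, with rounding, give e. *)
Lemma expR1_bounds : 13 / 5 <= expR (1 : R) <= 141 / 50.
Proof.
pose z : R := expR (16^-1).
have z1 : 17 / 16 <= z by have := expR_ge1Dx (16^-1 : R); rewrite -/z; lra.
have z2 : z <= 16 / 15.
  have h : 1 - 16^-1 <= z^-1 by rewrite /z -expRN; have := expR_ge1Dx (- 16^-1 : R).
  have z0 : 0 < z by exact: expR_gt0.
  have : z * (1 - 16^-1) <= z * z^-1 by rewrite ler_pM2l.
  by rewrite divff ?gt_eqF//; lra.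
have -> : expR 1 = (((z ^+ 2) ^+ 2) ^+ 2) ^+ 2 :> R.
  by rewrite -!exprM /z -expRM_natl mulfV// .
have s x lo hi lo' hi' : 0 <= lo -> lo <= x /\ x <= hi -> lo' <= lo ^+ 2 -> hi ^+ 2 <= hi' ->
    lo' <= x ^+ 2 /\ x ^+ 2 <= hi'.
  move=> l0 [h1 h2] h3 h4; split; [apply: le_trans h3 _|apply: le_trans h4].
    by rewrite lerXn2r ?nnegrE//; exact: le_trans h1.
  by rewrite lerXn2r ?nnegrE//; [|apply: le_trans h2]; exact: le_trans h1.
have a1 : 17 / 16 <= z /\ z <= 16 / 15 by split.
have a2 : 141 / 125 <= z ^+ 2 /\ z ^+ 2 <= 5689 / 5000 by apply: (s _ _ _ _ _ _ a1); lra.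
have a3 : 159 / 125 <= (z ^+ 2) ^+ 2 /\ (z ^+ 2) ^+ 2 <= 6473 / 5000.
  by apply: (s _ _ _ _ _ _ a2); lra.
have a4 : 1617 / 1000 <= ((z ^+ 2) ^+ 2) ^+ 2 /\ ((z ^+ 2) ^+ 2) ^+ 2 <= 838 / 500.
  by apply: (s _ _ _ _ _ _ a3); lra.
by apply/andP; apply: (s _ _ _ _ _ _ a4); lra.
Qed.

Lemma ln_ge a x : expR a <= x -> a <= ln x :> R.
Proof.
move=> h; rewrite -[a]expRK ler_ln// posrE ?expR_gt0//.
exact: lt_le_trans (expR_gt0 a) h.
Qed.

Lemma ln2_ge : 2 / 3 <= ln 2 :> R.
Proof.
apply: ln_ge; rewrite -(@ler_pXn2r _ 3)// ?nnegrE ?expR_ge0// -expRM_natl.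
have -> : 3%:R * (2 / 3) = 2%:R * 1 :> R by field.
rewrite expRM_natl; case/andP: expR1_bounds => h1 h2; nra.
Qed.

Lemma ln_fact_ge J : (0 < J)%N -> (J%:R - 1) / 2 <= ln (J`!)%:R :> R.
Proof.
move=> J0; apply: le_trans (_ : (J%:R - 1) * ln 2 <= _).
  apply: ler_wpM2l; first by rewrite subr_ge0 ler1n.
  by apply: le_trans ln2_ge; lra.
have -> : (J%:R - 1) * ln 2 = ln (2 ^+ J.-1) :> R.
  have e : J%:R = J.-1%:R + 1 :> R by rewrite natr1 prednK.
  by rewrite e addrK lnXn// [LHS]mulr_natl.
rewrite ler_ln ?posrE ?exprn_gt0 ?ltr0n ?fact_gt0//.
rewrite -natrX ler_nat; case: J J0 => // J _ /=.
by elim: J => // J IH; rewrite expnS factS leq_mul.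
Qed.

Lemma ln_fact_ge3 J : (3 <= J)%N -> 8 / 5 <= ln (J`!)%:R :> R.
Proof.
move=> J3; apply: le_trans (_ : ln 6 <= _); last first.
  rewrite ler_ln ?posrE ?ltr0n ?fact_gt0// (ler_nat _ 6) -[6%N]/(3`!)%N.
  exact: leq_fact.
apply: ln_ge; rewrite -(@ler_pXn2r _ 5)// ?nnegrE ?expR_ge0// -expRM_natl.
have -> : 5%:R * (8 / 5) = 8%:R * 1 :> R by field.
rewrite expRM_natl; case/andP: expR1_bounds => h1 h2.
apply: le_trans (_ : (141 / 50) ^+ 8 <= _); last lra.
by rewrite lerXn2r// nnegrE ?expR_ge0//; lra.
Qed.

(** Write D = (1 - dl) / dl >= 1 and v = sqrt(ln 2 / (2n)) <= 1. As the exponent lies between -1 and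
    1, the power of D * v is at least v / D, which leaves 2 e v D^3 >= 2 e v. Finally 2 * 13/5 *
    15/26 = 3. *)
Lemma alpha_tilde_ge n dl : (0 < n)%N -> 0 < dl <= 1 / 2 ->
  3 / Num.sqrt n%:R <= alpha_tilde n dl.
Proof.
move=> n0 /andP[d0 d1]; rewrite /alpha_tilde.
set D := (1 - dl) / dl; set v := Num.sqrt (ln 2 / _); set g := 1 - 2 / n%:R.
have N1 : 1 <= n%:R :> R by rewrite ler1n.
have N0 : 0 < n%:R :> R by rewrite ltr0n.
have D1 : 1 <= D by rewrite /D ler_pdivlMr//; lra.
have i1 : n%:R^-1 <= 1 :> R by rewrite invf_le1.
have g1 : g <= 1 by rewrite /g gerBl divr_ge0.
have g2 : -1 <= g by rewrite /g; lra.
have l2 : 2 / 3 <= ln 2 :> R := ln2_ge.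
have l1 : ln 2 <= 1 :> R.
  by have := @le_ln1Dx R 1; rewrite -[1 + 1]/(2%:R); apply; lra.
have vE : v = Num.sqrt (ln 2 / 2) / Num.sqrt n%:R.
  by rewrite /v invfM mulrA sqrtrM ?sqrtrV//; lra.
have sn : 0 < Num.sqrt n%:R :> R by rewrite sqrtr_gt0.
have u0 : 15 / 26 <= Num.sqrt (ln 2 / 2) :> R.
  rewrite -[15 / 26]ger0_norm; last lra.
  by rewrite -sqrtr_sqr ler_sqrt; lra.
have v0 : 0 < v by rewrite vE divr_gt0//; lra.
have v1 : v <= 1.
  rewrite /v -[leRHS]sqrtr1 ler_sqrt// ler_pdivrMr; last by rewrite mulr_gt0.
  by rewrite mul1r; lra.
have e1 : 13 / 5 <= expR 1 :> R by case/andP: expR1_bounds.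
have hv : v <= v `^ g by apply: ger1_powR => //; rewrite v0 v1.
have hD : D^-1 <= D `^ g.
  rewrite -powR_inv1; last by lra.
  exact: ler_powR.
rewrite powRM; [|by lra|exact: ltW].
apply: le_trans (_ : 2 * expR 1 * D ^+ 4 * (D^-1 * v) <= _); last first.
  apply: ler_wpM2l; first by apply: mulr_ge0; [lra|apply: exprn_ge0; lra].
  by apply: ler_pM => //; [rewrite invr_ge0; lra|exact: ltW].
have -> : 2 * expR 1 * D ^+ 4 * (D^-1 * v) = 2 * expR 1 * v * D ^+ 3.
  by field; rewrite gt_eqF//; lra.
apply: le_trans (_ : 2 * expR 1 * v <= _); last first.
  rewrite ler_peMr ?exprn_ege1//; apply: mulr_ge0; [lra|exact: ltW].
rewrite vE mulrA ler_pM2r ?invr_gt0//.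
have : 0 <= (expR 1 - 13 / 5) * (Num.sqrt (ln 2 / 2) - 15 / 26) :> R.
  by apply: mulr_ge0; lra.
lra.
Qed.

Lemma sparse_numeric n t : 3 < Num.sqrt n%:R :> R -> 0 <= t -> t <= 59 / 250 ->
  0 < n%:R * (1 / 2 - t) - 1 / 2 /\
  3 / 2 * (1 + (1 / 2 - t)) / (n%:R * (1 / 2 - t) - 1 / 2) <= 3 / Num.sqrt n%:R.
Proof.
move=> y3 t0 t1; pose y : R := Num.sqrt n%:R.
(* n is an integer, so sqrt n > 3 means n >= 10; the estimate below uses sqrt n >= 3.16. *)
have n10 : 10 <= n%:R :> R.
  rewrite ler_nat ltnNge; apply/negP => n9; move: y3; apply/negP; rewrite -leNgt.
  have -> : 3 = Num.sqrt 9%:R :> R.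
    by rewrite (_ : 9%:R = 3 ^+ 2) ?sqrtr_sqr ?ger0_norm//; ring.
  by rewrite ler_sqrt// ler_nat.
have yy : y ^+ 2 = n%:R by rewrite sqr_sqrtr.
have y1 : 316 / 100 <= y.
  rewrite -[316 / 100]ger0_norm; last lra.
  by rewrite -sqrtr_sqr ler_sqrt; lra.
have g0 : 0 < n%:R * (1 / 2 - t) - 1 / 2 by nra.
split=> //; rewrite -/y ler_pdivrMr// [leRHS]mulrAC ler_pdivlMr; last lra.
rewrite -yy; set h := 1 / 2 - t.
have h0 : 33 / 125 <= h by rewrite /h; lra.
have a1 : 0 <= (h - 33 / 125) * (y * (y - 1 / 2)).
  by apply: mulr_ge0; [lra|apply: mulr_ge0; lra].
have a2 : 0 <= (y - 316 / 100) * (33 / 125 * y - 79 / 125).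
  by apply: mulr_ge0; lra.
move: a1 a2; nra.
Qed.
End Numerics.

Section Conditions.
Variable R : realType.
Implicit Types (b dl r t x y : R) (n J : nat).

(** The condition 4 <= n b makes the exponent in [xi] nonnegative. Since the prefactor is at least
    15, the square root w is at most 1 and hence at most its power. Squaring yields 216 ln(J!) <= n
    b^2, and J b <= 2 turns this into 108 J ln(J!) <= n b, from which both claims follow by ln(J!)
    >= (J - 1) / 2. *)
Lemma xi_conditions n J b : (3 <= J)%N -> (0 < n)%N -> 0 < b -> J%:R * b <= 2 ->
  4 <= n%:R * b -> xi J n b <= 2^-1 ->
  40 * J%:R <= n%:R * b /\ 10 * J%:R * (J%:R - 1) <= n%:R * b.
Proof.
move=> J3 n0 b0 Jb nb; rewrite /xi; set F : R := ln _.
have J3' : 3 <= J%:R :> R by rewrite (ler_nat _ 3).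
have F1 : (J%:R - 1) / 2 <= F by apply: ln_fact_ge; exact: leq_trans J3.
have N0 : 0 < n%:R :> R by rewrite ltr0n.
set w := Num.sqrt _; set g := 1 - _.
have e1 : 13 / 5 <= expR 1 :> R by case/andP: (expR1_bounds R).
have nb0 : 0 < n%:R * b by lra.
have g0 : 0 <= g by rewrite /g subr_ge0 ler_pdivrMr// mul1r.
have g1 : g <= 1 by rewrite /g gerBl divr_ge0// ltW.
have b23 : b <= 2 / 3.
  have : 0 <= (J%:R - 3) * b by apply: mulr_ge0; lra.
  lra.
have wq : w ^+ 2 * (2 * n%:R) = F.
  rewrite sqr_sqrtr; first by rewrite divfK// gt_eqF// mulr_gt0.
  by apply: divr_ge0; [lra|rewrite mulr_ge0// ltW].
have w0 : 0 < w by rewrite sqrtr_gt0 divr_gt0//; [lra|rewrite mulr_gt0].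
have k1 : 15 <= 4 * expR 1 / b.
  by rewrite ler_pdivlMr//; lra.
move=> H; have w1 : w <= 1.
  rewrite leNgt; apply/negP => w1.
  have : 1 <= w `^ g by rewrite -[leLHS](powRr0 w); apply: ler_powR => //; exact: ltW.
  move=> h; have : 15 * 1 <= 4 * expR 1 / b * w `^ g by apply: ler_pM.
  lra.
have h1 : w <= w `^ g by apply: ger1_powR => //; rewrite w0 w1.
have h2 : 4 * expR 1 / b * w <= 2^-1.
  by apply: le_trans H; apply: ler_wpM2l => //; lra.
have h3 : w <= b * (5 / 104).
  move: h2; rewrite mulrAC ler_pdivrMr// => h2.
  have : 0 <= (expR 1 - 13 / 5) * w by apply: mulr_ge0; [lra|exact: ltW].
  lra.
have h4 : 216 * F <= n%:R * b ^+ 2.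
  have : 0 <= (b * (5 / 104) - w) * (b * (5 / 104) + w).
    by apply: mulr_ge0; [lra|apply: addr_ge0; [apply: mulr_ge0; lra|exact: ltW]].
  have : 0 <= n%:R * (b * (5 / 104) - w) * (b * (5 / 104) + w).
    rewrite -mulrA; apply: mulr_ge0 => //.
    by apply: mulr_ge0; [lra|apply: addr_ge0; [apply: mulr_ge0; lra|exact: ltW]].
  have -> : n%:R * (b * (5 / 104) - w) * (b * (5 / 104) + w) =
      25 / 10816 * (n%:R * b ^+ 2) - (w ^+ 2 * (2 * n%:R)) / 2 by field.
  by rewrite wq; lra.
have h5 : 108 * F * J%:R <= n%:R * b.
  have : 0 <= (n%:R * b ^+ 2 - 216 * F) * J%:R by apply: mulr_ge0; lra.
  have : 0 <= n%:R * b * (2 - J%:R * b) by apply: mulr_ge0; lra.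
  lra.
have h6 : 54 * (J%:R - 1) * J%:R <= n%:R * b.
  have : 0 <= (F - (J%:R - 1) / 2) * J%:R by apply: mulr_ge0; lra.
  lra.
have h7 : 0 <= (J%:R - 3) * J%:R :> R by apply: mulr_ge0; lra.
split; lra.
Qed.

(** With u = 1 - (J - 1) dl, one has 1 - [rho0] = dl / u =: rh. The hypothesis squared, with J b <=
    2, gives 25 J ln(J!) <= n b rh^2. The first claim follows from rh <= 1 and ln(J!) >= 8/5. For
    the second, rh = x / (J u) with x = J dl, and x (2 - x) <= 1 <= (J u)^2. *)
Lemma xi_tilde_conditions n J b dl : (3 <= J)%N -> (0 < n)%N -> 0 < b -> J%:R * b <= 2 ->
  0 < dl -> J%:R * dl <= 1 -> xi_tilde J n b (rho0 J dl) <= 2^-1 ->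
  40 * J%:R <= n%:R * b /\
  10 * J%:R * (J%:R - 1) * ((1 + (1 - J%:R * dl)) / (1 - (1 - J%:R * dl))) <= n%:R * b.
Proof.
move=> J3 n0 b0 Jb d0 Jd; rewrite /xi_tilde /rho0; set F : R := ln _.
have J3' : 3 <= J%:R :> R by rewrite (ler_nat _ 3).
have F1 : (J%:R - 1) / 2 <= F by apply: ln_fact_ge; exact: leq_trans J3.
have F2 : 8 / 5 <= F by exact: ln_fact_ge3.
have N0 : 0 < n%:R :> R by rewrite ltr0n.
set w := Num.sqrt _; set u := 1 - (J%:R - 1) * dl.
have du : dl <= u by rewrite /u; lra.
have u0 : 0 < u by lra.
have -> : 1 - (1 - J%:R * dl) / u = dl / u by rewrite /u; field; rewrite gt_eqF// -/u.
set rh := dl / u.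
have rh0 : 0 < rh by rewrite divr_gt0.
have rh1 : rh <= 1 by rewrite ler_pdivrMr// mul1r.
have wq : w ^+ 2 * (2 * n%:R) = F.
  rewrite sqr_sqrtr; first by rewrite divfK// gt_eqF// mulr_gt0.
  by apply: divr_ge0; [lra|rewrite mulr_ge0// ltW].
have w0 : 0 < w by rewrite sqrtr_gt0 divr_gt0//; [lra|rewrite mulr_gt0].
have br0 : 0 < b * rh by rewrite mulr_gt0.
rewrite mulrAC ler_pdivrMr// => h2.
have h4 : 50 * F <= n%:R * (b * rh) ^+ 2.
  have : 0 <= n%:R * ((b * rh / 10 - w) * (b * rh / 10 + w)).
    by apply: mulr_ge0 => //; apply: mulr_ge0; lra.
  have -> : n%:R * ((b * rh / 10 - w) * (b * rh / 10 + w)) =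
      (n%:R * (b * rh) ^+ 2) / 100 - (w ^+ 2 * (2 * n%:R)) / 2 by field.
  by rewrite wq; lra.
have h5 : 25 * F * J%:R <= n%:R * b * rh ^+ 2.
  have : 0 <= (n%:R * (b * rh) ^+ 2 - 50 * F) * J%:R by apply: mulr_ge0; lra.
  have : 0 <= n%:R * b * rh ^+ 2 * (2 - J%:R * b).
    by rewrite mulr_ge0// ?subr_ge0// mulr_ge0 ?sqr_ge0// mulr_ge0// ltW.
  lra.
have nb0 : 0 < n%:R * b by rewrite mulr_gt0.
split.
  have : 0 <= n%:R * b * (1 - rh ^+ 2).
    by apply: mulr_ge0; [exact: ltW|rewrite subr_ge0 exprn_ile1// ltW].
  have : 0 <= (F - 8 / 5) * J%:R by apply: mulr_ge0; lra.
  lra.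
set x := J%:R * dl in Jd *.
have x0 : 0 < x by apply: mulr_gt0; lra.
have h6 : 25 / 2 * (J%:R - 1) * J%:R <= n%:R * b * rh ^+ 2.
  have : 0 <= (F - (J%:R - 1) / 2) * J%:R by apply: mulr_ge0; lra.
  lra.
have -> : 1 - (1 - x) = x by ring.
rewrite mulrA ler_pdivrMr//.
have Ju1 : 1 <= J%:R * u.
  have : 0 <= (J%:R - 1) * (1 - x) by apply: mulr_ge0; lra.
  by rewrite /u /x; lra.
have h8 : (1 + (1 - x)) * x <= (J%:R * u) ^+ 2.
  apply: le_trans (_ : 1 <= _); last by rewrite exprn_ege1.
  have := sqr_ge0 (1 - x); lra.
have h9 : n%:R * b * rh ^+ 2 * (J%:R * u) ^+ 2 = n%:R * b * x ^+ 2.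
  by rewrite /rh /x; field; rewrite gt_eqF.
have JJ : 0 <= (J%:R - 1) * J%:R :> R by apply: mulr_ge0; lra.
rewrite -(ler_pM2r x0).
have -> : n%:R * b * x * x = n%:R * b * rh ^+ 2 * (J%:R * u) ^+ 2 by rewrite h9; ring.
apply: le_trans (_ : 10 * ((J%:R - 1) * J%:R) * (J%:R * u) ^+ 2 <= _).
  have : 0 <= (J%:R - 1) * J%:R * ((J%:R * u) ^+ 2 - (1 + (1 - x)) * x).
    by apply: mulr_ge0 => //; rewrite subr_ge0.
  lra.
by apply: ler_wpM2r; [exact: sqr_ge0|lra].
Qed.

(** Here r is the classification risk, so that [epsilon] is 1/2 - r. The second term of [alpha]
    comes from the residual bound, since sqrt(2n) / 2 is n / sqrt(2n) and pi >= 1. *)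
Lemma alpha_bound n r K : (0 < n)%N -> 0 <= r <= 1 / 2 -> 0 <= K ->
  n%:R * r - Num.sqrt (2 * n%:R) / 2 <= n%:R * K ->
  (forall l, 0 < l ->
     n%:R * r - l^-1 * (expR l * r + expR (- l) * (1 - r)) ^+ n <= n%:R * K) ->
  (1 - alpha n (2^-1 - r)) * r <= K.
Proof.
move=> n0 /andP[r0 r1] K0 dense cher; rewrite /alpha.
have N0 : 0 < n%:R :> R by rewrite ltr0n.
case: eqP => [e|ne].
  have -> : r = 0 by lra.
  by rewrite mulr0.
have rp : 0 < r by rewrite lt_neqAle r0 andbT; apply/eqP => h; apply: ne; lra.
have e1 : 1 - 2 * (2^-1 - r) = 2 * r by field.
have e2 : 1 + 2 * (2^-1 - r) = 2 * (1 - r) by field.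
have e3 : 1 - 4 * (2^-1 - r) ^+ 2 = 4 * (r * (1 - r)) by field.
rewrite e1 e2 e3; set t2 := (2 * r)^-1 * _; set t1 := _ / (n%:R * _).
have H2 : (1 - 2 * t2) * r <= K.
  have -> : (1 - 2 * t2) * r = r - Num.sqrt (pi / (2 * n%:R)).
    by rewrite /t2; field; rewrite gt_eqF.
  have y0 : 0 < Num.sqrt (2 * n%:R) :> R by rewrite sqrtr_gt0 mulr_gt0.
  have h : (Num.sqrt (2 * n%:R))^-1 <= Num.sqrt (pi / (2 * n%:R)) :> R.
    rewrite -sqrtrV; last by rewrite mulr_ge0.
    rewrite ler_sqrt; last by rewrite divr_ge0 ?pi_ge0// mulr_ge0.
    rewrite ler_peMl ?invr_ge0 ?mulr_ge0//; have := pi_ge2 R; lra.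
  have yy : Num.sqrt (2 * n%:R) / 2 = n%:R * (Num.sqrt (2 * n%:R))^-1 :> R.
    have := @sqr_sqrtr R (2 * n%:R); rewrite mulr_ge0// => /(_ isT) q.
    apply: (mulIf (x := Num.sqrt (2 * n%:R))); first by rewrite gt_eqF.
    by rewrite mulfVK ?gt_eqF// mulrAC -expr2 q; field.
  rewrite -(ler_pM2l N0); apply: le_trans dense; rewrite yy mulrBr lerD2l lerN2.
  by rewrite ler_pM2l.
case: eqP => [//|ne0].
have r2 : r < 1 / 2 by rewrite lt_neqAle r1 andbT; apply/eqP => h; apply: ne0; lra.
suff H1 : (1 - 2 * t1) * r <= K by case: (leP t1 t2).
(* This l minimises exp(l) r + exp(-l) (1 - r), with minimum sqrt a; the exponential bound then
   equals n (1 - 2 [t1]) r exactly. *)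
pose a := 4 * (r * (1 - r)); pose l := ln ((1 - r) / r) / 2.
have q0 : 0 < (1 - r) / r by apply: divr_gt0; lra.
have l0 : 0 < l.
  rewrite /l divr_gt0// ln_gt0//.
  by rewrite ltr_pdivlMr//; lra.
have a0 : 0 < a by apply: mulr_gt0 => //; apply: mulr_gt0; lra.
have El : expR l ^+ 2 = (1 - r) / r.
  rewrite -expRM_natl /l mulrCA divff// mulr1 lnK// posrE.
have Ea : expR l * r + expR (- l) * (1 - r) = Num.sqrt a.
  apply/eqP; rewrite -(@eqrXn2 _ 2)//.
    rewrite sqr_sqrtr ?ltW// expRN.
    have eE : 1 - r = r * expR l ^+ 2 by rewrite El mulrCA divff ?mulr1// gt_eqF.
    rewrite /a eE; apply/eqP; field; by rewrite gt_eqF// expR_gt0.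
  by rewrite addr_ge0// mulr_ge0// ?expR_ge0//; lra.
have := cher _ l0; rewrite Ea => H; rewrite -(ler_pM2l N0); apply: le_trans H.
rewrite le_eqVlt; apply/orP; left; apply/eqP.
have -> : Num.sqrt a ^+ n = a * a `^ ((n%:R - 2) / 2).
  rewrite -powR12_sqrt ?ltW// -powR_mulrn ?powR_ge0// -powRrM.
  rewrite -[X in X * _ `^ _]powRr1 ?ltW// -powRD; last by rewrite (gt_eqF a0) implybT.
  by congr (_ `^ _); field.
rewrite /t1 -/a.
have -> : ln (2 * (1 - r) / (2 * r)) = 2 * l.
  rewrite /l mulrCA divff// mulr1; congr ln; field; by rewrite gt_eqF.
rewrite [in RHS]/a; field.
by rewrite !gt_eqF.
Qed.
End Conditions.

(** * Bounds in terms of [Lambda] and the final assembly *)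

Section Lower.
Context {R : realType} {J : nat} {dY : measure_display} {TY : measurableType dY}.
Context {L : {measure set TY -> \bar R}} (theta : hmm_param J L).
Context {d : measure_display} {Omega : measurableType d}.
Variables (P : probability Omega R) (X : nat -> Omega -> 'I_J) (Y : nat -> Omega -> TY).
Hypothesis XY : is_hmm P X Y theta.
Hypothesis J_gt1 : (1 < J)%N.
Variable n : nat.
Hypothesis n_gt0 : (0 < n)%N.
Variable dl : R.
Hypothesis dl_gt0 : 0 < dl.
Hypothesis dl_nu : forall a, dl <= hmm_nu theta a.
Hypothesis dl_Q : forall a b, dl <= hmm_Q theta a b.
Local Notation f := (hmm_f theta).
Local Notation p := (plawP P X (n := n)).
Local Notation risk := (inf_clust_risk P X Y n).
Local Notation beta := (pair_beta P X n).
Let J_gt0 : (0 < J)%N := ltnW J_gt1.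

Lemma label_number_le : J%:R * dl <= 1.
Proof.
have : \sum_(a < J) dl <= \sum_a hmm_nu theta a by apply: ler_sum.
by rewrite hmm_nu_sum1 sumr_const card_ord mulr_natl.
Qed.

Lemma Lambda_scale k : \int[L]_y (k * fmin theta y) = k * Lambda theta.
Proof.
have [ih _] := sum_fint theta (index_enum 'I_J) (bm_plug_in_neq theta J_gt0).
rewrite RintegralZl//.
rewrite (_ : EFin \o fmin theta =
  EFin \o (fun y => \sum_a (plug_in theta J_gt0 y != a)%:R * f a y))//.
apply/funext => y /=; congr EFin; rewrite (fmin_plug_in theta J_gt0) big_mkcond.
apply: eq_bigr => a _.
by rewrite eq_sym; case: (plug_in theta J_gt0 y == a); rewrite ?mul0r ?mul1r.
Qed.

Lemma Lambda_ge0 : 0 <= Lambda theta.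
Proof. by apply: Rintegral_ge0 => y _; exact: fmin_ge0. Qed.

Lemma Lambda_leJ : Lambda theta <= J%:R.
Proof.
rewrite (Lambda_plug_in theta J_gt0) -[J in J%:R]card_ord -sumr_const.
apply: ler_sum => a _; apply: fint_le_cst; first exact: bm_plug_in_neq.
by move=> y; case: (_ != _); rewrite ?ler01.
Qed.

Section Local.
Variable c0 : R.
Hypothesis c0_ge0 : 0 <= c0.
Hypothesis c0_le : forall (i : 'I_n) a x, c0 <= cp p i a x.
(** Whatever label is guessed, the wrong ones have conditional probability at least [c0] each and
    their densities sum to at least [fmin], so this is an admissible local error density, of
    integral [c0] * [Lambda]. *)
Definition mmin y := c0 * fmin theta y.

Lemma mmin_ge0 y : 0 <= mmin y.
Proof. by rewrite mulr_ge0// fmin_ge0. Qed.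

Lemma measurable_mmin : measurable_fun setT mmin.
Proof. by apply: measurable_funM => //; exact: measurable_fmin. Qed.

Lemma mmin_le (i : 'I_n) x b y : mmin y <= \sum_(a | a != b) cp p i a x * f a y.
Proof.
apply: le_trans (_ : c0 * \sum_(a | a != b) f a y <= _).
  by apply: ler_wpM2l => //; exact: fmin_le.
rewrite mulr_sumr; apply: ler_sum => a _; apply: ler_wpM2r => //; exact: hmm_f_ge0.
Qed.
End Local.

Lemma multi_lower c0 c : 0 <= c0 -> (forall (i : 'I_n) a x, c0 <= cp p i a x) ->
  0 <= c < 1 ->
  (forall g w, (forall a b, g a - g b <= w) -> forall a b,
     \sum_b0 hmm_Q theta a b0 * g b0 - \sum_b0 hmm_Q theta b b0 * g b0 <= c * w) ->
  10 * J%:R * (J%:R - 1) * ((1 + c) / (1 - c)) <= n%:R * beta ->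
  40 * J%:R <= n%:R * beta -> (3 <= J)%N -> c0 * Lambda theta / 4 <= risk.
Proof.
move=> c00 c0le c01 ct h1 h2 J3; rewrite -Lambda_scale.
apply: (multi_risk XY J_gt1 n_gt0 _ _ _ _ _ c01 ct h1 h2).
- by move=> x; exact: (plawP_gt0 XY dl_gt0).
- exact: (mmin_ge0 c00).
- exact: (measurable_mmin c0).
- exact: mmin_le.
- by move=> i j; exact: (plawP_cross XY).
- by rewrite (ler_nat _ 3).
Qed.

Lemma risk_le : risk <= (1 - (J%:R - 1) * dl) * Lambda theta.
Proof. by apply: (risk_upper J_gt0 XY n_gt0) => i a; exact: (label_le XY). Qed.
End Lower.

Section Binary.
Context {R : realType} {dY : measure_display} {TY : measurableType dY}.
Context {L : {measure set TY -> \bar R}} (theta : hmm_param 2 L).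
Context {d : measure_display} {Omega : measurableType d}.
Variables (P : probability Omega R) (X : nat -> Omega -> 'I_2) (Y : nat -> Omega -> TY).
Hypothesis XY : is_hmm P X Y theta.
Variable n : nat.
Hypothesis n_gt0 : (0 < n)%N.
Variable dl : R.
Hypothesis dl_gt0 : 0 < dl.
Hypothesis dl_nu : forall a, dl <= hmm_nu theta a.
Hypothesis dl_Q : forall a b, dl <= hmm_Q theta a b.
Local Notation f := (hmm_f theta).
Local Notation p := (plawP P X (n := n)).
Local Notation risk := (inf_clust_risk P X Y n).

Let p_gt0 x : 0 < p x. Proof. exact: (plawP_gt0 XY dl_gt0). Qed.
Let p_cross (i j : 'I_n) : i != j -> odd i = odd j -> cross p i j.
Proof. exact: (plawP_cross XY). Qed.

Let risk_ge0 : 0 <= risk. Proof. exact: inf_clust_risk_ge0. Qed.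
Let N0 : 0 < n%:R :> R. Proof. by rewrite ltr0n. Qed.

(** The choice s = sqrt(2n) balances the two terms of [binary_dense_risk]. *)
Lemma dense_sqrt (mm : TY -> R) :
  (forall y, 0 <= mm y) -> measurable_fun setT mm ->
  (forall (i : 'I_n) x b y, mm y <= \sum_(a | a != b) cp p i a x * f a y) ->
  n%:R * (\int[L]_y mm y) - Num.sqrt (2 * n%:R) / 2 <= n%:R * risk.
Proof.
move=> h1 h2 h3; pose s := Num.sqrt (2 * n%:R) : R.
have s0 : 0 < s by rewrite sqrtr_gt0 mulr_gt0.
have ss : s ^+ 2 = 2 * n%:R by rewrite sqr_sqrtr// mulr_ge0.
apply: le_trans (binary_dense_risk XY n_gt0 p_gt0 h1 h2 h3 p_cross s0).
rewrite -/s; have -> : n%:R / s = s / 2.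
  apply: (mulIf (x := s)); first by rewrite gt_eqF.
  by rewrite divfK ?gt_eqF// mulrAC -expr2 ss mulrC mulKf.
lra.
Qed.

Lemma ind_lower : Theta_ind theta ->
  (1 - alpha n (epsilon P X Y n)) * dl * Lambda theta <= risk.
Proof.
move=> ind.
have p_iid x : p x = \prod_i hmm_nu theta (x i) by exact: (plawP_iid XY).
rewrite /epsilon (inf_class_risk_bayes XY n_gt0 p_gt0 p_iid).
set r := bayes theta.
pose mm y := Num.min (hmm_nu theta ord0 * f ord0 y) (hmm_nu theta ord_max * f ord_max y).
have nf0 a y : 0 <= hmm_nu theta a * f a y.
  by rewrite mulr_ge0 ?hmm_nu_ge0 ?hmm_f_ge0.
have mm0 y : 0 <= mm y by rewrite le_min !nf0.
have mmf a : measurable_fun setT (fun y => hmm_nu theta a * f a y).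
  by apply: measurable_funM => //; exact: hmm_f_measurable.
have mmm : measurable_fun setT mm by exact: measurable_minr.
have cpE (i : 'I_n) a x : cp p i a x = hmm_nu theta a by exact: (cp_iid XY dl_gt0).
have mm_le (i : 'I_n) x b y : mm y <= \sum_(a | a != b) cp p i a x * f a y.
  rewrite big_mkcond big_ord2 !cpE /mm.
  by elim/ord2P: b => /=; rewrite ?add0r ?addr0 ge_min lexx ?orbT.
(* The smaller of the two weighted densities is at least [dl] times the smaller density, so the
   Bayes error dominates [dl] * [Lambda]. *)
have dr : dl * Lambda theta <= r.
  rewrite -(Lambda_scale theta isT).
  have f0 a y : 0 <= f a y := hmm_f_ge0 theta a y.
  have S_int : L.-integrable setT (EFin \o (fun y => \sum_a f a y)).
    have [h _] := sum_fint theta (index_enum 'I_2) (fun a => bm_cst (1 : R) : bm (fun=> 1)).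
    rewrite (_ : EFin \o _ = EFin \o (fun y => \sum_a 1 * f a y))//.
    by apply/funext => y /=; under [in RHS]eq_bigr => a _ do rewrite mul1r.
  have dom (g : TY -> R) : measurable_fun setT g -> (forall y, 0 <= g y) ->
      (forall y, g y <= \sum_a f a y) -> L.-integrable setT (EFin \o g).
    move=> mg g0 gS; apply: le_integrable S_int => //; first exact/measurable_EFinP.
    by move=> y _; rewrite /= lee_fin !ger0_norm// sumr_ge0.
  have fm0 y : fmin theta y <= f ord0 y.
    by apply: le_trans (fmin_le theta isT ord_max y) _; rewrite big_mkcond big_ord2 /= addr0.
  have fm1 y : fmin theta y <= f ord_max y.
    by apply: le_trans (fmin_le theta isT ord0 y) _; rewrite big_mkcond big_ord2 /= add0r.
  have le1 a : hmm_nu theta a <= 1.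
    rewrite -(hmm_nu_sum1 theta) (bigD1 a)//= lerDl sumr_ge0// => b _.
    exact: hmm_nu_ge0.
  have mmS y : mm y <= \sum_a f a y.
    apply: le_trans (_ : hmm_nu theta ord0 * f ord0 y <= _).
      by rewrite /mm ge_min lexx.
    rewrite big_ord2; apply: le_trans (_ : 1 * f ord0 y <= _).
      by apply: ler_wpM2r.
    by rewrite mul1r lerDl.
  have dmm y : dl * fmin theta y <= mm y.
    have fg0 := fmin_ge0 theta isT y.
    rewrite le_min; apply/andP; split.
      by apply: ler_pM => //; exact: ltW.
    by apply: ler_pM => //; exact: ltW.
  apply: le_Rintegral => //.
    apply: dom.
    - by apply: measurable_funM => //; exact: measurable_fmin.
    - by move=> y; rewrite mulr_ge0 ?(ltW dl_gt0)// fmin_ge0.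
    - by move=> y; exact: le_trans (dmm y) (mmS y).
  exact: dom.
have r0 : 0 <= r by exact: bayes_ge0.
have r1 : r <= 1 / 2 := bayes_le theta.
have := @alpha_bound R n r risk n_gt0 _ risk_ge0 (dense_sqrt mm0 mmm mm_le)
  (chernoff_risk XY n_gt0 p_gt0 p_iid).
rewrite r0 r1 => /(_ isT) H; set al := alpha _ _ in H *.
(* When [alpha] exceeds 1 the claimed lower bound is nonpositive. *)
have [a1|a1] := leP al 1.
  apply: le_trans H; rewrite -mulrA; apply: ler_wpM2l => //; lra.
apply: le_trans risk_ge0; rewrite -mulrA mulr_le0_ge0//; first lra.
by rewrite mulr_ge0 ?(ltW dl_gt0)//; exact: Lambda_ge0.
Qed.

Lemma dep_lower :
  dl ^+ 2 * (1 - alpha_tilde n dl) / (1 - dl) * Lambda theta <= risk.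
Proof.
set al := alpha_tilde n dl; pose c0 := dl ^+ 2 / (1 - dl).
have d12 : dl <= 1 / 2 by have := label_number_le dl_nu; lra.
have c00 : 0 <= c0 by rewrite divr_ge0 ?sqr_ge0//; lra.
have c0le (i : 'I_n) a x : c0 <= cp p i a x by exact: (local_ge_dep XY).
pose t := c0 * Lambda theta.
have -> : dl ^+ 2 * (1 - al) / (1 - dl) * Lambda theta = (1 - al) * t.
  by rewrite /t /c0; ring.
have L0 := Lambda_ge0 theta isT.
have t0 : 0 <= t by rewrite mulr_ge0.
have [a1|a1] := leP 1 al.
  by apply: le_trans risk_ge0; rewrite mulr_le0_ge0//; lra.
have alg : 3 / Num.sqrt n%:R <= al by apply: alpha_tilde_ge; rewrite ?dl_gt0.
have y0 : 0 < Num.sqrt n%:R :> R by rewrite sqrtr_gt0.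
have y3 : 3 < Num.sqrt n%:R :> R.
  by have := le_lt_trans alg a1; rewrite ltr_pdivrMr// mul1r.
have yy : Num.sqrt n%:R ^+ 2 = n%:R :> R by rewrite sqr_sqrtr.
have m0 := mmin_ge0 theta isT c00; have mm := measurable_mmin theta isT c0.
have ml := mmin_le theta isT c00 c0le.
have mint : \int[L]_y mmin theta c0 y = t := Lambda_scale theta isT c0.
apply: le_trans (_ : (1 - 3 / Num.sqrt n%:R) * t <= _).
  by apply: ler_wpM2r => //; lra.
rewrite -(ler_pM2l N0); set y := Num.sqrt n%:R in y0 y3 yy alg *.
(* The threshold is just above sqrt 2 / 6: from there on the dense loss sqrt(2n) / 2 is at most 3 t
   sqrt n. *)
have [tbig|tsmall] := leP (59 / 250) t.
  have := dense_sqrt m0 mm ml; rewrite mint; apply: le_trans.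
  have e2 : Num.sqrt (2 * n%:R) = Num.sqrt 2 * y :> R by rewrite sqrtrM.
  have s2 : Num.sqrt 2 <= 283 / 200 :> R.
    rewrite -[283 / 200]ger0_norm; last lra.
    by rewrite -sqrtr_sqr ler_sqrt; lra.
  rewrite e2 -yy.
  have -> : y ^+ 2 * ((1 - 3 / y) * t) = y ^+ 2 * t - 3 * t * y by field; rewrite gt_eqF.
  have : 0 <= (t - 59 / 250) * y by apply: mulr_ge0; lra.
  have : 0 <= (283 / 200 - Num.sqrt 2) * y by apply: mulr_ge0; lra.
  lra.
have [g0 num] := sparse_numeric y3 t0 (ltW tsmall).
set g := n%:R * (1 / 2 - t) - 1 / 2 in g0 num.
(* With two labels, every other point carries one of the two values, so all n - 1 of them count and
   the event [ok] always holds. The level [s0] divides the gap g between n t and [t1] in the ratio 1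
   to 2. The local error is at most 1/2, which serves as the bound B in the variance term. *)
pose t1 : R := (n%:R - 1) / 2; pose s0 := n%:R * t + g / 3.
have t1s : t1 - s0 = 2 / 3 * g by rewrite /t1 /s0 /g; field.
have mlB (i : 'I_n) x z : mmin theta c0 z <= 1 / 2 * \sum_a cp p i a x * f a z.
  have h0 := ml i x ord0 z; have h1 := ml i x ord_max z.
  move: h0 h1; rewrite big_mkcond big_ord2 /= add0r => h0.
  by rewrite big_mkcond big_ord2 /= addr0 => h1; rewrite big_ord2; lra.
have okp (i : 'I_n) (x : {ffun 'I_n -> 'I_2}) a b : true -> a != b ->
    2 * t1 <= \sum_(j | j != i) ((x j == a) || (x j == b))%:R.
  move=> _ ab; rewrite (eq_bigr (fun=> 1)) => [|j _].
    have : \sum_(j < n) (1 : R) = n%:R by rewrite sumr_const card_ord.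
    by rewrite (bigD1 i)//= /t1; lra.
  by move: ab; elim/ord2P: a; elim/ord2P: b => //= _; elim/ord2P: (x j).
have := @sparse_risk _ _ _ _ _ theta _ _ P X Y XY n isT n_gt0 p_gt0 _ _ m0 mm ml mlB
  p_cross (fun _ _ => true) s0 t1 _ (fun _ _ _ => erefl) okp.
rewrite -[local_mass _]/(\int[L]_y mmin theta c0 y) mint t1s.
have h12 : 0 <= 1 / 2 :> R by lra.
have a2 : n%:R * t < s0 by rewrite /s0; lra.
have a3 : s0 < t1 by rewrite -subr_gt0 t1s; lra.
move=> /(_ h12 a2 a3); apply: le_trans.
have -> : \sum_(i < n) \sum_x p x * true%:R = n%:R.
  rewrite (eq_bigr (fun=> 1)) => [|i _]; first by rewrite sumr_const card_ord.
  rewrite -[RHS](plawP_sum1 XY n); apply: eq_bigr => x _; exact: mulr1.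
have -> : s0 - n%:R * t = g / 3 by rewrite /s0; ring.
have -> : t * n%:R - n%:R * t / (2 / 3 * g) - n%:R * (t * (1 / 2 - t)) / (2 * (g / 3)) =
    n%:R * t * (1 - 3 / 2 * (1 + (1 / 2 - t)) / g) by field; rewrite gt_eqF.
rewrite [(1 - 3 / y) * t]mulrC mulrA; apply: ler_wpM2l; last lra.
by rewrite mulr_ge0.
Qed.
End Binary.

Theorem corollary4 (R : realType) (J : nat) (J_ge2 : (2 <= J)%N)
    (TY : ptopologicalType) (TY_polish : polish R TY)
    (L : {sigma_finite_measure set (borel TY) -> \bar R})
    (theta : hmm_param J L)
    (d : measure_display) (Omega : measurableType d) (P : probability Omega R)
    (X : nat -> Omega -> 'I_J) (Y : nat -> Omega -> borel TY)
    (XY_hmm : is_hmm P X Y theta)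
    (n : nat) (n_ge1 : (1 <= n)%N) :
  let delta := minQ theta in
  let Lam := Lambda theta in
  let b := pair_beta P X n in
  let r0 := rho0 J delta in
  let risk := inf_clust_risk P X Y n in
  0 < delta -> delta <= minnu theta ->
  [/\ J = 2%N ->
        (Theta_ind theta -> (2 <= n)%N ->
           (1 - alpha n (epsilon P X Y n)) * delta * Lam <= risk /\
           risk <= (1 - delta) * Lam) /\
        (Theta_dep theta ->
           delta ^+ 2 * (1 - alpha_tilde n delta) / (1 - delta) * Lam <= risk /\
           risk <= (1 - delta) * Lam),
      (2 < J)%N -> Theta_ind theta ->
        4 * J%:R ^+ 2 * expR (- (n%:R * b / 8)) <= delta * Lam ->
        xi J n b <= 2^-1 ->
        delta / 4 * Lam <= risk /\
        risk <= (1 - (J%:R - 1) * delta) * Lam &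
      (2 < J)%N -> Theta_dep theta ->
        4 * (1 - (J%:R - 1) * delta) * (J%:R ^+ 2 + 1) *
          expR (- (2 * n%:R * (1 - r0) ^+ 2 * b ^+ 2 / 25))
          <= delta ^+ 2 * Lam ->
        xi_tilde J n b r0 <= 2^-1 ->
        delta ^+ 2 / (4 * (1 - delta)) * Lam <= risk /\
        risk <= (1 - (J%:R - 1) * delta) * Lam].
Proof.
move=> delta Lam b r0 risk dl0 dnu.
have J_gt0 : (0 < J)%N := ltnW J_ge2.
have dl_nu a : delta <= hmm_nu theta a.
  apply: le_trans dnu _; apply: ge_inf; last by exists a.
  by exists 0 => _ [c _ <-]; exact: hmm_nu_ge0.
have dl_Q a c : delta <= hmm_Q theta a c.
  apply: ge_inf; last by exists (a, c).
  by exists 0 => _ [[? ?] _ <-]; exact: hmm_Q_ge0.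
have upper : risk <= (1 - (J%:R - 1) * delta) * Lam by exact: (risk_le XY_hmm).
have Jd : J%:R * delta <= 1 by exact: label_number_le dl_nu.
have b2 : 2 * delta <= b by exact: (pair_beta_ge XY_hmm).
have b0 : 0 < b by apply: lt_le_trans b2; rewrite mulr_gt0.
have Jb : J%:R * b <= 2 by exact: (pair_beta_upper XY_hmm).
split.
- move=> J2; subst J.
  have up2 : risk <= (1 - delta) * Lam.
    by move: upper; rewrite (_ : (2%:R - 1) * delta = delta)//; ring.
  split=> [ind _|_]; split=> //; first exact: (ind_lower XY_hmm).
  exact: (dep_lower XY_hmm).
- move=> J3 ind h1 h2; split=> //.
  have L1 : delta * Lam <= 1.
    apply: le_trans Jd; rewrite [leRHS]mulrC ler_pM2l//.
    exact: Lambda_leJ.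
  (* If n b < 4, the exponential is at least 1/2 and the assumed lower bound on delta * [Lam] would
     be at least 18, although delta * [Lam] <= 1. *)
  have nb : 4 <= n%:R * b.
    rewrite leNgt; apply/negP => nb4.
    have := expR_ge1Dx (- (n%:R * b / 8)); set e := expR _ in h1 * => he.
    have J9 : 9 <= J%:R ^+ 2 :> R by rewrite -natrX (ler_nat _ 9) (leq_sqr 3).
    have : 9 * (1 / 2) <= J%:R ^+ 2 * e by apply: ler_pM => //; lra.
    lra.
  have [c1 c2] := xi_conditions J3 n_ge1 b0 Jb nb h2.
  (* Independent labels have conditional probabilities nu_a >= delta given all the others, and their
     transitions erase all oscillation, so c = 0. *)
  rewrite mulrAC; apply: (multi_lower XY_hmm J_ge2 n_ge1 dl0 dl_nu dl_Q (c := 0)) => //.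
  + exact: ltW.
  + by move=> i a x; rewrite (cp_iid XY_hmm dl0).
  + by rewrite lexx ltr01.
  + exact: contraction_ind.
  + by rewrite addr0 subr0 divr1 mulr1.
move=> J3 dep _ h2; split=> //.
have [c1 c2] := xi_tilde_conditions J3 n_ge1 b0 Jb dl0 Jd h2.
have J3' : 3 <= J%:R :> R by rewrite (ler_nat _ 3).
have d1 : delta < 1.
  have : 0 <= (J%:R - 3) * delta by apply: mulr_ge0; lra.
  lra.
have -> : delta ^+ 2 / (4 * (1 - delta)) * Lam = delta ^+ 2 / (1 - delta) * Lam / 4.
  by field; rewrite subr_eq0 gt_eqF.
(* Dependent labels have conditional probabilities at least delta^2 / (1 - delta), and Doeblin's
   condition gives the contraction constant 1 - J delta. *)
apply: (multi_lower XY_hmm J_ge2 n_ge1 dl0 dl_nu dl_Q (c := 1 - J%:R * delta)) => //.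
- by rewrite divr_ge0 ?sqr_ge0// subr_ge0 ltW.
- by move=> i a x; exact: (local_ge_dep XY_hmm).
- by rewrite subr_ge0 Jd ltrBlDr ltrDl mulr_gt0// ltr0n.
- exact: contraction_dep.
Qed.
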